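(* Let $r\in\mathbb N$. There exists a constant $C_r>0$ depending only on $r$ such that the following holds. Let $n,m\in\mathbb N$, $p\in(0,1)$, let $A^{(1)},\ldots,A^{(n)}$ be the attribute vectors of $\mathcal G(n,m,p)$, let $h\in L^4\big((\{0,1\}^m)^r,\mu_{m,p}^{\otimes r}\big)$ be symmetric and $X=\sum_{1\le k_1<\cdots<k_r\le n}h(A^{(k_1)},\ldots,A^{(k_r)})$. Then, with $\mathcal N\sim\mathcal N(0,1)$, $$d_{K/W}\left(\frac{X-\mathbb E[X]}{\sqrt{\operatorname{Var}[X]}},\mathcal N\right)\le \frac{C_r n^{2r}}{\operatorname{Var}[X]}\Bigg(\sum_{0\le i<j\le r}\frac{\|\tilde h_j\ast_j^i\tilde h_j\|_2^2}{n^{3j-i}}+\sum_{1\le i<j\le r}\Big(\frac{\|\tilde h_j\ast_i^i\tilde h_j\|_2^2}{n^{2j}}+\frac{\|\tilde h_j\ast_i^i\tilde h_i\|_2^2}{n^{j+i}}\Big)\Bigg)^{1/2},$$ where $h_j(x_1,\ldots,x_j)=\int_{(\{0,1\}^m)^{r-j}}h(x_1,\ldots,x_r)\,d\mu_{m,p}^{\otimes(r-j)}(x_{j+1},\ldots,x_r)$ and $\tilde h_j=\Phi_{x_1}\cdots\Phi_{x_j}h_j$ is the coordinate-wise centralization of $h_j$.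
   Context: Random intersection graph $\mathcal G(n,m,p)$: vertices $v_1,\ldots,v_n$, attributes $a_1,\ldots,a_m$, each vertex chooses each attribute independently with probability $p$; $A^{(k)}\in\{0,1\}^m$ has $i$-th coordinate the indicator that $v_k$ chose $a_i$, so the $A^{(k)}$ are i.i.d. with law $\mu_{m,p}(x)=p^{|x|}(1-p)^{m-|x|}$, $|x|=\sum_ix_i$. Norms are $L^2$ norms with respect to the appropriate product of $\mu_{m,p}$. Coordinate centralization: $\Phi_{x_i}f(x)=f(x)-\int_{\{0,1\}^m}f(x)\,d\mu_{m,p}(x_i)$. Contraction: for $f$ on $(\{0,1\}^m)^k$, $g$ on $(\{0,1\}^m)^l$, $0\le a\le b\le k\wedge l$: $f\ast_b^ag(x_1,\ldots,x_{b-a},y_1,\ldots,y_{k-b},z_1,\ldots,z_{l-b})=\int_{(\{0,1\}^m)^a}f(w,x,y)g(w,x,z)\,d\mu_{m,p}^{\otimes a}(w)$. $d_K(X,Y)=\sup_t|\mathbb P(X\le t)-\mathbb P(Y\le t)|$, $d_W(X,Y)=\sup_{\mathrm{Lip}(\phi)\le1}|\mathbb E[\phi(X)-\phi(Y)]|$, $d_{K/W}=\max\{d_K,d_W\}$. *)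

(* Defs.v *)
From HB Require Import structures.
From mathcomp Require Import all_boot all_order all_algebra.
From mathcomp Require Import all_classical all_reals all_analysis.
From mathcomp Require Import normal_distribution.
From mathcomp Require Import fingroup perm.
Set Implicit Arguments. Unset Strict Implicit. Unset Printing Implicit Defensive.
Import Order.TTheory GRing.Theory Num.Theory.
Local Open Scope ring_scope.

Section RIG.
Variables (R : realType) (m : nat) (p : R).

Definition attr := {ffun 'I_m -> bool}.

Definition attr_size (x : attr) : nat := #|[set i | x i]|.

Definition mu (x : attr) : R := p ^+ attr_size x * (1 - p) ^+ (m - attr_size x).

Definition muprod (s : seq attr) : R := \prod_(a <- s) mu a.

(* Functions of several attribute vectors are represented as functions on
   sequences; a function "of d variables" is only ever evaluated on
   sequences of length d. *)
Definition mfun := seq attr -> R.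

Definition l2norm (d : nat) (f : mfun) : R :=
  Num.sqrt (\sum_(t : d.-tuple attr) muprod t * f t ^+ 2).

Definition centr (i : nat) (f : mfun) : mfun := fun s =>
  f s - \sum_(a : attr) mu a * f (set_nth a s i a).

(* contraction  f *_b^a g  for f of k variables and g of l variables:
   output variables are (x_1..x_{b-a}, y_1..y_{k-b}, z_1..z_{l-b}) *)
Definition contr (a b k : nat) (f g : mfun) : mfun := fun s =>
  let x := take (b - a) s in
  let yz := drop (b - a) s in
  \sum_(w : a.-tuple attr)
     muprod w * (f (w ++ x ++ take (k - b) yz) * g (w ++ x ++ drop (k - b) yz)).

End RIG.

Section Ustat.
Variables (R : realType) (m : nat) (p : R) (r : nat).

Definition kern (h : r.-tuple (attr m) -> R) : mfun R m := fun s =>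
  if insub s is Some t then h t else 0.

Definition symmetric_kernel (h : r.-tuple (attr m) -> R) : Prop :=
  forall (t : r.-tuple (attr m)) (s : 'S_r),
    h [tuple tnth t (s i) | i < r] = h t.

Definition hproj (h : r.-tuple (attr m) -> R) (j : nat) : mfun R m := fun s =>
  \sum_(t : (r - j).-tuple (attr m)) muprod p t * kern h (s ++ t).

Definition htilde (h : r.-tuple (attr m) -> R) (j : nat) : mfun R m :=
  foldr (fun i f => centr p i f) (hproj h j) (iota 0 j).

End Ustat.

Section Graph.
Variables (R : realType) (n m : nat) (p : R) (r : nat).

Definition config := {ffun 'I_n -> attr m}.

Definition config_prob (c : config) : R := \prod_(k < n) mu p (c k).

Definition strictly_incr (k : {ffun 'I_r -> 'I_n}) : bool :=
  [forall i : 'I_r, forall j : 'I_r, (i < j)%N ==> (k i < k j)%N].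

Definition Ustat (h : r.-tuple (attr m) -> R) (c : config) : R :=
  \sum_(k : {ffun 'I_r -> 'I_n} | strictly_incr k) h [tuple c (k i) | i < r].

Definition rig_mean (Y : config -> R) : R := \sum_(c : config) config_prob c * Y c.
Definition rig_var (Y : config -> R) : R := rig_mean (fun c => (Y c - rig_mean Y) ^+ 2).

Definition standardize (Y : config -> R) : config -> R :=
  fun c => (Y c - rig_mean Y) / Num.sqrt (rig_var Y).

Definition prob_le (Y : config -> R) (t : R) : R :=
  \sum_(c : config | Y c <= t) config_prob c.

End Graph.

(* d_{K/W}(Y, N(0,1)) <= B, written out: the Kolmogorov part and the
   Wasserstein part (sup over 1-Lipschitz test functions) are both <= B. *)
Definition dKW_normal_le (R : realType) (n m : nat) (p : R)
    (Y : config n m -> R) (B : R) : Prop :=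
  (forall t : R,
     (`| (prob_le p Y t)%:E - normal_prob 0 1 `]-oo, t]%classic | <= B%:E)%E) /\
  (forall phi : R -> R, (forall x y, `|phi x - phi y| <= `|x - y|) ->
     (`| (rig_mean p (fun c => phi (Y c)))%:E
         - \int[normal_prob (0:R) 1]_x (phi x)%:E | <= B%:E)%E).

(* Main.v *)
(** After a Hoeffding decomposition the standardized statistic is a sum W of
    degenerate components indexed by nonempty sets of at most r vertices.  For a
    nonincreasing test function h the Stein solution f makes w f(w) - h(w)
    nondecreasing, so the Taylor error made when one vertex is resampled is bounded
    by an increment of a monotone function; exchanging the two copies of that vertex
    turns the error into second moments of quadratic forms in the components.  No
    smoothness of h enters, so that ramps give the Kolmogorov distance and
    h(x) = phi(x) - x the Wasserstein distance, both with the same bound.  The second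
    moments are sums of fourth moments over linked quadruples of index sets; by the
    Cauchy-Schwarz inequality these are controlled by contraction norms, each of which
    is dominated by those in the theorem, and counting quadruples by the size of their
    union produces the powers of n. *)

Require Import Defs.
From HB Require Import structures.
From mathcomp Require Import all_boot all_order all_algebra.
From mathcomp Require Import fingroup perm.
From mathcomp Require Import ring lra zify.
From mathcomp Require Import reals.
Set Implicit Arguments. Unset Strict Implicit. Unset Printing Implicit Defensive.
Import Order.TTheory GRing.Theory Num.Theory.
Local Open Scope ring_scope.

(** * Product spaces and resampling *)

(** Giving the component of J the weight 1/|J| in [usum k] writes W as a sum over vertices of terms
    centered in one vertex each, and makes Z = sum_k [usum k] * [vsum k] have mean exactly Var W =
    1. The first error is thus a genuine variance, in which unlinked quadruples cancel. The obstacle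
    is the second error: it carries |[usum k]|, and the absolute value destroys the polynomial
    structure, so that only the centering in vertex k survives. This is enough: for two vertices k
    and l, the part of [Tsum k] built without the components through l is orthogonal to [Tsum l],
    and what is left carries a factor of components through both, so that summing over l costs no
    factor n. The powers of n then balance exactly: a vertex covered by only one of the four sets
    kills the moment, and a vertex seen by only one pair is integrated before Cauchy-Schwarz, so the
    exponents of the two conditional moments add up to twice the size of the union. Linkage keeps
    out the fully integrated square, a fourth power of the norm of [htilde], which the bound does
    not contain. *)

Section WeightedSums.
Variables (R : realFieldType) (I : finType) (w : I -> R).
Hypothesis w_ge0 : forall i, 0 <= w i.

(** Lagrange's identity: the difference of the two sides is half the weighted sum of the squared
    minors [x i * y j - x j * y i]. *)
Lemma sum_cauchy_schwarz (x y : I -> R) :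
  (\sum_i w i * (x i * y i)) ^+ 2
    <= (\sum_i w i * x i ^+ 2) * (\sum_i w i * y i ^+ 2).
Proof.
rewrite -subr_ge0.
suff -> : (\sum_i w i * x i ^+ 2) * (\sum_i w i * y i ^+ 2) -
    (\sum_i w i * (x i * y i)) ^+ 2
  = 2^-1 * \sum_i \sum_j w i * w j * (x i * y j - x j * y i) ^+ 2.
  rewrite mulr_ge0 ?invr_ge0//; apply: sumr_ge0 => i _; apply: sumr_ge0 => j _.
  by apply: mulr_ge0; [exact: mulr_ge0|exact: sqr_ge0].
have e i j : w i * w j * (x i * y j - x j * y i) ^+ 2
    = w i * x i ^+ 2 * (w j * y j ^+ 2) - 2 * (w i * (x i * y i) * (w j * (x j * y j)))
     + w i * y i ^+ 2 * (w j * x j ^+ 2) by ring.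
under [in RHS]eq_bigr => i _ do under eq_bigr => j _ do rewrite e.
under [in RHS]eq_bigr => i _ do rewrite big_split sumrB -!mulr_sumr.
rewrite big_split sumrB -mulr_sumr -!mulr_suml expr2 /=; lra.
Qed.

Lemma sum_jensen_sqr (x : I -> R) : \sum_i w i = 1 ->
  (\sum_i w i * x i) ^+ 2 <= \sum_i w i * x i ^+ 2.
Proof.
move=> w1; have := sum_cauchy_schwarz x (fun=> 1).
under eq_bigr do rewrite mulr1.
under [X in _ <= _ * X -> _]eq_bigr do rewrite expr1n mulr1.
by rewrite w1 mulr1.
Qed.
End WeightedSums.

Section ProductSpace.
Variables (R : realType) (n : nat) (T : finType) (w : T -> R).
Hypotheses (w_ge0 : forall a, 0 <= w a) (w_sum1 : \sum_a w a = 1).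

Local Notation conf := {ffun 'I_n -> T}.
Implicit Types (S J : {set 'I_n}) (c : conf) (F G : conf -> R).
Implicit Types (kap : 'I_n -> T -> T -> R).

Definition prodw c : R := \prod_k w (c k).
Definition expect F : R := \sum_(c : conf) prodw c * F c.

(* The operator with product kernel [kap]; conditional expectations, centralizations
   and Hoeffding projections are all of this form, and composition is coordinatewise. *)
Definition kerw kap c c' : R := \prod_k kap k (c k) (c' k).
Definition kop kap F c : R := \sum_(c' : conf) kerw kap c c' * F c'.

Definition dirac (a b : T) : R := (a == b)%:R.
Definition resample S k (a b : T) : R := if k \in S then w b else dirac a b.
(** [S] is the set of coordinates integrated out, so this is the conditional expectation given the
    coordinates outside [S]; [indep_of] below follows the same convention. *)
Definition cexp S := kop (resample S).

Lemma sum_prod_kernel (f : 'I_n -> T -> R) :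
  \sum_(c : conf) \prod_k f k (c k) = \prod_k \sum_a f k a.
Proof. by rewrite bigA_distr_bigA. Qed.

Lemma prodw_ge0 c : 0 <= prodw c.
Proof. exact: prodr_ge0. Qed.

Lemma prodw_sum1 : \sum_(c : conf) prodw c = 1.
Proof. by rewrite (sum_prod_kernel (fun=> w)) big1. Qed.

Lemma kop_comp kap kap' F c :
  kop kap (kop kap' F) c = kop (fun k a b => \sum_d kap k a d * kap' k d b) F c.
Proof.
rewrite /kop; under eq_bigr do rewrite mulr_sumr; rewrite exchange_big/=.
apply: eq_bigr => c'' _; under eq_bigr do rewrite mulrA; rewrite -mulr_suml.
congr (_ * _); rewrite /kerw -(sum_prod_kernel (fun k d => kap k (c k) d * kap' k d (c'' k))).
by apply: eq_bigr => c' _; rewrite big_split.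
Qed.

Lemma eq_kop kap kap' F : (forall k a b, kap k a b = kap' k a b) ->
  kop kap F =1 kop kap' F.
Proof.
by move=> e c; apply: eq_bigr => c' _; congr (_ * _); apply: eq_bigr => k _.
Qed.

Lemma eq_kop_fun kap F G : F =1 G -> kop kap F =1 kop kap G.
Proof. by move=> e c; apply: eq_bigr => c' _; rewrite e. Qed.

Lemma eq_expect F G : F =1 G -> expect F = expect G.
Proof. by move=> e; apply: eq_bigr => c' _; rewrite e. Qed.

Lemma kop_sum kap (I : Type) (s : seq I) (P : pred I) (F : I -> conf -> R) c :
  kop kap (fun c' => \sum_(i <- s | P i) F i c') c = \sum_(i <- s | P i) kop kap (F i) c.
Proof.
by rewrite /kop; under eq_bigr do rewrite mulr_sumr; rewrite exchange_big.
Qed.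

Lemma kopZ kap x F c : kop kap (fun c' => x * F c') c = x * kop kap F c.
Proof. by rewrite /kop mulr_sumr; apply: eq_bigr => c' _; rewrite mulrCA. Qed.

Lemma kopD kap F G c : kop kap (fun c' => F c' + G c') c = kop kap F c + kop kap G c.
Proof. by rewrite /kop -big_split; apply: eq_bigr => c' _; rewrite mulrDr. Qed.

Lemma kopB kap F G c : kop kap (fun c' => F c' - G c') c = kop kap F c - kop kap G c.
Proof. by rewrite /kop -sumrB; apply: eq_bigr => c' _; rewrite mulrBr. Qed.

Lemma expect_sum (I : Type) (s : seq I) (P : pred I) (F : I -> conf -> R) :
  expect (fun c' => \sum_(i <- s | P i) F i c') = \sum_(i <- s | P i) expect (F i).
Proof.
by rewrite /expect; under eq_bigr do rewrite mulr_sumr; rewrite exchange_big.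
Qed.

Lemma expectZ x F : expect (fun c' => x * F c') = x * expect F.
Proof. by rewrite /expect mulr_sumr; apply: eq_bigr => c' _; rewrite mulrCA. Qed.

Lemma expectD F G : expect (fun c' => F c' + G c') = expect F + expect G.
Proof. by rewrite /expect -big_split; apply: eq_bigr => c' _; rewrite mulrDr. Qed.

Lemma expectB F G : expect (fun c' => F c' - G c') = expect F - expect G.
Proof. by rewrite /expect -sumrB; apply: eq_bigr => c' _; rewrite mulrBr. Qed.

Lemma expect_cst x : expect (fun=> x) = x.
Proof. by rewrite /expect -mulr_suml prodw_sum1 mul1r. Qed.

Lemma le_expect F G : (forall c, F c <= G c) -> expect F <= expect G.
Proof. by move=> FG; apply: ler_sum => c _; rewrite ler_wpM2l ?prodw_ge0. Qed.

Lemma expect_ge0 F : (forall c, 0 <= F c) -> 0 <= expect F.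
Proof. by move=> F0; apply: sumr_ge0 => c _; rewrite mulr_ge0 ?prodw_ge0. Qed.

Lemma expect_CS F G : (expect (fun c => F c * G c)) ^+ 2
  <= expect (fun c => F c ^+ 2) * expect (fun c => G c ^+ 2).
Proof. exact: sum_cauchy_schwarz prodw_ge0 F G. Qed.

Lemma dirac_suml (f : T -> R) a : \sum_d dirac a d * f d = f a.
Proof.
rewrite (bigD1 a)//= /dirac eqxx mul1r big1 ?addr0// => d /negbTE.
by rewrite eq_sym => ->; rewrite mul0r.
Qed.

Lemma dirac_sumr (f : T -> R) b : \sum_d f d * dirac d b = f b.
Proof.
rewrite (bigD1 b)//= /dirac eqxx mulr1 big1 ?addr0// => d /negbTE ->.
by rewrite mulr0.
Qed.

Lemma kop_dirac F c : kop (fun=> dirac) F c = F c.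
Proof.
rewrite /kop (bigD1 c)//= {1}/kerw big1 ?mul1r => [|k _]; last by rewrite /dirac eqxx.
rewrite big1 ?addr0// => c' /eqP c'c.
have [k ck] : exists k, c k != c' k.
  apply/existsP; rewrite -negb_forall; apply/negP => /forallP h.
  by apply: c'c; apply/ffunP => k; rewrite (eqP (h k)).
by rewrite /kerw (bigD1 k)//= /dirac (negbTE ck) !mul0r.
Qed.

Lemma resample_ge0 S k a b : 0 <= resample S k a b.
Proof. by rewrite /resample /dirac; case: ifP. Qed.

Lemma kerw_resample_ge0 S c c' : 0 <= kerw (resample S) c c'.
Proof. by apply: prodr_ge0 => k _; exact: resample_ge0. Qed.

Lemma resample_sum1 S k a : \sum_b resample S k a b = 1.
Proof.
rewrite /resample; case: (k \in S); first exact: w_sum1.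
by rewrite -[RHS](dirac_suml (fun=> 1) a); apply: eq_bigr => b _; rewrite mulr1.
Qed.

Lemma kerw_resample_sum1 S c : \sum_(c' : conf) kerw (resample S) c c' = 1.
Proof.
rewrite (sum_prod_kernel (fun k => resample S k (c k))) big1// => k _.
exact: resample_sum1.
Qed.

(** Detailed balance: resampling is reversible for the product measure. The self-adjointness of
    [cexp] and the exchangeability of a configuration with its resampled copy both come from it. *)
Lemma kerw_resample_sym S c c' :
  prodw c * kerw (resample S) c c' = prodw c' * kerw (resample S) c' c.
Proof.
rewrite /prodw /kerw -!big_split; apply: eq_bigr => k _ /=.
rewrite /resample /dirac; case: ifP => _; first by rewrite mulrC.
by rewrite eq_sym; case: eqP => [->|]; rewrite ?mulr0.
Qed.

Lemma kerw_resample_agree S c c' :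
  kerw (resample S) c c' != 0 -> forall k, k \notin S -> c k = c' k.
Proof.
move=> h k kS; apply/eqP; apply: contraNT h => ck.
by rewrite /kerw (bigD1 k)//= /resample (negbTE kS) /dirac (negbTE ck) mul0r.
Qed.

Lemma cexp_cexp S S' F : cexp S (cexp S' F) =1 cexp (S :|: S') F.
Proof.
move=> c; rewrite /cexp kop_comp; apply: eq_kop => k a b.
rewrite /resample inE; case: (k \in S) => /=; case: (k \in S').
- by rewrite -mulr_suml w_sum1 mul1r.
- by rewrite dirac_sumr.
- by rewrite (dirac_suml (fun=> w b)).
- by rewrite dirac_sumr.
Qed.

Lemma cexpT F c : cexp setT F c = expect F.
Proof.
apply: eq_bigr => c' _; congr (_ * _); apply: eq_bigr => k _.
by rewrite /resample inE.
Qed.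

Lemma expect_adjoint S F G :
  expect (fun c => cexp S F c * G c) = expect (fun c => F c * cexp S G c).
Proof.
rewrite /expect /cexp /kop.
transitivity (\sum_(c : conf) \sum_(c' : conf) prodw c * kerw (resample S) c c' * (F c' * G c)).
  by apply: eq_bigr => c _; rewrite mulr_suml mulr_sumr; apply: eq_bigr => c' _; ring.
rewrite exchange_big/=; apply: eq_bigr => c _; rewrite !mulr_sumr.
by apply: eq_bigr => c' _; rewrite -kerw_resample_sym; ring.
Qed.

Lemma expect_cexp S F : expect (cexp S F) = expect F.
Proof.
have := expect_adjoint S F (fun=> 1).
rewrite (eq_expect (_ : _ =1 cexp S F)) => [->|c]; last by rewrite mulr1.
apply: eq_expect => c; rewrite /cexp /kop.
by under eq_bigr do rewrite mulr1; rewrite kerw_resample_sum1 mulr1.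
Qed.

Lemma cexp_jensen S F c : (cexp S F c) ^+ 2 <= cexp S (fun c => F c ^+ 2) c.
Proof.
exact: (sum_jensen_sqr (kerw_resample_ge0 S c) F (kerw_resample_sum1 S c)).
Qed.

Lemma le_cexp S F G c : (forall c, F c <= G c) -> cexp S F c <= cexp S G c.
Proof. by move=> FG; apply: ler_sum => c' _; rewrite ler_wpM2l ?kerw_resample_ge0. Qed.

Lemma cexp_ge0 S F c : (forall c, 0 <= F c) -> 0 <= cexp S F c.
Proof. by move=> F0; apply: sumr_ge0 => c' _; rewrite mulr_ge0 ?kerw_resample_ge0. Qed.

Lemma norm_cexp S F c : `|cexp S F c| <= cexp S (fun c => `|F c|) c.
Proof.
apply: le_trans (ler_norm_sum _ _ _) _; apply: ler_sum => c' _.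
by rewrite normrM ger0_norm ?kerw_resample_ge0.
Qed.

Lemma cexp_cst S x c : cexp S (fun=> x) c = x.
Proof. by rewrite /cexp /kop -mulr_suml kerw_resample_sum1 mul1r. Qed.

Definition indep_of S F := forall c c', (forall k, k \notin S -> c k = c' k) -> F c = F c'.

Lemma indep_ofS S S' F : S' \subset S -> indep_of S F -> indep_of S' F.
Proof.
by move=> sub i c c' e; apply: i => k kS; apply: e; apply: contraNN kS; exact: subsetP.
Qed.

Lemma indep_ofM S F G : indep_of S F -> indep_of S G -> indep_of S (fun c => F c * G c).
Proof. by move=> iF iG c c' e; rewrite (iF _ _ e) (iG _ _ e). Qed.

Lemma cexpMl S F G c : indep_of S F -> cexp S (fun c => F c * G c) c = F c * cexp S G c.
Proof.
move=> i; rewrite /cexp /kop mulr_sumr; apply: eq_bigr => c' _.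
have [->|/kerw_resample_agree e] := eqVneq (kerw (resample S) c c') 0.
  by rewrite !mul0r mulr0.
by rewrite (i c c' e); ring.
Qed.

Lemma cexp_id S F : indep_of S F -> cexp S F =1 F.
Proof.
move=> i c; have := cexpMl (fun=> 1) c i; rewrite cexp_cst mulr1 => <-.
by apply: eq_kop_fun => c'; rewrite mulr1.
Qed.

(** As [F] ignores [S'], averaging over [S :|: S'] gives the same function as averaging over [S],
    and the larger average reads no coordinate of the union. *)
Lemma cexp_indep S S' F : indep_of S' F -> indep_of (S :|: S') (cexp S F).
Proof.
move=> i c c' e.
have cS d : cexp S F d = cexp (S :|: S') F d.
  by rewrite -cexp_cexp; apply: eq_kop_fun => d'; rewrite cexp_id.
rewrite !cS.
apply: eq_bigr => d _; congr (_ * _); apply: eq_bigr => k _.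
by rewrite /resample; case: ifPn => // kS; rewrite e.
Qed.

Lemma expect_sqr_cexp_le S F : expect (fun c => cexp S F c ^+ 2) <= expect (fun c => F c ^+ 2).
Proof.
by rewrite -(expect_cexp S (fun c => F c ^+ 2)); apply: le_expect => c; exact: cexp_jensen.
Qed.

(** Expectation over the exchangeable pair made of a configuration and the copy in which vertex [k]
    is redrawn. *)
Definition product_pair k (Phi : conf -> conf -> R) : R :=
  \sum_(c : conf) prodw c * \sum_(c' : conf) kerw (resample [set k]) c c' * Phi c c'.

Lemma product_pair_flip k Phi : product_pair k Phi = product_pair k (fun c c' => Phi c' c).
Proof.
rewrite /product_pair.
under eq_bigr do rewrite mulr_sumr; under [RHS]eq_bigr do rewrite mulr_sumr.
rewrite exchange_big/=; apply: eq_bigr => c _; apply: eq_bigr => c' _.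
by rewrite !mulrA kerw_resample_sym.
Qed.

Lemma product_pairD k Phi Psi :
  product_pair k (fun c c' => Phi c c' + Psi c c') = product_pair k Phi + product_pair k Psi.
Proof.
rewrite /product_pair -big_split/=; apply: eq_bigr => c _.
rewrite -mulrDr -big_split/=; congr (_ * _).
by apply: eq_bigr => c' _; rewrite mulrDr.
Qed.

Lemma product_pairN k Phi : product_pair k (fun c c' => - Phi c c') = - product_pair k Phi.
Proof.
rewrite /product_pair -sumrN/=; apply: eq_bigr => c _; rewrite -mulrN -sumrN/=; congr (_ * _).
by apply: eq_bigr => c' _; rewrite mulrN.
Qed.

Lemma eq_product_pair k Phi Psi :
  (forall c c', (forall l, l != k -> c l = c' l) -> Phi c c' = Psi c c') ->
  product_pair k Phi = product_pair k Psi.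
Proof.
move=> e; apply: eq_bigr => c _; congr (_ * _); apply: eq_bigr => c' _.
have [->|/kerw_resample_agree h] := eqVneq (kerw (resample [set k]) c c') 0.
  by rewrite !mul0r.
by rewrite e// => l lk; apply: h; rewrite inE.
Qed.

Lemma norm_product_pair k Phi Psi :
  (forall c c', (forall l, l != k -> c l = c' l) -> `|Phi c c'| <= Psi c c') ->
  `|product_pair k Phi| <= product_pair k Psi.
Proof.
move=> e; apply: le_trans (ler_norm_sum _ _ _) _; apply: ler_sum => c _.
rewrite normrM (ger0_norm (prodw_ge0 _)) ler_wpM2l ?prodw_ge0//.
apply: le_trans (ler_norm_sum _ _ _) _; apply: ler_sum => c' _.
have [->|/kerw_resample_agree h] := eqVneq (kerw (resample [set k]) c c') 0.
  by rewrite !mul0r normr0.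
rewrite normrM (ger0_norm (kerw_resample_ge0 _ _ _)) ler_wpM2l ?kerw_resample_ge0//.
by apply: e => l lk; apply: h; rewrite inE.
Qed.

Lemma product_pairM k F G : product_pair k (fun c c' => F c * G c') =
  expect (fun c => F c * cexp [set k] G c).
Proof.
apply: eq_bigr => c _; congr (_ * _); rewrite mulr_sumr.
by apply: eq_bigr => c' _; rewrite mulrCA.
Qed.

Lemma product_pairl k F : product_pair k (fun c _ => F c) = expect F.
Proof.
apply: eq_bigr => c _; rewrite -mulr_suml kerw_resample_sum1 ?mul1r//.
Qed.

Lemma expect_orth S F G : indep_of S F -> cexp S G =1 (fun=> 0) ->
  expect (fun c => F c * G c) = 0.
Proof.
move=> iF G0; rewrite -(expect_cexp S) -(expect_cst 0).
by apply: eq_expect => c; rewrite cexpMl// G0 mulr0.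
Qed.

(** * The centered quadratic remainder at one vertex *)

Section Tterm.
Variable k : 'I_n.
Local Notation Ek := (cexp [set k]).

(* The expectation of [(|a c| + |a c'|) * (b c - b c')] over the resampled
   configuration [c'], when [b] is centered in coordinate [k]. *)
Definition tterm (a b : conf -> R) c : R :=
  `|a c| * b c + Ek (fun c => `|a c|) c * b c - Ek (fun c => `|a c| * b c) c.

(** The first and last terms form a function minus its conditional mean, and the middle one is [b]
    times a factor that does not read coordinate [k]. This centering is the only structure left once
    the absolute value is taken. *)
Lemma cexp_tterm a b : Ek b =1 (fun=> 0) -> Ek (tterm a b) =1 (fun=> 0).
Proof.
move=> b0 c; rewrite /tterm /cexp kopB kopD -/(cexp _ _).
have -> : kop (resample [set k]) (fun c => Ek (fun c => `|a c|) c * b c) c = 0.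
  rewrite -/(cexp _ _ _) cexpMl ?b0 ?mulr0//.
  move=> d d' e; apply: eq_bigr => d'' _; congr (_ * _); apply: eq_bigr => l _.
  by rewrite /resample; case: ifPn => // /e ->.
rewrite -/(cexp _ _) addr0.
have -> := cexp_cexp [set k] [set k] (fun c => `|a c| * b c) c.
by rewrite setUid subrr.
Qed.

Lemma indep_tterm S a b : indep_of S a -> indep_of S b -> indep_of S (tterm a b).
Proof.
move=> ia ib.
have ia' : indep_of S (fun c => `|a c|) by move=> c c' e; rewrite (ia _ _ e).
have h F : indep_of S F -> indep_of S (Ek F).
  by move=> iF; apply: indep_ofS (subsetUr [set k] S) _; exact: cexp_indep.
move=> c c' e; rewrite /tterm (ia _ _ e) (ib _ _ e) (h _ ia' _ _ e).
by rewrite (h _ (indep_ofM ia' ib) _ _ e).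
Qed.

Lemma sqr_sum3_le (x y z : R) : (x + y + z) ^+ 2 <= 3 * (x ^+ 2 + y ^+ 2 + z ^+ 2).
Proof.
have := sqr_ge0 (x - y); have := sqr_ge0 (y - z); have := sqr_ge0 (x - z); lra.
Qed.

(** Splitting into three terms costs a factor 3, and Jensen bounds the mean of each square by the
    second moment of [a ^+ 2 + b ^+ 2]: hence 9 = 3 * 3. *)
Lemma expect_sqr_tterm a b :
  expect (fun c => tterm a b c ^+ 2) <= 9 * expect (fun c => (a c ^+ 2 + b c ^+ 2) ^+ 2).
Proof.
pose q c := a c ^+ 2 + b c ^+ 2.
have q0 c : 0 <= q c by rewrite addr_ge0 ?sqr_ge0.
have -> : expect (fun c => (a c ^+ 2 + b c ^+ 2) ^+ 2) = expect (fun c => q c ^+ 2) by [].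
apply: (@le_trans _ _ (expect (fun c => 3 * (q c ^+ 2 + Ek q c * q c + Ek (fun c => q c ^+ 2) c)))).
  apply: le_expect => c; apply: le_trans (sqr_sum3_le _ _ _) _; rewrite ler_wpM2l// sqrrN.
  have abq d : (`|a d| * b d) ^+ 2 <= q d ^+ 2.
    rewrite exprMn real_normK ?num_real// /q.
    by have := sqr_ge0 (a d); have := sqr_ge0 (b d); nra.
  rewrite !lerD ?abq//.
    rewrite exprMn ler_pM ?sqr_ge0//.
      apply: le_trans (cexp_jensen _ _ _) _; apply: le_cexp => d.
      by rewrite real_normK ?num_real// lerDl sqr_ge0.
    by rewrite lerDr sqr_ge0.
  by apply: le_trans (cexp_jensen _ _ _) _; apply: le_cexp.
rewrite expectZ !expectD expect_cexp.
have : expect (fun c => Ek q c * q c) <= expect (fun c => q c ^+ 2).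
  apply: (@le_trans _ _ (expect (fun c => 2^-1 * (Ek q c ^+ 2 + q c ^+ 2)))).
    by apply: le_expect => c; have := sqr_ge0 (Ek q c - q c); lra.
  by rewrite expectZ expectD; have := expect_sqr_cexp_le [set k] q; lra.
by lra.
Qed.

(** Here [a'] and [b'] are the parts to be removed. The bound is linear in [a' ^+ 2 + b' ^+ 2], and
    [q], [Q] may be chosen the same for a whole family of removed parts; summing over the family
    then costs nothing. *)
Lemma expect_sqr_tterm_diff a b a' b' (q Q : conf -> R) :
  (forall c, a c ^+ 2 + b c ^+ 2 <= q c) ->
  (forall c, a' c ^+ 2 + b' c ^+ 2 <= Q c) ->
  expect (fun c => (tterm a b c - tterm (fun c => a c - a' c) (fun c => b c - b' c) c) ^+ 2)
  <= 18 * expect (fun c => (a' c ^+ 2 + b' c ^+ 2) * (q c + Q c + Ek q c + Ek Q c)).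
Proof.
move=> abq sQ; pose s c := a' c ^+ 2 + b' c ^+ 2.
(* The difference of the two [tterm] values is [P + N - Ek P]: [P] collects the pointwise products,
   [N] those in which the absolute value is averaged over vertex [k]. *)
pose P c := `|a c| * b c - `|a c - a' c| * (b c - b' c).
pose N c := Ek (fun c => `|a c|) c * b c - Ek (fun c => `|a c - a' c|) c * (b c - b' c).
have q0 c : 0 <= q c by apply: le_trans (abq c); rewrite addr_ge0 ?sqr_ge0.
have s0 c : 0 <= s c by rewrite addr_ge0 ?sqr_ge0.
have Q0 c : 0 <= Q c by apply: le_trans (sQ c); exact: s0.
have a2q c : a c ^+ 2 <= q c by apply: le_trans (abq c); rewrite lerDl sqr_ge0.
have b2q c : b c ^+ 2 <= q c by apply: le_trans (abq c); rewrite lerDr sqr_ge0.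
have a2s c : a' c ^+ 2 <= s c by rewrite lerDl sqr_ge0.
have b2s c : b' c ^+ 2 <= s c by rewrite lerDr sqr_ge0.
(* Increment of a product, in the form [(x - y) * w0 + y * y']: every resulting term contains a
   removed part. *)
have dec (x y x' y' z w0 : R) : `|x - y| <= x' -> `|y| <= z + x' ->
    (x * w0 - y * (w0 - y')) ^+ 2 <= 3 * (x' ^+ 2 * w0 ^+ 2 + z ^+ 2 * y' ^+ 2 + x' ^+ 2 * y' ^+ 2).
  move=> xy yz.
  have h : `|x * w0 - y * (w0 - y')| <= x' * `|w0| + z * `|y'| + x' * `|y'|.
    rewrite (_ : _ - _ = (x - y) * w0 + y * y'); last by ring.
    rewrite -addrA -mulrDl; apply: le_trans (ler_normD _ _) _.
    by rewrite !normrM lerD// ler_wpM2r.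
  rewrite -real_normK ?num_real// -(real_normK (num_real w0)) -(real_normK (num_real y')).
  rewrite -!exprMn; apply: le_trans (sqr_sum3_le _ _ _).
  have h' := le_trans (normr_ge0 _) h.
  by rewrite ler_sqr ?nnegrE.
have PE c : P c ^+ 2 <= 3 * (s c * (q c + Q c)).
  have h1 : `| `|a c| - `|a c - a' c| | <= `|a' c|.
    by apply: le_trans (ler_dist_dist _ _) _; rewrite opprB addrCA subrr addr0.
  have h2 : `| `|a c - a' c| | <= `|a c| + `|a' c| by rewrite normr_id ler_normB.
  apply: le_trans (dec _ _ _ (b' c) _ (b c) h1 h2) _.
  rewrite ler_wpM2l// !real_normK ?num_real//.
  have := ler_pM (sqr_ge0 _) (sqr_ge0 _) (a2s c) (le_trans (b2s c) (sQ c)).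
  have := mulr_ge0 (sqr_ge0 (b' c)) (sqr_ge0 (b c)).
  have := mulr_ge0 (sqr_ge0 (a' c)) (sqr_ge0 (a c)).
  by have := ler_wpM2l (s0 c) (abq c); rewrite /s; lra.
have NE : expect (fun c => N c ^+ 2) <= 3 * expect (fun c => s c * (2 * Ek q c + Ek Q c)).
  apply: (@le_trans _ _ (3 * expect (fun c => Ek s c * q c + s c * Ek q c + s c * Ek Q c))).
    rewrite -expectZ; apply: le_expect => c.
    have h1 : `|Ek (fun c => `|a c|) c - Ek (fun c => `|a c - a' c|) c| <= Ek (fun c => `|a' c|) c.
      rewrite /cexp -kopB; apply: le_trans (norm_cexp _ _ _) _; apply: le_cexp => d.
      by apply: le_trans (ler_dist_dist _ _) _; rewrite opprB addrCA subrr addr0.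
    have h2 : `|Ek (fun c => `|a c - a' c|) c| <= Ek (fun c => `|a c|) c + Ek (fun c => `|a' c|) c.
      rewrite /cexp -kopD; apply: le_trans (norm_cexp _ _ _) _; apply: le_cexp => d.
      by rewrite normr_id ler_normB.
    apply: le_trans (dec _ _ _ (b' c) _ (b c) h1 h2) _.
    have Esqr (x y : conf -> R) : (forall c, x c ^+ 2 <= y c) -> Ek (fun c => `|x c|) c ^+ 2 <= Ek y c.
      move=> xy; apply: le_trans (cexp_jensen _ _ _) _; apply: le_cexp => d.
      by rewrite real_normK ?num_real.
    rewrite ler_wpM2l// !lerD// ?[s c * _]mulrC ler_pM ?sqr_ge0 ?Esqr//.
    by move=> d; exact: le_trans (a2s d) (sQ d).
  (* Self-adjointness moves the average from [s] onto [q], so that [s] stands outside every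
     conditional expectation. *)
  rewrite ler_wpM2l// !expectD expect_adjoint -!expectD; apply: le_expect => c.
  by lra.
apply: (@le_trans _ _ (expect (fun c => 3 * (P c ^+ 2 + N c ^+ 2 + Ek P c ^+ 2)))).
  apply: le_expect => c; rewrite -[Ek P c ^+ 2]sqrrN; apply: le_trans (sqr_sum3_le _ _ _).
  rewrite le_eqVlt; apply/orP; left; apply/eqP; congr (_ ^+ 2).
  by rewrite /tterm /P /N /cexp kopB; ring.
rewrite expectZ !expectD.
have : expect (fun c => P c ^+ 2) <= 3 * expect (fun c => s c * (q c + Q c)).
  by rewrite -expectZ; apply: le_expect.
have := expect_sqr_cexp_le [set k] P.
have -> : expect (fun c => (a' c ^+ 2 + b' c ^+ 2) * (q c + Q c + Ek q c + Ek Q c))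
  = expect (fun c => s c * (q c + Q c)) + 2^-1 * expect (fun c => s c * (2 * Ek q c + Ek Q c))
    + 2^-1 * expect (fun c => s c * Ek Q c).
  by rewrite -!expectZ -!expectD; apply: eq_expect => c; rewrite /s; field.
have : 0 <= expect (fun c => s c * Ek Q c).
  by apply: expect_ge0 => c; rewrite mulr_ge0// cexp_ge0.
have : 0 <= expect (fun c => s c * (q c + Q c)).
  by apply: expect_ge0 => c; rewrite mulr_ge0// addr_ge0.
by move: NE; lra.
Qed.

End Tterm.

(** * Sums of degenerate components *)

Section DegenerateFamily.
Variables (G : {set 'I_n} -> conf -> R) (r : nat).
Hypotheses (G_indep : forall J, indep_of (~: J) (G J))
  (G_degen : forall J k, k \in J -> cexp [set k] (G J) =1 (fun=> 0))
  (G_supp : forall J c, ~~ (0 < #|J| <= r)%N -> G J c = 0).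
Implicit Types (a : {set 'I_n} -> R) (P : pred {set 'I_n}) (k l : 'I_n).

Lemma cexp_meet S J : ~~ [disjoint J & S] -> cexp S (G J) =1 (fun=> 0).
Proof.
case/pred0Pn => k /andP[/= kJ kS] c.
have -> : S = S :|: [set k] by apply/esym/setUidPl; rewrite sub1set.
rewrite -cexp_cexp -(cexp_cst S 0 c); apply: eq_kop_fun => d; exact: G_degen.
Qed.

Lemma indep_disjoint S J : [disjoint J & S] -> indep_of S (G J).
Proof.
move=> dJS; apply: (indep_ofS _ (@G_indep J)).
by rewrite subsets_disjoint setCK disjoint_sym.
Qed.

Definition lsum a P c : R := \sum_(J | P J) a J * G J c.

Lemma cexp_lsum_meet S a P : (forall J, P J -> ~~ [disjoint J & S]) ->
  cexp S (lsum a P) =1 (fun=> 0).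
Proof.
move=> h c; rewrite /cexp kop_sum big1// => J PJ.
by rewrite kopZ -/(cexp _ _ _) cexp_meet ?mulr0// h.
Qed.

Lemma indep_lsum S a P : (forall J, P J -> [disjoint J & S]) -> indep_of S (lsum a P).
Proof.
move=> h c c' e; apply: eq_bigr => J PJ; congr (_ * _).
exact: indep_disjoint (h J PJ) _ _ e.
Qed.

Definition inv_card J : R := #|J|%:R^-1.
Definition Wsum c : R := \sum_J G J c.
(** The weight [1 / #|J|] shares each component equally among its vertices, so that the [usum k] add
    up to [Wsum], while [vsum k] carries the whole dependence of [Wsum] on vertex [k]. *)
Definition usum k := lsum inv_card (fun J => k \in J).
Definition vsum k := lsum (fun=> 1) (fun J => k \in J).
Definition Tsum k := tterm k (usum k) (vsum k).

Lemma set0_supp c : G set0 c = 0.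
Proof. by apply: G_supp; rewrite cards0. Qed.

Lemma sum_usum c : \sum_k usum k c = Wsum c.
Proof.
rewrite /usum /lsum (exchange_big_dep predT)//=; apply: eq_bigr => J _.
(* The empty set gets the weight [0^-1 = 0], which is consistent because its component vanishes. *)
rewrite sumr_const; have [->|J0] := eqVneq J set0; first by rewrite set0_supp mulr0 mul0rn.
have -> : #|[pred k in J]| = #|J| by apply: eq_card => k; rewrite inE.
by rewrite -mulr_natl mulrA divff ?mul1r// pnatr_eq0 cards_eq0.
Qed.

Lemma not_disjoint1 k J : k \in J -> ~~ [disjoint J & [set k]].
Proof. by move=> kJ; apply/pred0Pn; exists k; rewrite /= kJ inE eqxx. Qed.

Lemma disjoint1 k J : k \notin J -> [disjoint J & [set k]].
Proof. by rewrite disjoint_sym disjoints1. Qed.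

Lemma Wsum_diff k c c' : (forall l, l != k -> c l = c' l) ->
  Wsum c - Wsum c' = vsum k c - vsum k c'.
Proof.
move=> e; rewrite /Wsum (bigID (fun J : {set _} => k \in J))/=.
rewrite [X in _ - X](bigID (fun J : {set _} => k \in J))/=.
have -> : \sum_(J : {set _} | k \notin J) G J c = \sum_(J : {set _} | k \notin J) G J c'.
  apply: eq_bigr => J kJ; apply: (indep_disjoint (disjoint1 kJ)) => l.
  by rewrite inE; exact: e.
rewrite opprD addrACA subrr addr0 /vsum /lsum.
by congr (_ - _); apply: eq_bigr => J _; rewrite mul1r.
Qed.

(** * Stein's identity by resampling one vertex *)

Section Discrepancy.
Variables f f' g : R -> R.
Hypothesis taylor : forall w w', `|f w - f w' - (w - w') * f' w| <= (w - w') * (g w - g w').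

Let err k c c' := usum k c * (f (Wsum c) - f (Wsum c') - (Wsum c - Wsum c') * f' (Wsum c)).

(** Two mean-zero terms are inserted: [usum k c * f (Wsum c')] vanishes because [usum k] is centered
    in vertex [k], and [f' (Wsum c) * usum k c * vsum k c'] because [vsum k] is. They leave the
    first-order term and the Taylor remainder. *)
Lemma usum_product_expand k : expect (fun c => usum k c * f (Wsum c))
  = expect (fun c => f' (Wsum c) * (usum k c * vsum k c)) + product_pair k (err k).
Proof.
have cu0 : cexp [set k] (usum k) =1 (fun=> 0).
  by apply: cexp_lsum_meet => J; exact: not_disjoint1.
have cv0 : cexp [set k] (vsum k) =1 (fun=> 0).
  by apply: cexp_lsum_meet => J; exact: not_disjoint1.
have e0 : product_pair k (fun c c' => usum k c * f (Wsum c')) = 0.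
  rewrite product_pairM -expect_adjoint -(expect_cst 0).
  by apply: eq_expect => c; rewrite cu0 mul0r.
have e1 : product_pair k (fun c c' => (f' (Wsum c) * usum k c) * vsum k c') = 0.
  by rewrite product_pairM -(expect_cst 0); apply: eq_expect => c; rewrite cv0 mulr0.
rewrite -!(product_pairl k) -[LHS]subr0 -e0 -[X in _ = X + _]subr0 -e1.
rewrite -!product_pairN -!product_pairD; apply: eq_product_pair => c c' cc'.
by rewrite /err (Wsum_diff cc'); ring.
Qed.

(** The bound [(w - w') * (g w - g w')] keeps its signs, so no absolute value falls on
    [vsum k c - vsum k c']. Exchanging the copies trades [g (Wsum c')] for [g (Wsum c)], and
    averaging over the copy produces exactly [tterm]. *)
Lemma norm_product_err k :
  `|product_pair k (err k)| <= expect (fun c => g (Wsum c) * Tsum k c).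
Proof.
have cv0 : cexp [set k] (vsum k) =1 (fun=> 0).
  by apply: cexp_lsum_meet => J; exact: not_disjoint1.
pose U c := `|usum k c|.
pose D c c' := U c * (vsum k c - vsum k c').
apply: (@le_trans _ _ (product_pair k (fun c c' => D c c' * (g (Wsum c) - g (Wsum c'))))).
  apply: norm_product_pair => c c' cc'.
  rewrite /err normrM /D -mulrA ler_wpM2l// -(Wsum_diff cc').
  exact: taylor.
have -> : product_pair k (fun c c' => D c c' * (g (Wsum c) - g (Wsum c')))
  = product_pair k (fun c c' => (D c c' - D c' c) * g (Wsum c)).
  transitivity (product_pair k (fun c c' => D c c' * g (Wsum c))
     + product_pair k (fun c c' => - (D c c' * g (Wsum c')))).
    by rewrite -product_pairD; apply: eq_product_pair => c c' _; ring.
  rewrite [X in _ + X]product_pair_flip -product_pairD.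
  by apply: eq_product_pair => c c' _; ring.
rewrite le_eqVlt; apply/orP; left; apply/eqP.
rewrite /product_pair /expect; apply: eq_bigr => c _; congr (_ * _).
(* The antisymmetrized weight is [(U c + U c') * (vsum k c - vsum k c')]; its product
   [U c * vsum k c'] averages to zero and the other three form [Tsum k]. *)
transitivity (g (Wsum c) * (U c * vsum k c - U c * cexp [set k] (vsum k) c
    + cexp [set k] U c * vsum k c - cexp [set k] (fun c => U c * vsum k c) c)).
  transitivity (kop (resample [set k]) (fun c' => g (Wsum c) *
      (U c * vsum k c - U c * vsum k c' + vsum k c * U c' - U c' * vsum k c')) c).
    by apply: eq_bigr => c' _; rewrite /D; ring.
  have kcst x : kop (resample [set k]) (fun=> x) c = x by exact: cexp_cst.
  by rewrite /cexp kopZ kopB kopD kopB !kopZ kcst [vsum k c * kop _ U c]mulrC.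
by rewrite cv0 mulr0 subr0.
Qed.

Lemma stein_discrepancy :
  `|expect (fun c => f' (Wsum c)) - expect (fun c => Wsum c * f (Wsum c))|
  <= `|expect (fun c => f' (Wsum c) * (1 - \sum_k usum k c * vsum k c))|
     + expect (fun c => g (Wsum c) * \sum_k Tsum k c).
Proof.
have -> : expect (fun c => Wsum c * f (Wsum c)) =
    expect (fun c => f' (Wsum c) * \sum_k usum k c * vsum k c)
    + \sum_k product_pair k (err k).
  transitivity (\sum_k expect (fun c => usum k c * f (Wsum c))).
    by rewrite -expect_sum; apply: eq_expect => c; rewrite -mulr_suml sum_usum.
  under eq_bigr do rewrite usum_product_expand.
  rewrite big_split/= -expect_sum; congr (_ + _).
  by apply: eq_expect => c; rewrite mulr_sumr.
have -> : expect (fun c => f' (Wsum c) * (1 - \sum_k usum k c * vsum k c)) =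
  expect (fun c => f' (Wsum c)) - expect (fun c => f' (Wsum c) * \sum_k usum k c * vsum k c).
  by rewrite -expectB; apply: eq_expect => c; rewrite mulrBr mulr1.
rewrite opprD addrA; apply: le_trans (ler_normB _ _) _; rewrite lerD//.
apply: le_trans (ler_norm_sum _ _ _) _.
rewrite (eq_expect (fun c => mulr_sumr _ _ _ _)) expect_sum.
by apply: ler_sum => k _; exact: norm_product_err.
Qed.
End Discrepancy.

Definition usum2 k l := lsum inv_card (fun J => (k \in J) && (l \in J)).
Definition vsum2 k l := lsum (fun=> 1) (fun J => (k \in J) && (l \in J)).
Definition qform k c : R := usum k c ^+ 2 + vsum k c ^+ 2.
Definition qform2 k c : R := \sum_(l | l != k) (usum2 k l c ^+ 2 + vsum2 k l c ^+ 2).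

(** [Tsum k] rebuilt from the components that avoid vertex [l]: it ignores coordinate [l] and stays
    centered in coordinate [k]. *)
Let Tcut k l := tterm k (fun c => usum k c - usum2 k l c) (fun c => vsum k c - vsum2 k l c).
Let Trem k l c := Tsum k c - Tcut k l c.

Lemma lsum_sub a k l c :
  lsum a (fun J => k \in J) c - lsum a (fun J => (k \in J) && (l \in J)) c
  = lsum a (fun J => (k \in J) && (l \notin J)) c.
Proof. by rewrite /lsum (bigID (fun J : {set _} => l \in J))/= addrAC subrr add0r. Qed.

Let cexp_Tsum k : cexp [set k] (Tsum k) =1 (fun=> 0).
Proof.
by apply: cexp_tterm; apply: cexp_lsum_meet => J; exact: not_disjoint1.
Qed.

Let cexp_Tcut k l : cexp [set k] (Tcut k l) =1 (fun=> 0).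
Proof.
apply: cexp_tterm => c.
transitivity (cexp [set k] (lsum (fun=> 1) (fun J => (k \in J) && (l \notin J))) c).
  by apply: eq_kop_fun => d; exact: lsum_sub.
by apply: cexp_lsum_meet => J /andP[kJ _]; exact: not_disjoint1.
Qed.

Let indep_Tcut k l : indep_of [set l] (Tcut k l).
Proof.
apply: indep_tterm => c c' e; rewrite !lsum_sub.
- by apply: (indep_lsum _ _ e) => J /andP[_ lJ]; exact: disjoint1.
- by apply: (indep_lsum _ _ e) => J /andP[_ lJ]; exact: disjoint1.
Qed.

Let cexp_Trem k l : cexp [set k] (Trem k l) =1 (fun=> 0).
Proof.
move=> c; have := cexp_Tsum k c; have := cexp_Tcut k l c.
rewrite /cexp => e2 e1.
by rewrite (kopB _ (Tsum k) (Tcut k l)) e1 e2 subrr.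
Qed.

(* By degeneracy only the remainders contribute: the expectation is that of
   [Trem k l * Trem l k]. *)
Let expect_TsumM k l : l != k ->
  expect (fun c => Tsum k c * Tsum l c)
  <= 2^-1 * (expect (fun c => Trem k l c ^+ 2) + expect (fun c => Trem l k c ^+ 2)).
Proof.
move=> lk.
have o1 : expect (fun c => Tcut k l c * Tsum l c) = 0.
  by apply: (@expect_orth [set l]); [exact: indep_Tcut|exact: cexp_Tsum].
have o2 : expect (fun c => Tcut l k c * Trem k l c) = 0.
  by apply: (@expect_orth [set k]); [exact: indep_Tcut|exact: cexp_Trem].
rewrite -expectD -expectZ -[leLHS]subr0 -o1 -expectB -[leLHS]subr0 -o2 -expectB.
apply: le_expect => c; have := sqr_ge0 (Trem k l c - Trem l k c).
rewrite /Trem; lra.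
Qed.

(** The choice [q = qform k], [Q = qform2 k] does not depend on [l], so the removed parts add up to
    [qform2 k] without a factor [n]. Young's inequality gives the 3 in 54 = 18 * 3. *)
Let expect_Trem_sum k : \sum_(l | l != k) expect (fun c => Trem k l c ^+ 2)
  <= 54 * (expect (fun c => qform k c ^+ 2) + expect (fun c => qform2 k c ^+ 2)).
Proof.
pose s l c := usum2 k l c ^+ 2 + vsum2 k l c ^+ 2.
pose X c := qform k c + qform2 k c + cexp [set k] (qform k) c + cexp [set k] (qform2 k) c.
apply: (@le_trans _ _ (\sum_(l | l != k) 18 * expect (fun c => s l c * X c))).
  apply: ler_sum => l lk; apply: expect_sqr_tterm_diff => c //.
  rewrite /qform2 (bigD1 l)//= lerDl; apply: sumr_ge0 => l' _.
  by rewrite addr_ge0 ?sqr_ge0.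
rewrite -mulr_sumr -expect_sum.
have -> : expect (fun c => \sum_(l | l != k) s l c * X c) = expect (fun c => qform2 k c * X c).
  by apply: eq_expect => c; rewrite -mulr_suml.
have h1 := expect_sqr_cexp_le [set k] (qform k).
have h2 := expect_sqr_cexp_le [set k] (qform2 k).
rewrite [54](_ : _ = 18 * 3); last by rewrite -natrM.
rewrite -mulrA ler_wpM2l//.
apply: (@le_trans _ _ (expect (fun c => 2^-1 * qform k c ^+ 2
   + 2^-1 * cexp [set k] (qform k) c ^+ 2 + 2^-1 * cexp [set k] (qform2 k) c ^+ 2
   + 5/2 * qform2 k c ^+ 2))).
  apply: le_expect => c; rewrite /X.
  have := sqr_ge0 (qform k c - qform2 k c).
  have := sqr_ge0 (cexp [set k] (qform k) c - qform2 k c).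
  have := sqr_ge0 (cexp [set k] (qform2 k) c - qform2 k c).
  lra.
have h3 : 0 <= expect (fun c => qform k c ^+ 2) by apply: expect_ge0 => c; exact: sqr_ge0.
rewrite !expectD !expectZ; lra.
Qed.

(** The diagonal contributes 9 and, after symmetrization in the two vertices, the off-diagonal part
    contributes 54; their sum is 63. *)
Lemma expect_sqr_Tsum :
  expect (fun c => (\sum_k Tsum k c) ^+ 2)
  <= 63 * \sum_k (expect (fun c => qform k c ^+ 2) + expect (fun c => qform2 k c ^+ 2)).
Proof.
have -> : expect (fun c => (\sum_k Tsum k c) ^+ 2)
    = \sum_k \sum_l expect (fun c => Tsum k c * Tsum l c).
  rewrite (eq_expect (_ : _ =1 fun c => \sum_k \sum_l Tsum k c * Tsum l c)); last first.
    by move=> c; rewrite expr2 mulr_suml; apply: eq_bigr => k _; rewrite mulr_sumr.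
  by rewrite expect_sum; apply: eq_bigr => k _; rewrite expect_sum.
pose A k := expect (fun c => qform k c ^+ 2).
pose B k := expect (fun c => qform2 k c ^+ 2).
have diag k : expect (fun c => Tsum k c * Tsum k c) <= 9 * A k.
  by have := expect_sqr_tterm k (usum k) (vsum k).
have B0 k : 0 <= B k by apply: expect_ge0 => c; rewrite sqr_ge0.
apply: (@le_trans _ _ (\sum_k (9 * A k + \sum_(l | l != k)
  (2^-1 * (expect (fun c => Trem k l c ^+ 2) + expect (fun c => Trem l k c ^+ 2)))))).
  apply: ler_sum => k _; rewrite (bigD1 k)//= lerD//.
  by apply: ler_sum => l; exact: expect_TsumM.
rewrite big_split/=.
have -> : \sum_k \sum_(l | l != k) 2^-1 * (expect (fun c => Trem k l c ^+ 2)
     + expect (fun c => Trem l k c ^+ 2))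
  = \sum_k \sum_(l | l != k) expect (fun c => Trem k l c ^+ 2).
  under eq_bigr do rewrite -mulr_sumr big_split/=.
  rewrite -mulr_sumr big_split/= [X in _ + X](exchange_big_dep predT)//=.
  under [X in _ + X]eq_bigr => k _ do under eq_bigl => l do rewrite eq_sym.
  lra.
rewrite -big_split mulr_sumr; apply: ler_sum => k _ /=.
have := expect_Trem_sum k; have := B0 k; rewrite -/(A k) -/(B k); lra.
Qed.

(** * Quadratic forms and quadruples of index sets *)

Local Notation spair := ({set 'I_n} * {set 'I_n})%type.
Implicit Types (p : spair) (b : spair -> R).

Definition Gpair p c : R := G p.1 c * G p.2 c.
Definition bilin b c : R := \sum_p b p * Gpair p c.
Definition moment2 p : R := expect (Gpair p).
Definition moment4 (p p' : spair) : R := expect (fun c => Gpair p c * Gpair p' c).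
(** Two pairs stand for a quadruple of index sets. The third condition excludes independent pairs;
    the first two record that in the quadratic forms the two sets of a pair share a vertex. *)
Definition linked (p p' : spair) : bool :=
  [&& p.1 :&: p.2 != set0, p'.1 :&: p'.2 != set0
    & (p.1 :|: p.2) :&: (p'.1 :|: p'.2) != set0].
(** The products of second moments enter because the variance of [Zsum] subtracts them. *)
Definition quad_sum : R :=
  \sum_p \sum_(p' | linked p p') (`|moment4 p p'| + `|moment2 p * moment2 p'|).

Lemma lsumM a a' P P' c : lsum a P c * lsum a' P' c
  = bilin (fun p => (P p.1)%:R * (P' p.2)%:R * (a p.1 * a' p.2)) c.
Proof.
rewrite /bilin -(pair_bigA _ (fun I J => (P I)%:R * (P' J)%:R * (a I * a' J) * Gpair (I, J) c))/=.
rewrite /lsum mulr_suml big_mkcond; apply: eq_bigr => I _.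
case: (P I); last by rewrite big1// => J _; rewrite !mul0r.
rewrite mulr_sumr big_mkcond; apply: eq_bigr => J _ /=.
by case: (P' J); rewrite /Gpair/= ?mulr0 ?mul0r//; ring.
Qed.

Lemma bilinD b b' c : bilin b c + bilin b' c = bilin (fun p => b p + b' p) c.
Proof. by rewrite /bilin -big_split; apply: eq_bigr => p _; rewrite mulrDl. Qed.

Lemma bilin_sum (I : Type) (s : seq I) (P : pred I) (B : I -> spair -> R) c :
  \sum_(i <- s | P i) bilin (B i) c = bilin (fun p => \sum_(i <- s | P i) B i p) c.
Proof.
by rewrite /bilin exchange_big; apply: eq_bigr => p _; rewrite mulr_suml.
Qed.

Lemma eq_bilin b b' : b =1 b' -> bilin b =1 bilin b'.
Proof. by move=> e c; apply: eq_bigr => p _; rewrite e. Qed.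

Lemma expect_bilin b : expect (bilin b) = \sum_p b p * moment2 p.
Proof. by rewrite expect_sum; apply: eq_bigr => p _; rewrite expectZ. Qed.

Lemma expect_bilin_sqr b :
  expect (fun c => bilin b c ^+ 2) = \sum_p \sum_p' b p * b p' * moment4 p p'.
Proof.
transitivity (expect (fun c => \sum_p \sum_p' b p * b p' * (Gpair p c * Gpair p' c))).
  apply: eq_expect => c; rewrite expr2 mulr_suml; apply: eq_bigr => p _.
  by rewrite mulr_sumr; apply: eq_bigr => p' _; ring.
rewrite expect_sum; apply: eq_bigr => p _; rewrite expect_sum.
by apply: eq_bigr => p' _; rewrite expectZ.
Qed.

Lemma moment4_supp (p p' : spair) : moment4 p p' != 0 -> (#|p.1| <= r)%N /\ (#|p'.1| <= r)%N.
Proof.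
move=> h; split; rewrite leqNgt; apply: contraNN h => h; apply/eqP;
  rewrite -(expect_cst 0); apply: eq_expect => c; rewrite /Gpair.
  by rewrite (G_supp (J := p.1)) ?mul0r// negb_and -!ltnNge h orbT.
by rewrite (G_supp (J := p'.1)) ?mul0r ?mulr0// negb_and -!ltnNge h orbT.
Qed.

(** For a fixed quadruple only the vertices lying in all four sets contribute. There are at most [r]
    of them, and the existence of one makes the quadruple linked, so the sum over [k] costs [r] and
    not [n]. *)
Lemma sum_expect_bilin_sqr (b : 'I_n -> spair -> R) (B : R) :
  (forall k p, 0 <= b k p) ->
  (forall k p, (#|p.1| <= r)%N -> b k p <= B * (k \in p.1 :&: p.2)%:R) ->
  \sum_k expect (fun c => bilin (b k) c ^+ 2) <= B ^+ 2 * r%:R * quad_sum.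
Proof.
move=> b0 bB; under eq_bigr do rewrite expect_bilin_sqr.
rewrite exchange_big /quad_sum mulr_sumr; apply: ler_sum => p _.
rewrite exchange_big mulr_sumr [leRHS]big_mkcond; apply: ler_sum => p' _ /=.
have [->|/moment4_supp[pr p'r]] := eqVneq (moment4 p p') 0.
  rewrite big1 => [|k _]; last by rewrite mulr0.
  case: ifP => // _; apply: mulr_ge0; last exact: addr_ge0.
  by apply: mulr_ge0 => //; exact: sqr_ge0.
apply: (@le_trans _ _ (\sum_(k in p.1 :&: p.2 :&: (p'.1 :&: p'.2)) B ^+ 2 * `|moment4 p p'|)).
  rewrite [leRHS]big_mkcond; apply: ler_sum => k _.
  have h1 := bB k p pr; have h2 := bB k p' p'r.
  have h3 := ler_pM (b0 k p) (b0 k p') h1 h2.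
  apply: (@le_trans _ _ (b k p * b k p' * `|moment4 p p'|)).
    by rewrite ler_wpM2l ?mulr_ge0// ler_norm.
  apply: le_trans (ler_wpM2r (normr_ge0 _) h3) _.
  rewrite [in leRHS]inE; case: (k \in p.1 :&: p.2); case: (k \in p'.1 :&: p'.2);
    by rewrite /= ?mulr1 ?mulr0 ?mul0r ?expr2.
rewrite sumr_const -[X in X <= _]mulr_natr mulrAC.
case: ifPn => [_|nl].
  rewrite -[X in X <= _]mulrA -[X in _ <= X]mulrA; apply: (ler_wpM2l (sqr_ge0 B)).
  apply: ler_pM => //; last by rewrite lerDl.
  rewrite ler_nat; apply: leq_trans pr; apply: subset_leq_card.
  by apply/subsetP => k; rewrite !inE => /andP[/andP[]].
rewrite (_ : #|_| = 0%N) ?mulr0 ?mul0r//; apply/eqP; rewrite cards_eq0; apply/eqP/setP => k.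
rewrite in_set0; apply: contraNF nl; rewrite !inE => /andP[/andP[k1 k2] /andP[k3 k4]].
by apply/and3P; split; apply/set0Pn; exists k; rewrite !inE ?k1 ?k2 ?k3 ?k4.
Qed.

Let inv_card_le1 J : 0 <= inv_card J <= 1.
Proof.
rewrite /inv_card invr_ge0 ler0n/=; case: #|J| => [|j]; first by rewrite invr0.
by rewrite invf_le1 ?ltr0n// ler1n.
Qed.

(** The coefficients [inv_card p.1 * inv_card p.2 + 1] are at most 2, so [B = 2]. *)
Lemma sum_expect_sqr_qform :
  \sum_k expect (fun c => qform k c ^+ 2) <= 4 * r%:R * quad_sum.
Proof.
pose b k p := (k \in p.1)%:R * (k \in p.2)%:R * (inv_card p.1 * inv_card p.2)
  + (k \in p.1)%:R * (k \in p.2)%:R * (1 * 1) : R.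
have e k : qform k =1 bilin (b k).
  by move=> c; rewrite /qform !expr2 !lsumM bilinD.
under eq_bigr => k _ do rewrite (eq_expect (fun c => congr1 (fun x => x ^+ 2) (e k c))).
rewrite [4](_ : _ = 2 ^+ 2); last by rewrite -natrX.
apply: sum_expect_bilin_sqr => k p.
  have /andP[i1 _] := inv_card_le1 p.1; have /andP[i2 _] := inv_card_le1 p.2.
  by rewrite /b addr_ge0 ?mulr_ge0.
have /andP[i1 i2] := inv_card_le1 p.1; have /andP[i3 i4] := inv_card_le1 p.2.
move=> _; rewrite /b inE; case: (k \in p.1); case: (k \in p.2);
  rewrite /= ?mul0r ?mulr0 ?addr0 ?mul1r ?mulr1//; nra.
Qed.

(** The second vertex [l] must lie in [p.1], which leaves at most [r] choices; hence [B = 2 * r]. *)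
Lemma sum_expect_sqr_qform2 :
  \sum_k expect (fun c => qform2 k c ^+ 2) <= 4 * r%:R ^+ 3 * quad_sum.
Proof.
pose b k p := \sum_(l | l != k) (((k \in p.1) && (l \in p.1))%:R *
  ((k \in p.2) && (l \in p.2))%:R * (inv_card p.1 * inv_card p.2)
  + ((k \in p.1) && (l \in p.1))%:R * ((k \in p.2) && (l \in p.2))%:R * (1 * 1)) : R.
have e k : qform2 k =1 bilin (b k).
  move=> c; rewrite /qform2 -bilin_sum; apply: eq_bigr => l _.
  by rewrite !expr2 !lsumM bilinD.
under eq_bigr => k _ do rewrite (eq_expect (fun c => congr1 (fun x => x ^+ 2) (e k c))).
rewrite (_ : 4 * r%:R ^+ 3 = (2 * r%:R) ^+ 2 * r%:R); last by ring.
apply: sum_expect_bilin_sqr => k p.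
  have /andP[i1 _] := inv_card_le1 p.1; have /andP[i2 _] := inv_card_le1 p.2.
  by apply: sumr_ge0 => l _; rewrite addr_ge0 ?mulr_ge0.
move=> pr; have /andP[i1 i2] := inv_card_le1 p.1; have /andP[i3 i4] := inv_card_le1 p.2.
apply: (@le_trans _ _ (\sum_(l in p.1) 2 * (k \in p.1 :&: p.2)%:R)).
  rewrite /b big_mkcond [leRHS]big_mkcond; apply: ler_sum => l _; rewrite inE.
  case: (l != k); case: (k \in p.1); case: (k \in p.2); case: (l \in p.1); case: (l \in p.2);
    rewrite /= ?mul0r ?mulr0 ?addr0 ?mul1r ?mulr1//; nra.
rewrite sumr_const -[X in X <= _]mulr_natr mulrAC ler_wpM2r// ler_wpM2l//.
by rewrite ler_nat.
Qed.

(** A vertex in one set but not in the other can be integrated inside one component alone, where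
    degeneracy gives zero. *)
Lemma moment2_neq I J : I != J -> moment2 (I, J) = 0.
Proof.
have half (A B : {set _}) k : k \in A -> k \notin B -> expect (fun c => G B c * G A c) = 0.
  move=> kA kB; apply: (@expect_orth [set k]); last exact: G_degen.
  exact: indep_disjoint (disjoint1 kB).
rewrite eqEsubset negb_and => /orP[] /subsetPn[k kA kB].
  by rewrite -(half _ _ _ kA kB); apply: eq_expect => c; rewrite /Gpair mulrC.
by rewrite -(half _ _ _ kA kB); apply: eq_expect.
Qed.

Lemma sum_moment2 b : \sum_p b p * moment2 p = \sum_I b (I, I) * moment2 (I, I).
Proof.
rewrite (eq_bigr (fun p => b (p.1, p.2) * moment2 (p.1, p.2))); last by case.
rewrite -(pair_bigA _ (fun I J => b (I, J) * moment2 (I, J)))/=.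
apply: eq_bigr => I _; rewrite (bigD1 I)//= big1 ?addr0// => J JI.
by rewrite moment2_neq ?mulr0// eq_sym.
Qed.

Definition Zsum c : R := \sum_k usum k c * vsum k c.
(** Each common vertex brings the weight [1 / #|p.1|], so the coefficient is 1 when both sets are
    equal and nonempty, and never exceeds 1. *)
Let zcoef p : R := #|p.1 :&: p.2|%:R * inv_card p.1.

Lemma Zsum_bilin : Zsum =1 bilin zcoef.
Proof.
move=> c; rewrite /Zsum; under eq_bigr do rewrite lsumM; rewrite bilin_sum.
apply: eq_bilin => p; rewrite /zcoef -sum1_card natr_sum mulr_suml [RHS]big_mkcond.
apply: eq_bigr => k _; rewrite inE.
by case: (_ \in _); case: (_ \in _) => /=; ring.
Qed.

(** A nonzero coefficient forces each pair to overlap, so linkage can only fail through disjoint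
    unions, and then the two products are independent. *)
Lemma moment4_split (p p' : spair) : ~~ linked p p' -> zcoef p * zcoef p' != 0 ->
  moment4 p p' = moment2 p * moment2 p'.
Proof.
move=> nl; rewrite /zcoef !mulf_eq0 !negb_or !pnatr_eq0 !cards_eq0.
move=> /andP[/andP[i1 _] /andP[i2 _]].
move: nl; rewrite /linked i1 i2 /= negbK setI_eq0 => dj.
set A := p.1 :|: p.2 in dj.
have iA : indep_of A (Gpair p').
  rewrite disjoint_sym in dj.
  apply: indep_ofM; apply: indep_disjoint; apply: disjointWl dj; first exact: subsetUl.
  exact: subsetUr.
have iA' : indep_of (~: A) (Gpair p).
  by apply: indep_ofM; apply: (indep_ofS _ (@G_indep _)); rewrite setCS ?subsetUl ?subsetUr.
rewrite /moment4 -(expect_cexp A).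
transitivity (expect (fun c => moment2 p * Gpair p' c)); last by rewrite expectZ.
apply: eq_expect => c.
transitivity (cexp A (fun d => Gpair p' d * Gpair p d) c).
  by apply: eq_kop_fun => d; rewrite mulrC.
rewrite cexpMl// mulrC; congr (_ * _).
rewrite /moment2 -(cexpT (Gpair p) c) -(setUCr A) -cexp_cexp.
by apply: eq_kop_fun => d; rewrite cexp_id.
Qed.

Hypothesis W_var : expect (fun c => Wsum c ^+ 2) = 1.

Lemma expect_Zsum : expect Zsum = 1.
Proof.
have EW : expect (fun c => Wsum c ^+ 2) = \sum_p 1 * moment2 p.
  rewrite -(expect_bilin (fun=> 1)); apply: eq_expect => c.
  have e : Wsum c = lsum (fun=> 1) predT c by apply: eq_bigr => J _; rewrite mul1r.
  by rewrite expr2 e lsumM; apply: eq_bilin => p; rewrite /= !mulr1.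
rewrite (eq_expect Zsum_bilin) expect_bilin -W_var EW !sum_moment2.
apply: eq_bigr => I _; rewrite /zcoef /= setIid /inv_card.
have [->|I0] := eqVneq I set0.
  rewrite /moment2 (_ : expect _ = 0) ?mulr0// -(expect_cst 0).
  by apply: eq_expect => c; rewrite /Gpair set0_supp mul0r.
by rewrite divff// pnatr_eq0 cards_eq0.
Qed.

(** As [Zsum] has mean 1, this is a variance, that is a double sum of covariances, and the unlinked
    ones cancel. *)
Lemma expect_sqr_1BZsum : expect (fun c => (1 - Zsum c) ^+ 2) <= quad_sum.
Proof.
have z01 p : 0 <= zcoef p <= 1.
  rewrite /zcoef /inv_card mulr_ge0 ?invr_ge0//=.
  have [->|p0] := posnP #|p.1|; first by rewrite invr0 mulr0.
  by rewrite ler_pdivrMr ?ltr0n// mul1r ler_nat subset_leq_card// subsetIl.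
have -> : expect (fun c => (1 - Zsum c) ^+ 2)
    = \sum_p \sum_p' zcoef p * zcoef p' * (moment4 p p' - moment2 p * moment2 p').
  transitivity (expect (fun c => Zsum c ^+ 2) - 1).
    transitivity (expect (fun c => 1 - 2 * Zsum c + Zsum c ^+ 2)).
      by apply: eq_expect => c; ring.
    rewrite expectD expectB expect_cst expectZ expect_Zsum; ring.
  rewrite (eq_expect (fun c => congr1 (fun x => x ^+ 2) (Zsum_bilin c))).
  rewrite expect_bilin_sqr -[X in _ - X](expr1n _ 2) -[X in _ - X ^+ _]expect_Zsum.
  rewrite (eq_expect Zsum_bilin) expect_bilin expr2 mulr_suml -sumrB.
  apply: eq_bigr => p _; rewrite mulr_sumr -sumrB; apply: eq_bigr => p' _; ring.
apply: ler_sum => p _; rewrite [leRHS]big_mkcond; apply: ler_sum => p' _ /=.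
have /andP[z0 z1] := z01 p; have /andP[z0' z1'] := z01 p'.
case: ifPn => [_|nl].
  apply: (@le_trans _ _ (`|moment4 p p' - moment2 p * moment2 p'|)); last exact: ler_normB.
  rewrite -[leRHS]mul1r; apply: le_trans (ler_norm _) _; rewrite normrM ler_wpM2r//.
  by rewrite normrM !ger0_norm //; apply: mulr_ile1.
have [->|z] := eqVneq (zcoef p * zcoef p') 0; first by rewrite mul0r.
by rewrite moment4_split// subrr mulr0.
Qed.

(** The factors 4 come from bounding the L2 norms of [f' (Wsum c)] and [g (Wsum c)] by [4 * K]: a
    function of size [2 * K * (1 + |w|)] has square at most [8 * K ^+ 2 * (1 + w ^+ 2)], and the
    variance is 1. The root gathers 63 and the two bounds on quadratic forms. *)
Definition stein_cst : R := 4 + 4 * Num.sqrt (63 * (4 * r%:R + 4 * r%:R ^+ 3)).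

Lemma norm_expectM_le F F' : `|expect (fun c => F c * F' c)|
  <= Num.sqrt (expect (fun c => F c ^+ 2)) * Num.sqrt (expect (fun c => F' c ^+ 2)).
Proof.
rewrite -sqrtrM; last by apply: expect_ge0 => c; exact: sqr_ge0.
by rewrite -sqrtr_sqr ler_wsqrtr// expect_CS.
Qed.

Lemma quad_sum_ge0 : 0 <= quad_sum.
Proof. by apply: sumr_ge0 => p _; apply: sumr_ge0 => p' _; rewrite addr_ge0. Qed.

Lemma stein_quad_bound (f f' g : R -> R) (K : R) :
  (forall w w', `|f w - f w' - (w - w') * f' w| <= (w - w') * (g w - g w')) ->
  (forall w, `|f' w| <= 2 * K * (1 + `|w|)) ->
  (forall w, `|g w| <= 2 * K * (1 + `|w|)) ->
  `|expect (fun c => f' (Wsum c)) - expect (fun c => Wsum c * f (Wsum c))|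
  <= K * (stein_cst * Num.sqrt quad_sum).
Proof.
move=> taylor f'K gK.
have K0 : 0 <= K.
  by have := le_trans (normr_ge0 _) (f'K 0); rewrite normr0 addr0 mulr1 pmulr_rge0.
have q0 := quad_sum_ge0.
have growth (F : R -> R) : (forall w, `|F w| <= 2 * K * (1 + `|w|)) ->
    Num.sqrt (expect (fun c => F (Wsum c) ^+ 2)) <= 4 * K.
  move=> FK; have K4 : 0 <= 4 * K by rewrite mulr_ge0.
  rewrite -(ger0_norm K4) -sqrtr_sqr ler_wsqrtr//.
  apply: (@le_trans _ _ (expect (fun c => 8 * K ^+ 2 * (1 + Wsum c ^+ 2)))).
    apply: le_expect => c; have := FK (Wsum c).
    rewrite -(ler_sqr (x := `|F _|)) ?nnegrE ?mulr_ge0 ?addr_ge0//.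
    rewrite real_normK ?num_real// => /le_trans; apply.
    rewrite -[Wsum c ^+ 2]real_normK ?num_real//.
    have := mulr_ge0 (sqr_ge0 K) (sqr_ge0 (1 - `|Wsum c|)); lra.
  rewrite expectZ expectD expect_cst W_var; lra.
apply: le_trans (stein_discrepancy taylor) _.
rewrite /stein_cst mulrDl mulrDr lerD//.
  apply: le_trans (norm_expectM_le _ _) _; rewrite mulrCA mulrA.
  rewrite ler_pM ?sqrtr_ge0 ?growth// ler_wsqrtr//; exact: expect_sqr_1BZsum.
apply: le_trans (ler_norm _) _; apply: le_trans (norm_expectM_le _ _) _.
rewrite -mulrA mulrCA mulrA ler_pM ?sqrtr_ge0 ?growth//.
rewrite -sqrtrM; last by rewrite mulr_ge0// addr_ge0 ?mulr_ge0 ?exprn_ge0.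
rewrite ler_wsqrtr//; apply: le_trans expect_sqr_Tsum _.
rewrite -mulrA ler_wpM2l// big_split mulrDl lerD//.
  exact: sum_expect_sqr_qform.
exact: sum_expect_sqr_qform2.
Qed.

(** * Fourth moments, conditional expectations and counting *)

Definition cond_moment (S : {set 'I_n}) p : R := expect (fun c => cexp S (Gpair p) c ^+ 2).
(** The shared vertices of [p] that [p'] does not see; they can be integrated before the two pairs
    are separated. *)
Definition private (p p' : spair) : {set 'I_n} := (p.1 :&: p.2) :\: (p'.1 :|: p'.2).
Definition support2 p : {set 'I_n} := p.1 :|: p.2.

Lemma cond_moment_ge0 S p : 0 <= cond_moment S p.
Proof. by apply: expect_ge0 => c; exact: sqr_ge0. Qed.

Lemma disjoint_private p p' : [disjoint p'.1 & private p p'] /\ [disjoint p'.2 & private p p'].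
Proof.
by split; rewrite disjoint_sym; apply/pred0P => k /=;
  rewrite !inE; case: (k \in p'.1); case: (k \in p'.2); rewrite ?andbF.
Qed.

Lemma indep_private p p' : indep_of (private p p') (Gpair p').
Proof.
have [d1 d2] := disjoint_private p p'.
by apply: indep_ofM; exact: indep_disjoint.
Qed.

(** [Gpair p'] ignores the vertices private to [p], so [Gpair p] may be averaged over them for free,
    and conversely. Applying Cauchy-Schwarz only afterwards yields contractions instead of plain
    fourth moments. *)
Lemma norm_moment4_le p p' : `|moment4 p p'|
  <= Num.sqrt (cond_moment (private p p') p) * Num.sqrt (cond_moment (private p' p) p').
Proof.
set S := private p p'; set S' := private p' p.
have -> : moment4 p p' = expect (fun c => cexp S (Gpair p) c * cexp S' (Gpair p') c).
  rewrite /moment4 -(expect_cexp S).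
  transitivity (expect (fun c => cexp S (Gpair p) c * Gpair p' c)).
    apply: eq_expect => c.
    transitivity (cexp S (fun d => Gpair p' d * Gpair p d) c).
      by apply: eq_kop_fun => d; rewrite mulrC.
    by rewrite (cexpMl _ _ (@indep_private p p')) mulrC.
  rewrite -(expect_cexp S'); apply: eq_expect => c.
  have iS' : indep_of S' (cexp S (Gpair p)).
    apply: (indep_ofS (subsetUr S S')); apply: cexp_indep; exact: indep_private.
  by rewrite (cexpMl _ _ iS').
exact: norm_expectM_le.
Qed.

Lemma norm_moment2_le S p : `|moment2 p| <= Num.sqrt (cond_moment S p).
Proof.
rewrite -sqrtr_sqr ler_wsqrtr// /moment2 -(expect_cexp S).
exact: (sum_jensen_sqr prodw_ge0 _ prodw_sum1).
Qed.

Lemma moment4C p p' : moment4 p p' = moment4 p' p.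
Proof. by apply: eq_expect => c; rewrite mulrC. Qed.

Lemma cexp_G1M k J F : k \in J -> indep_of [set k] F ->
  expect (fun c => F c * G J c) = 0.
Proof. by move=> kJ iF; apply: (expect_orth iF); exact: G_degen. Qed.

(** Such a vertex lies in exactly one of the four sets, and integrating it kills that component. *)
Lemma moments_covered_once p p' k :
  k \in support2 p -> k \notin p.1 :&: p.2 -> k \notin support2 p' ->
  moment4 p p' = 0 /\ moment2 p = 0.
Proof.
rewrite !inE !negb_or => k1 k2 /andP[k3 k4].
have i2 : indep_of [set k] (Gpair p').
  by apply: indep_ofM; apply: indep_disjoint; exact: disjoint1.
have i1 J : k \notin J -> indep_of [set k] (G J).
  by move=> kJ; apply: indep_disjoint; exact: disjoint1.
case/orP: k1 => k1; rewrite k1 ?andbT /= in k2.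
- split.
    rewrite -(cexp_G1M k1 (indep_ofM i2 (i1 _ k2))); apply: eq_expect => c.
    by rewrite /Gpair; ring.
  by rewrite -(cexp_G1M k1 (i1 _ k2)); apply: eq_expect => c; rewrite /Gpair mulrC.
- split.
    rewrite -(cexp_G1M k1 (indep_ofM i2 (i1 _ k2))); apply: eq_expect => c.
    by rewrite /Gpair; ring.
  by rewrite -(cexp_G1M k1 (i1 _ k2)); apply: eq_expect => c.
Qed.

Lemma moment2_supp p : moment2 p != 0 -> (#|p.1| <= r)%N && (#|p.2| <= r)%N.
Proof.
move=> h; apply/andP; split; rewrite leqNgt; apply: contraNN h => h; apply/eqP;
  rewrite -(expect_cst 0); apply: eq_expect => c; rewrite /Gpair.
  by rewrite (G_supp (J := p.1)) ?mul0r// negb_and -!ltnNge h orbT.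
by rewrite (G_supp (J := p.2)) ?mulr0// negb_and -!ltnNge h orbT.
Qed.

Lemma moment4_supp2 (p p' : spair) : moment4 p p' != 0 ->
  (#|p.1| <= r)%N && (#|p.2| <= r)%N.
Proof.
move=> h; apply/andP; split; rewrite leqNgt; apply: contraNN h => h; apply/eqP;
  rewrite -(expect_cst 0); apply: eq_expect => c; rewrite /Gpair.
  by rewrite (G_supp (J := p.1)) ?mul0r// negb_and -!ltnNge h orbT.
by rewrite (G_supp (J := p.2)) ?mulr0 ?mul0r// negb_and -!ltnNge h orbT.
Qed.

Definition quad_term (p p' : spair) : R := `|moment4 p p'| + `|moment2 p * moment2 p'|.

Definition quad_small (p p' : spair) : bool :=
  (#|support2 p :|: support2 p'| <= 4 * r)%N.

(** Four sets of size at most [r] give [4 * r]; the inclusions say that no vertex of the union is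
    covered only once. *)
Lemma quad_term_neq0 p p' : quad_term p p' != 0 ->
  [/\ quad_small p p', support2 p :\: (p.1 :&: p.2) \subset support2 p'
    & support2 p' :\: (p'.1 :&: p'.2) \subset support2 p].
Proof.
move=> h; split.
- have : [&& #|p.1| <= r, #|p.2| <= r, #|p'.1| <= r & #|p'.2| <= r]%N.
    have [m4|m4] := eqVneq (moment4 p p') 0.
      have : moment2 p * moment2 p' != 0.
        by apply: contraNneq h => m2; rewrite /quad_term m4 m2 normr0 addr0.
      by rewrite mulf_eq0 negb_or => /andP[/moment2_supp/andP[-> ->] /moment2_supp].
    have m4' := m4; rewrite moment4C in m4'.
    have /andP[-> ->] := moment4_supp2 m4; exact: moment4_supp2 m4'.
  move=> /and4P[h1 h2 h3 h4]; rewrite /quad_small /support2.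
  apply: leq_trans (leq_card_setU _ _) _; apply: (@leq_trans (2 * r + 2 * r)); last by clear; lia.
  by apply: leq_add; apply: leq_trans (leq_card_setU _ _) _; rewrite mul2n -addnn leq_add.
- apply/subsetP => k; rewrite in_setD => /andP[k1 k2].
  apply: contraNT h => k3; have [m4 m2] := moments_covered_once k2 k1 k3.
  by rewrite /quad_term m4 m2 mul0r normr0 addr0.
- apply/subsetP => k; rewrite in_setD => /andP[k1 k2].
  apply: contraNT h => k3; have [m4 m2] := moments_covered_once k2 k1 k3.
  by rewrite /quad_term moment4C m4 m2 mulr0 normr0 addr0.
Qed.

Section QuadSum.
Variable beta : R.
Hypotheses (beta_ge0 : 0 <= beta) (n_gt0 : (0 < n)%N).
Local Notation nR := (n%:R : R).
Hypothesis cond_moment_le : forall S p, S \subset p.1 :&: p.2 ->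
  p.1 :&: p.2 != set0 -> support2 p != S -> 
  cond_moment S p <= beta * nR ^+ (4 * r) / nR ^+ (#|S| + #|support2 p|).

(** Every vertex of [p] outside [p'] is private, so the union has size [#|S| + #|support2 p'|], and
    symmetrically. The two exponents therefore add up to twice the size of the union, which the
    square root halves. Linkage supplies the side conditions of [cond_moment_le]. *)
Lemma quad_term_le p p' : linked p p' -> quad_term p p' != 0 ->
  quad_term p p' <= 2 * (beta * nR ^+ (4 * r) / nR ^+ #|support2 p :|: support2 p'|).
Proof.
move=> lk nz; have [_ sub1 sub2] := quad_term_neq0 nz.
set S := private p p'; set S' := private p' p.
have n0 : 0 < nR by rewrite ltr0n.
pose X := beta * nR ^+ (4 * r) / nR ^+ #|support2 p :|: support2 p'|.
suff XX : Num.sqrt (cond_moment S p) * Num.sqrt (cond_moment S' p') <= X.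
  rewrite mulr_natl mulr2n lerD//; first exact: le_trans (norm_moment4_le _ _) XX.
  by apply: le_trans XX; rewrite normrM ler_pM// norm_moment2_le.
have X0 : 0 <= X by rewrite !mulr_ge0 ?invr_ge0 ?exprn_ge0// ltW.
rewrite -sqrtrM ?cond_moment_ge0// -[X]ger0_norm// -sqrtr_sqr ler_wsqrtr//.
have card1 : #|support2 p :|: support2 p'| = (#|S| + #|support2 p'|)%N.
  have -> : support2 p :|: support2 p' = S :|: support2 p'.
    apply/setP => k; rewrite /S /private in_setU [in RHS]in_setU in_setD -/(support2 p').
    have := subsetP sub1 k; rewrite in_setD.
    rewrite /support2 !inE; case: (k \in p.1); case: (k \in p.2);
      by case: (k \in p'.1); case: (k \in p'.2) => //=; move=> /(_ isT).
  rewrite cardsU (_ : S :&: _ = set0) ?cards0 ?subn0//.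
  apply/setP => k; rewrite /S /private /support2 !inE.
  by case: (k \in p.1); case: (k \in p.2); case: (k \in p'.1); case: (k \in p'.2).
have card2 : #|support2 p :|: support2 p'| = (#|S'| + #|support2 p|)%N.
  have -> : support2 p :|: support2 p' = S' :|: support2 p.
    apply/setP => k; rewrite /S' /private in_setU [in RHS]in_setU in_setD -/(support2 p).
    have := subsetP sub2 k; rewrite in_setD.
    rewrite /support2 !inE; case: (k \in p.1); case: (k \in p.2);
      by case: (k \in p'.1); case: (k \in p'.2) => //=; move=> /(_ isT).
  rewrite cardsU (_ : S' :&: _ = set0) ?cards0 ?subn0//.
  apply/setP => k; rewrite /S' /private /support2 !inE.
  by case: (k \in p.1); case: (k \in p.2); case: (k \in p'.1); case: (k \in p'.2).
have /and3P[l1 l2 l3] := lk.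
have ne q q' : (support2 q :&: support2 q') != set0 -> support2 q != private q q'.
  apply: contraNneq => e; apply/eqP/setP => k.
  rewrite [in RHS]inE inE e /private /support2 !inE.
  by case: (k \in q.1); case: (k \in q.2); case: (k \in q'.1); case: (k \in q'.2).
have c1 : cond_moment S p <= beta * nR ^+ (4 * r) / nR ^+ (#|S| + #|support2 p|).
  by apply: cond_moment_le; rewrite ?subsetDl// ne.
have c2 : cond_moment S' p' <= beta * nR ^+ (4 * r) / nR ^+ (#|S'| + #|support2 p'|).
  by apply: cond_moment_le; rewrite ?subsetDl// ne// setIC.
apply: le_trans (ler_pM (cond_moment_ge0 _ _) (cond_moment_ge0 _ _) c1 c2) _.
rewrite le_eqVlt; apply/orP; left; apply/eqP; rewrite /X expr2.
rewrite -!mulrA; congr (_ * (_ * _)).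
rewrite mulrCA [RHS]mulrCA; congr (_ * _).
rewrite mulrCA [RHS]mulrCA; congr (_ * _).
rewrite -!invfM -!exprD; congr (_ ^- _).
have arith (a b x y u : nat) : (u = a + y -> u = b + x -> (a + x) + (b + y) = u + u)%N.
  by clear; lia.
exact: arith card1 card2.
Qed.

(** At most [(2 ^ 4) ^ v] quadruples have a given union of size [v], and there are at most [n ^ v]
    such unions, which cancels the power of [n] in [quad_term_le]. *)
Lemma quad_sum_le :
  quad_sum <= 2 * beta * nR ^+ (4 * r) * \sum_(v < (4 * r).+1) 16 ^+ v.
Proof.
have n0 : 0 < nR by rewrite ltr0n.
pose X := 2 * (beta * nR ^+ (4 * r)).
pose U (q : spair * spair) := support2 q.1 :|: support2 q.2.
have X0 : 0 <= X by rewrite mulr_ge0 ?mulr_ge0 ?exprn_ge0// ltW.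
apply: (@le_trans _ _ (\sum_(q : spair * spair | (#|U q| <= 4 * r)%N) X / nR ^+ #|U q|)).
  rewrite /quad_sum.
  under eq_bigr do rewrite big_mkcond.
  rewrite (pair_bigA _ (fun p p' => if linked p p' then quad_term p p' else 0))/=.
  rewrite [leRHS]big_mkcond; apply: ler_sum => -[p p'] _ /=.
  have [q0|q0] := eqVneq (quad_term p p') 0.
    by rewrite q0 if_same; case: ifP => // _; rewrite divr_ge0 ?exprn_ge0 ?(ltW n0).
  have [small _ _] := quad_term_neq0 q0.
  rewrite [X in _ <= if X then _ else _]small.
  case: ifP => [lk|_]; last by rewrite divr_ge0 ?exprn_ge0 ?(ltW n0).
  by apply: le_trans (quad_term_le lk q0) _; rewrite /X mulrA.
rewrite (partition_big U (fun V => (#|V| <= 4 * r)%N))//=.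
apply: (@le_trans _ _ (\sum_(V : {set 'I_n} | (#|V| <= 4 * r)%N) X * (16 / nR) ^+ #|V|)).
  apply: ler_sum => V Vr.
  rewrite (eq_bigr (fun=> X / nR ^+ #|V|)); last by move=> q /andP[_ /eqP ->].
  rewrite sumr_const expr_div_n -[X in X <= _]mulr_natr -mulrA ler_wpM2l// mulrC.
  rewrite ler_wpM2r ?invr_ge0 ?exprn_ge0 ?(ltW n0)//.
  rewrite -natrX ler_nat.
  pose PV := powerset V.
  apply: (@leq_trans #|setX (setX PV PV) (setX PV PV)|).
    apply: subset_leq_card; apply/subsetP => -[[I J] [I' J']].
    rewrite unfold_in /= => /andP[_ /eqP e]; rewrite /PV -e !inE /U /support2 /=.
    by rewrite -!andbA; apply/and4P; split; apply/subsetP => k kI; rewrite !inE kI ?orbT.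
  rewrite !cardsX !card_powerset -!expnD.
  by rewrite (_ : 16 = 2 ^ 4)%N// -expnM leq_exp2l//; clear; lia.
rewrite -mulr_sumr /X -!mulrA ler_wpM2l//.
do 2 (rewrite ler_wpM2l ?exprn_ge0 ?(ltW n0)//).
rewrite (partition_big (fun V : {set 'I_n} => inord #|V| : 'I_(4 * r).+1) predT)//=.
apply: ler_sum => v _.
apply: (@le_trans _ _ (\sum_(V : {set 'I_n} | #|V| == v) (16 / nR) ^+ v)).
  rewrite big_mkcond [leRHS]big_mkcond; apply: ler_sum => V _ /=.
  have z0 : 0 <= (16 / nR) ^+ v by rewrite exprn_ge0// divr_ge0// ltW.
  case: ifPn => [/andP[Vr /eqP e]|_]; last by case: ifP.
  have e' : #|V| = v by rewrite -e inordK// ltnS.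
  by rewrite e' eqxx.
rewrite sumr_const expr_div_n -[X in X <= _]mulr_natr -mulrA ler_piMr ?exprn_ge0//.
rewrite mulrC ler_pdivrMr ?exprn_gt0// mul1r -natrX ler_nat.
have -> : #|[pred V : {set 'I_n} | #|V| == v]| = 'C(n, v).
  by rewrite -[n in RHS]card_ord -card_draws; apply: eq_card => V; rewrite !inE.
apply: (@leq_trans (n ^_ v)); first by rewrite -bin_ffact leq_pmulr ?fact_gt0.
rewrite ffact_prod -[v in (_ ^ v)%N]card_ord -prod_nat_const.
by apply: leq_prod => i _; exact: leq_subr.
Qed.
End QuadSum.

End DegenerateFamily.

End ProductSpace.

(** * Contractions *)

Section TupleIntegrals.
Variables (R : realType) (m : nat) (p : R).
Hypotheses (p_gt0 : 0 < p) (p_lt1 : p < 1).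
Local Notation T := (attr m).
Local Notation mu := (@mu R m p).
Implicit Types (a b c d e i j : nat) (s u : seq T).

Lemma mu_ge0 (x : T) : 0 <= mu x.
Proof. by rewrite mulr_ge0 ?exprn_ge0 ?subr_ge0// ltW. Qed.

Lemma mu_sum1 : \sum_(x : T) mu x = 1.
Proof.
(* The weight of [x] is a product of Bernoulli weights over the attributes, so the sum factors. *)
transitivity (\sum_(x : T) \prod_i (if x i then p else 1 - p)).
  apply: eq_bigr => x _; rewrite (bigID (fun k => x k))/=.
  rewrite (eq_bigr (fun=> p)) => [|k ->//]; rewrite prodr_const.
  rewrite (eq_bigr (fun=> 1 - p)) => [|k /negbTE -> //]; rewrite prodr_const.
  rewrite /mu /attr_size; congr (_ ^+ _ * _ ^+ _); first by rewrite cardsE.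
  transitivity #|~: [set k | x k]|; first by rewrite [RHS]cardsCs setCK card_ord.
  by apply: eq_card => k; rewrite !inE.
rewrite -(bigA_distr_bigA (fun _ (x : bool) => if x then p else 1 - p)).
by rewrite big1// => k _; rewrite big_bool/= addrC subrK.
Qed.

Lemma muprod_cat s u : muprod p (s ++ u) = muprod p s * muprod p u.
Proof. exact: big_cat. Qed.

Lemma muprod_ge0 s : 0 <= muprod p s.
Proof. by apply: prodr_ge0 => x _; exact: mu_ge0. Qed.

Definition tint a (F : seq T -> R) : R := \sum_(t : a.-tuple T) muprod p t * F t.

Lemma eq_tint a F F' : (forall s, size s = a -> F s = F' s) -> tint a F = tint a F'.
Proof. by move=> e; apply: eq_bigr => t _; rewrite e// size_tuple. Qed.

Lemma le_tint a F F' : (forall s, size s = a -> F s <= F' s) -> tint a F <= tint a F'.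
Proof.
by move=> e; apply: ler_sum => t _; rewrite ler_wpM2l ?muprod_ge0// e// size_tuple.
Qed.

Lemma tint_ge0 a F : (forall s, size s = a -> 0 <= F s) -> 0 <= tint a F.
Proof.
by move=> e; apply: sumr_ge0 => t _; rewrite mulr_ge0 ?muprod_ge0// e// size_tuple.
Qed.

Lemma tintZ a x F : tint a (fun s => x * F s) = x * tint a F.
Proof. by rewrite mulr_sumr; apply: eq_bigr => t _; rewrite mulrCA. Qed.

Lemma tint0 F : tint 0 F = F [::].
Proof.
rewrite /tint (bigD1 [tuple])//= /muprod big_nil mul1r big1 ?addr0// => t.
by move=> /negP[]; apply/eqP; exact: tuple0.
Qed.

Lemma tint_swap a b F :
  tint a (fun s => tint b (F s)) = tint b (fun u => tint a (fun s => F s u)).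
Proof.
rewrite /tint; under eq_bigr do rewrite mulr_sumr; rewrite exchange_big/=.
by apply: eq_bigr => u _; rewrite mulr_sumr; apply: eq_bigr => s _; rewrite mulrCA.
Qed.

Lemma tintD a b F : tint (a + b) F = tint a (fun s => tint b (fun u => F (s ++ u))).
Proof.
pose f (q : a.-tuple T * b.-tuple T) := cat_tuple q.1 q.2.
have f_inj : injective f.
  move=> [s u] [s' u'] /(congr1 val)/= /eqP.
  rewrite eqseq_cat ?size_tuple// => /andP[/eqP/val_inj -> /eqP/val_inj ->] //.
have f_bij : bijective f.
  by apply: inj_card_bij => //; rewrite card_prod !card_tuple expnD.
rewrite /tint (reindex f) /=; last exact: onW_bij.
rewrite -(pair_bigA _ (fun (s : a.-tuple T) (u : b.-tuple T) => muprod p (s ++ u) * F (s ++ u)))/=.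
apply: eq_bigr => s _; rewrite mulr_sumr; apply: eq_bigr => u _.
by rewrite muprod_cat mulrA.
Qed.

Lemma tint_pair a b (F : seq T -> seq T -> R) :
  tint a (fun s => tint b (F s)) = tint (a + b) (fun t => F (take a t) (drop a t)).
Proof.
rewrite tintD; apply: eq_tint => s sa; apply: eq_tint => u _.
by rewrite take_size_cat// drop_size_cat.
Qed.

Lemma tint_CS a F F' :
  tint a (fun s => F s * F' s) ^+ 2 <= tint a (fun s => F s ^+ 2) * tint a (fun s => F' s ^+ 2).
Proof. exact: (sum_cauchy_schwarz (fun t : a.-tuple T => muprod_ge0 t) F F'). Qed.

Lemma tint_CS2 a b (F F' : seq T -> seq T -> R) :
  tint a (fun s => tint b (fun u => F s u * F' s u)) ^+ 2 <=
  tint a (fun s => tint b (fun u => F s u ^+ 2))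
  * tint a (fun s => tint b (fun u => F' s u ^+ 2)).
Proof. by rewrite !tint_pair; exact: tint_CS. Qed.

(* [contr_sqr a c d e f g] is [|| f *_(a+c)^a g ||^2] where [f] has the [a + c]
   shared arguments and [d] further ones, and [g] has [e] further ones. *)
Definition contr_sqr a c d e (f g : mfun R m) : R :=
  tint c (fun x => tint d (fun y => tint e (fun z =>
    tint a (fun w => f (w ++ x ++ y) * g (w ++ x ++ z)) ^+ 2))).

(** Dictionary with the contraction of the theorem: [b = a + c] and [k = a + c + d]; the arity of
    [g] enters through the number [e] of remaining variables. *)
Lemma l2norm_contr a c d e f g :
  l2norm p (c + (d + e)) (contr p a (a + c) (a + c + d) f g) ^+ 2 = contr_sqr a c d e f g.
Proof.
rewrite /l2norm sqr_sqrtr; last first.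
  by apply: sumr_ge0 => t _; rewrite mulr_ge0 ?muprod_ge0 ?sqr_ge0.
rewrite -/(tint _ (fun t => contr p a (a + c) (a + c + d) f g t ^+ 2)).
rewrite tintD; apply: eq_tint => x xc; rewrite tintD; apply: eq_tint => y yd.
apply: eq_tint => z ze; congr (_ ^+ 2); rewrite /contr addKn take_size_cat// drop_size_cat//.
by rewrite addKn take_size_cat// drop_size_cat.
Qed.

Lemma contr_sqr_ge0 a c d e f g : 0 <= contr_sqr a c d e f g.
Proof. by do 3 (apply: tint_ge0 => ? _); exact: sqr_ge0. Qed.

Lemma contr_sqrC a c d e f g : contr_sqr a c d e f g = contr_sqr a c e d g f.
Proof.
apply: eq_tint => x _; rewrite tint_swap; apply: eq_tint => y _; apply: eq_tint => z _.
by congr (_ ^+ 2); apply: eq_tint => w0 _; rewrite mulrC.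
Qed.

Definition sym_on j (f : mfun R m) := forall s u, size s = j -> perm_eq s u -> f s = f u.

(** Cauchy-Schwarz in the contracted variables separates the free variables of [f] from those of
    [g]. What remains is the integral over the shared [x] of two partial squared norms, to which it
    is applied again. *)
Lemma contr_sqr_split a c d e f g : sym_on (a + c + d) f -> sym_on (a + c + e) g ->
  contr_sqr a c d e f g ^+ 2 <= contr_sqr (a + d) c 0 0 f f * contr_sqr (a + e) c 0 0 g g.
Proof.
move=> sf sg.
pose A b q x := tint b (fun w => q (w ++ x) ^+ 2) : R.
have Asplit b q x : sym_on (a + c + b) q -> size x = c ->
    tint b (fun y => tint a (fun w => q (w ++ x ++ y) ^+ 2)) = A (a + b)%N q x.
  move=> sq xc; rewrite /A tintD tint_swap; apply: eq_tint => w0 wa; apply: eq_tint => y yb.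
  congr (_ ^+ 2); apply: sq; first by rewrite !size_cat wa xc yb addnA.
  by rewrite -catA perm_cat2l perm_catC.
have Aself b q : contr_sqr b c 0 0 q q = tint c (fun x => A b q x ^+ 2).
  apply: eq_tint => x _; rewrite !tint0; congr (_ ^+ 2); apply: eq_tint => w0 _.
  by rewrite cats0 expr2.
rewrite !Aself; apply: le_trans (tint_CS _ _ _).
have h0 : 0 <= tint c (fun x => A (a + d)%N f x * A (a + e)%N g x).
  by apply: tint_ge0 => x _; apply: mulr_ge0; apply: tint_ge0 => ? _; exact: sqr_ge0.
rewrite ler_sqr ?nnegrE ?contr_sqr_ge0//.
apply: le_tint => x xc; rewrite -!Asplit// mulrC -tintZ; apply: le_tint => y _.
rewrite mulrC -tintZ; apply: le_tint => z _; exact: tint_CS.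
Qed.

Lemma tint_swap22 d e a b (F : seq T -> seq T -> seq T -> seq T -> R) :
  tint d (fun y => tint e (fun z => tint a (fun s => tint b (fun u => F y z s u))))
  = tint a (fun s => tint b (fun u => tint d (fun y => tint e (fun z => F y z s u)))).
Proof.
transitivity (tint d (fun y => tint a (fun s => tint e (fun z => tint b (fun u => F y z s u))))).
  by apply: eq_tint => y _; rewrite tint_swap.
rewrite tint_swap; apply: eq_tint => s _; rewrite [RHS]tint_swap.
by apply: eq_tint => y _; rewrite tint_swap.
Qed.

(** The squared integral is written with two copies [s], [u] of the contracted variables and the
    order of integration is exchanged. Contracted and free variables swap roles, and [f] and [g]
    separate into two factors for Cauchy-Schwarz. *)
Lemma contr_sqr_dual a d e f g : sym_on (a + d) f -> sym_on (a + e) g ->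
  contr_sqr a 0 d e f g ^+ 2 <= contr_sqr d 0 a a f f * contr_sqr e 0 a a g g.
Proof.
move=> sf sg.
pose K b q s u := tint b (fun y => q (s ++ y) * q (u ++ y)) : R.
have Kself b q : sym_on (a + b) q ->
    contr_sqr b 0 a a q q = tint a (fun s => tint a (fun u => K b q s u ^+ 2)).
  move=> sq; rewrite /contr_sqr tint0; apply: eq_tint => s sa; apply: eq_tint => u ua.
  congr (_ ^+ 2); apply: eq_tint => y yb; rewrite cat0s /=.
  congr (_ * _); apply: sq; rewrite ?size_cat ?yb ?sa ?ua 1?addnC //.
    by rewrite perm_catC.
  by rewrite perm_catC.
rewrite !Kself//; apply: le_trans (tint_CS2 _ _ _ _).
rewrite le_eqVlt; apply/orP; left; apply/eqP; congr (_ ^+ 2).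
rewrite /contr_sqr tint0.
transitivity (tint d (fun y => tint e (fun z => tint a (fun s => tint a (fun u =>
   (f (s ++ y) * g (s ++ z)) * (f (u ++ y) * g (u ++ z))))))).
  apply: eq_tint => y _; apply: eq_tint => z _; rewrite expr2 -tintZ.
  apply: eq_tint => s _; rewrite mulrC -tintZ; apply: eq_tint => u _ /=; by [].
rewrite tint_swap22; apply: eq_tint => s _; apply: eq_tint => u _.
rewrite /K mulrC -tintZ; apply: eq_tint => y _; rewrite mulrC -tintZ.
by apply: eq_tint => z _; ring.
Qed.

(** * Domination by the contractions of the theorem *)

Section ContractionBound.
Variables (r : nat) (fj : nat -> mfun R m) (B x : R).
Hypotheses (fj_sym : forall j, (j <= r)%N -> sym_on j (fj j)) (B_ge0 : 0 <= B) (x_gt0 : 0 < x).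
Hypothesis full_le : forall i j, (i < j <= r)%N ->
  contr_sqr i (j - i) 0 0 (fj j) (fj j) <= B * x ^+ (3 * j - i).
Hypothesis diag_le : forall i j, (1 <= i)%N -> (i < j <= r)%N ->
  contr_sqr i 0 (j - i) (j - i) (fj j) (fj j) <= B * x ^+ (2 * j).
Hypothesis mixed_le : forall i j, (1 <= i)%N -> (i < j <= r)%N ->
  contr_sqr i 0 (j - i) 0 (fj j) (fj i) <= B * x ^+ (j + i).

Let sqr_le_geom (y z u : R) k l q : 0 <= y -> 0 <= z -> 0 <= u ->
  y ^+ 2 <= z * u -> z <= B * x ^+ k -> u <= B * x ^+ l -> (k + l = 2 * q)%N ->
  y <= B * x ^+ q.
Proof.
move=> y0 z0 u0 yzu zB uB kl.
have Bq : 0 <= B * x ^+ q by rewrite mulr_ge0// exprn_ge0// ltW.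
rewrite -ler_sqr ?nnegrE//; apply: le_trans yzu _.
apply: le_trans (ler_pM z0 u0 zB uB) _.
by rewrite exprMn -exprM mulnC -kl exprD expr2 mulrACA.
Qed.

(** With [c > 0], [contr_sqr_split] leads to [full_le]; with [c = 0] and [d], [e] both positive,
    [contr_sqr_dual] leads to [diag_le]. With [c = 0] and one of [d], [e] zero, either inequality
    would produce a fourth power of a norm as a factor, which is why a mixed contraction has to be
    part of the bound. *)
Lemma contr_sqr_le a c d e : (a + c + d <= r)%N -> (a + c + e <= r)%N ->
  (0 < a + c)%N -> (0 < c + d + e)%N ->
  contr_sqr a c d e (fj (a + c + d)) (fj (a + c + e)) <= B * x ^+ (2 * a + 3 * c + d + e).
Proof.
move=> kr lr ac cde.
have [c0|c0] := posnP c; last first.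
  have h1 := @full_le (a + d) (a + c + d); have h2 := @full_le (a + e) (a + c + e).
  rewrite (_ : a + c + d - (a + d) = c)%N in h1; last by clear; lia.
  rewrite (_ : a + c + e - (a + e) = c)%N in h2; last by clear; lia.
  apply: sqr_le_geom (contr_sqr_split (fj_sym kr) (fj_sym lr)) (h1 _) (h2 _) _;
    rewrite ?contr_sqr_ge0//; clear h1 h2; lia.
rewrite c0 in kr lr ac cde *; rewrite !addn0 in kr lr ac cde *.
have [d0|d0] := posnP d.
  rewrite d0 !addn0 in cde *; have h := @mixed_le a (a + e) ac.
  rewrite contr_sqrC; rewrite addKn in h.
  rewrite (_ : 2 * a + e = a + e + a)%N; last by clear; lia.
  apply: h; clear - lr cde; lia.
have [e0|e0] := posnP e.
  rewrite e0 !addn0; have h := @mixed_le a (a + d) ac; rewrite addKn in h.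
  rewrite (_ : 2 * a + d = a + d + a)%N; last by clear; lia.
  apply: h; clear - kr d0; lia.
have h1 := @diag_le d (a + d) d0; have h2 := @diag_le e (a + e) e0.
rewrite addnK in h1; rewrite addnK in h2.
apply: sqr_le_geom (contr_sqr_dual (fj_sym kr) (fj_sym lr)) (h1 _) (h2 _) _;
  rewrite ?contr_sqr_ge0//; clear - kr lr ac; lia.
Qed.
End ContractionBound.
End TupleIntegrals.

(** * Hoeffding decomposition *)

Section Configurations.
Variables (R : realType) (n m : nat) (p : R).
Hypotheses (p_gt0 : 0 < p) (p_lt1 : p < 1).
Local Notation T := (attr m).
Local Notation mu := (@mu R m p).
Local Notation conf := {ffun 'I_n -> T}.
Local Notation cexp := (@cexp R n T mu).
Local Notation expect := (@expect R n T mu).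
Local Notation tint := (@tint R m p).
Local Notation dirac := (@dirac R T).
Let mu1 : \sum_(x : T) mu x = 1 := mu_sum1 m p.
Implicit Types (S J A : {set 'I_n}) (c : conf) (L : seq 'I_n) (F : conf -> R).
Implicit Types (Psi : seq T -> R).

Lemma map_nth_index (x0 : T) (t : seq T) L : uniq L -> size t = size L ->
  map (fun k => nth x0 t (index k L)) L = t.
Proof.
move=> uL tL; apply: (@eq_from_nth _ x0); rewrite size_map ?tL// => i iL.
pose k0 := tnth (in_tuple L) (Ordinal iL).
by rewrite (nth_map k0)// index_uniq.
Qed.

(** [Psi] is expanded over the possible tuples of values along [L]. The indicator of one tuple is a
    product over vertices, so the sum over configurations factors. *)
Lemma cexp_map S L Psi c : uniq L -> {subset L <= S} ->
  cexp S (fun c' => Psi (map c' L)) c = tint (size L) Psi.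
Proof.
move=> uL LS; rewrite /cexp /kop /tint.
have e (c' : conf) : Psi (map c' L) =
    \sum_(t : (size L).-tuple T) (val t == map c' L)%:R * Psi t.
  have sz : size (map c' L) == size L by rewrite size_map.
  rewrite (bigD1 (Tuple sz))//= eqxx mul1r big1 ?addr0// => t.
  by rewrite -val_eqE /= => /negbTE ->; rewrite mul0r.
under eq_bigr do rewrite e mulr_sumr.
rewrite exchange_big/=; apply: eq_bigr => t _.
under eq_bigr do rewrite mulrA; rewrite -mulr_suml; congr (_ * _).
pose x0 : T := [ffun=> false].
pose tau k := nth x0 t (index k L).
have mem_eq (c' : conf) : (val t == map c' L)%:R
    = \prod_k (if k \in L then (c' k == tau k)%:R else 1) :> R.
  rewrite -big_mkcond/=; have [tL|tL] := eqVneq.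
    rewrite big1// => k kL.
    by rewrite /tau tL (nth_map k) ?index_mem// nth_index// eqxx.
  have [k kL ck] : exists2 k, k \in L & c' k != tau k.
    apply/hasP; rewrite has_predC; apply: contra tL => /allP h; apply/eqP.
    rewrite -[LHS](map_nth_index x0 uL) ?size_tuple//.
    by apply/eq_in_map => k /h /eqP.
  by rewrite (bigD1 k)//= (negbTE ck) mul0r.
under eq_bigr => c' _ do rewrite mem_eq /kerw -big_split/=.
rewrite (sum_prod_kernel (fun k a => resample mu S k (c k) a
  * (if k \in L then (a == tau k)%:R else 1))).
transitivity (\prod_(k in L) mu (tau k)).
  rewrite [RHS]big_mkcond; apply: eq_bigr => k _.
  case: ifPn => kL; last first.
    by under eq_bigr do rewrite mulr1; rewrite resample_sum1.
  rewrite /resample LS//; exact: (dirac_sumr (fun a => mu a)).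
rewrite -big_uniq//= /muprod.
by rewrite -[in RHS](map_nth_index x0 uL (size_tuple t)) big_map.
Qed.

Lemma expect_map L Psi : uniq L -> expect (fun c' => Psi (map c' L)) = tint (size L) Psi.
Proof.
move=> uL; rewrite -(cexpT mu _ [ffun=> [ffun=> false]]) cexp_map// => k _.
by rewrite inE.
Qed.

Lemma map_agree S L c c' : kerw (resample mu S) c c' != 0 ->
  [disjoint [set k in L] & S] -> map c' L = map c L.
Proof.
move=> /kerw_resample_agree e dLS; apply/eq_in_map => k kL.
by rewrite -e// (disjointFr dLS)// inE.
Qed.

Lemma cexp_eq S F F' c : (forall c', kerw (resample mu S) c c' != 0 -> F c' = F' c') ->
  cexp S F c = cexp S F' c.
Proof.
move=> e; apply: eq_bigr => c' _.
by have [->|h] := eqVneq (kerw (resample mu S) c c') 0; [rewrite !mul0r|rewrite e].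
Qed.

Section CondMoment.
Variables (r : nat) (fj : nat -> mfun R m) (coef : {set 'I_n} -> R).
Hypothesis fj_sym : forall j, (j <= r)%N -> sym_on j (fj j).

Definition Gfun J c := coef J * fj #|J| (map c (enum J)).

Let enumU (A A' : {set 'I_n}) : [disjoint A & A'] -> perm_eq (enum (A :|: A')) (enum A ++ enum A').
Proof.
move=> dA; apply: uniq_perm; rewrite ?enum_uniq//; last first.
  by move=> k; rewrite mem_cat !mem_enum inE.
rewrite cat_uniq !enum_uniq andbT/=; apply/hasPn => k; rewrite !mem_enum => kA'.
by rewrite (disjointFl dA).
Qed.

(** The vertices of the union form four blocks: [S], integrated inside the square; [X], shared and
    kept; and the two set differences. Symmetry lets both kernels list their arguments block by
    block, and the blocks become the variables of the contraction. *)
Lemma cond_moment_contr S (I J : {set 'I_n}) : (#|I| <= r)%N -> (#|J| <= r)%N -> S \subset I :&: J ->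
  let X := (I :&: J) :\: S in
  cond_moment mu Gfun S (I, J) = (coef I * coef J) ^+ 2 *
    contr_sqr p #|S| #|X| #|I :\: J| #|J :\: I| (fj #|I|) (fj #|J|).
Proof.
move=> Ir Jr /subsetIP[SI SJ] X; set Y := I :\: J; set Z := J :\: I.
have dSX : [disjoint S & X] by rewrite disjoint_sym disjoints_subset subsetDr.
have dSY : [disjoint S & Y].
  by apply: disjointWl SJ _; rewrite disjoint_sym disjoints_subset subsetDr.
have dSZ : [disjoint S & Z].
  by apply: disjointWl SI _; rewrite disjoint_sym disjoints_subset subsetDr.
have dXY : [disjoint X & Y].
  rewrite disjoint_sym disjoints_subset; apply/subsetP => k.
  by rewrite !inE => /andP[/negbTE -> _]; rewrite andbF andbF.
have dXZ : [disjoint X & Z].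
  rewrite disjoint_sym disjoints_subset; apply/subsetP => k.
  by rewrite !inE => /andP[/negbTE -> _]; rewrite andbF.
have dYZ : [disjoint Y & Z].
  rewrite disjoints_subset; apply/subsetP => k.
  by rewrite !inE => /andP[_ ->].
have decI : I = S :|: (X :|: Y).
  apply/setP => k; have := subsetP SI k; have := subsetP SJ k; rewrite !inE.
  by case: (k \in S); case: (k \in I); case: (k \in J) => // h1 h2; have := h1 isT; have := h2 isT.
have decJ : J = S :|: (X :|: Z).
  apply/setP => k; have := subsetP SI k; have := subsetP SJ k; rewrite !inE.
  by case: (k \in S); case: (k \in I); case: (k \in J) => // h1 h2; have := h1 isT; have := h2 isT.
have perm3 (Q : {set 'I_n}) : [disjoint S & Q] -> [disjoint X & Q] ->
    perm_eq (enum (S :|: (X :|: Q))) (enum S ++ enum X ++ enum Q).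
  move=> dSQ dXQ; apply: (perm_trans (enumU _)).
    by rewrite disjoint_sym -setI_eq0 setIUl setU_eq0 !setI_eq0 !(disjoint_sym _ S) dSX dSQ.
  by rewrite perm_cat2l enumU.
have fI (c : conf) : fj #|I| (map c (enum I)) =
    fj #|I| (map c (enum S) ++ map c (enum X) ++ map c (enum Y)).
  rewrite -!map_cat; apply: (fj_sym Ir); first by rewrite size_map -cardE.
  by apply: perm_map; rewrite [in enum I]decI perm3.
have fJ (c : conf) : fj #|J| (map c (enum J)) =
    fj #|J| (map c (enum S) ++ map c (enum X) ++ map c (enum Z)).
  rewrite -!map_cat; apply: (fj_sym Jr); first by rewrite size_map -cardE.
  by apply: perm_map; rewrite [in enum J]decJ perm3.
pose Phi x y z := tint #|S| (fun w => fj #|I| (w ++ x ++ y) * fj #|J| (w ++ x ++ z)) : R.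
have cE c : cexp S (Gpair Gfun (I, J)) c =
    coef I * coef J * Phi (map c (enum X)) (map c (enum Y)) (map c (enum Z)).
  rewrite /Phi [#|S| in RHS]cardE -(@cexp_map S _ _ c (enum_uniq S)); last first.
    by move=> k; rewrite mem_enum.
  rewrite /cexp -kopZ; apply: cexp_eq => c' cc'.
  rewrite /Gpair /Gfun/= fI fJ.
  have agree (Q : {set 'I_n}) : [disjoint S & Q] -> map c' (enum Q) = map c (enum Q).
    move=> dSQ; apply: (map_agree cc'); rewrite disjoint_sym.
    by rewrite (_ : [set k in enum Q] = Q)//; apply/setP => k; rewrite inE mem_enum.
  by rewrite (agree X)// (agree Y)// (agree Z)//; ring.
rewrite /cond_moment (eq_expect _ (fun c => congr1 (fun x => x ^+ 2) (cE c))).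
rewrite (eq_expect _ (fun c => exprMn _ _ _)) expectZ; congr (_ * _).
pose Psi s := Phi (take #|X| s) (take #|Y| (drop #|X| s)) (drop #|Y| (drop #|X| s)) ^+ 2.
transitivity (expect (fun c => Psi (map c (enum X ++ enum Y ++ enum Z)))).
  apply: eq_expect => c; rewrite /Psi !map_cat.
  by rewrite !(take_size_cat, drop_size_cat) ?size_map -?cardE.
rewrite expect_map; last first.
  have uYZ : uniq (enum Y ++ enum Z).
    by rewrite -(perm_uniq (enumU dYZ)) enum_uniq.
  rewrite cat_uniq enum_uniq uYZ andbT /=; apply/hasPn => k.
  rewrite mem_cat !mem_enum => /orP[kY|kZ]; first by rewrite (disjointFl dXY).
  by rewrite (disjointFl dXZ).
rewrite !size_cat -!cardE tintD; apply: eq_tint => x xc; rewrite tintD.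
apply: eq_tint => y yd; apply: eq_tint => z ze.
by rewrite /Psi !(take_size_cat, drop_size_cat).
Qed.
End CondMoment.

(* kernel of the product over [k in A] of the operators [1 - cexp [set k]] *)
Definition center_ker (A : pred 'I_n) k (x y : T) : R :=
  if A k then dirac x y - mu y else dirac x y.

(* kernel of the projection on the Hoeffding component indexed by [J] *)
Definition hoeffding_ker J k (x y : T) : R :=
  if k \in J then dirac x y - mu y else mu y.

Lemma kop_eq0 kap F c k : (forall x y, kap k x y = 0) -> kop kap F c = 0.
Proof.
move=> h; rewrite /kop big1// => c' _.
by rewrite /kerw (bigD1 k)//= h !mul0r.
Qed.

Lemma kop_center1 l F c :
  kop (center_ker (pred1 l)) F c = F c - cexp [set l] F c.
Proof.
rewrite -[F c in RHS]kop_dirac /cexp /kop -sumrB; apply: eq_bigr => c' _.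
rewrite -mulrBl; congr (_ * _).
rewrite /kerw (bigD1 l)//= [X in _ = X - _](bigD1 l)//= [X in _ = _ - X](bigD1 l)//=.
have -> : center_ker (pred1 l) l (c l) (c' l) = dirac (c l) (c' l) - mu (c' l).
  by rewrite /center_ker /= eqxx.
have -> : resample mu [set l] l (c l) (c' l) = mu (c' l) by rewrite /resample inE eqxx.
rewrite mulrBl; congr (_ * _ - _ * _).
  by apply: eq_bigr => k kl; rewrite /center_ker /= (negbTE kl).
by apply: eq_bigr => k kl; rewrite /center_ker /resample /= (negbTE kl) inE (negbTE kl).
Qed.

Lemma cexp_center (A : pred 'I_n) F k : A k -> cexp [set k] (kop (center_ker A) F) =1 (fun=> 0).
Proof.
move=> Ak c; rewrite /cexp kop_comp; apply: (@kop_eq0 _ _ _ k) => x y.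
rewrite /resample inE eqxx /center_ker Ak.
under eq_bigr do rewrite mulrBr.
by rewrite sumrB dirac_sumr -mulr_suml mu1 mul1r subrr.
Qed.

Lemma kop_center_cons l (A : pred 'I_n) F c : ~~ A l ->
  kop (center_ker (pred1 l)) (kop (center_ker A) F) c = kop (center_ker (predU1 l A)) F c.
Proof.
move=> Al; rewrite kop_comp; apply: eq_kop => k x y; rewrite /center_ker /=.
have [->|kl] /= := eqVneq k l.
  by rewrite (negbTE Al) dirac_sumr.
exact: (dirac_suml (fun d => if A k then dirac d y - mu y else dirac d y)).
Qed.

Lemma tint1 Psi : tint 1 Psi = \sum_(x : T) mu x * Psi [:: x].
Proof.
rewrite /tint (reindex (fun x : T => [tuple x])) /=; last first.
  apply: onW_bij; exists (fun t : 1.-tuple T => thead t) => [x|t]; first by [].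
  by apply: val_inj; case: t => -[|x [|]].
by apply: eq_bigr => x _; rewrite /muprod big_seq1.
Qed.

Lemma map_set_nth (c c' : conf) L i l : uniq L -> (i < size L)%N -> l = nth l L i ->
  (forall k, k != l -> c k = c' k) -> map c' L = set_nth [ffun=> false] (map c L) i (c' l).
Proof.
move=> uL iL lE e; apply: (@eq_from_nth _ [ffun=> false]).
  by rewrite size_set_nth !size_map; apply/esym/maxn_idPr.
move=> j; rewrite size_map => jL; rewrite nth_set_nth /= (nth_map l)//.
have [->|ji] := eqVneq j i; first by rewrite -lE.
by rewrite (nth_map l)//; apply/esym/e; rewrite [X in _ != X]lE nth_uniq.
Qed.

Lemma set_nth_default_any (x x' : T) s i y : (i < size s)%N -> set_nth x s i y = set_nth x' s i y.
Proof. by elim: s i => [|z s IH] [|i]//= iS; rewrite IH. Qed.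

Lemma centr_map i (f : mfun R m) L c l : uniq L -> (i < size L)%N -> l = nth l L i ->
  centr p i f (map c L) = kop (center_ker (pred1 l)) (fun c' => f (map c' L)) c.
Proof.
move=> uL iL lE; rewrite kop_center1 /centr; congr (_ - _).
pose Psi (t : seq T) := f (set_nth [ffun=> false] (map c L) i (head [ffun=> false] t)).
transitivity (cexp [set l] (fun c' => Psi (map c' [:: l])) c).
  rewrite cexp_map//; last by move=> k; rewrite !inE.
  rewrite tint1; apply: eq_bigr => x _; rewrite /Psi /=; congr (_ * f _).
  by apply: set_nth_default_any; rewrite size_map.
apply: cexp_eq => c' /kerw_resample_agree e; rewrite /Psi /= -(@map_set_nth c)// => k kl.
by rewrite e// inE.
Qed.

Lemma foldr_centr_map (f : mfun R m) L (s : seq nat) c k0 : uniq L -> uniq s ->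
  all (fun i => (i < size L)%N) s ->
  foldr (fun i g => centr p i g) f s (map c L)
  = kop (center_ker [in [seq nth k0 L i | i <- s]]) (fun c' => f (map c' L)) c.
Proof.
move=> uL; elim: s c => [|i s IH] c /=.
  by move=> _ _; rewrite -[LHS](kop_dirac (fun c' => f (map c' L)) c).
move=> /andP[is_ us] /andP[iL sL].
rewrite (@centr_map i _ L c (nth k0 L i))//; last exact: set_nth_default.
rewrite (eq_kop_fun _ (fun c' => IH c' us sL)) kop_center_cons.
  by apply: eq_kop => k x y; rewrite /center_ker /= inE.
rewrite /=; apply: contraNN is_ => /mapP[j js /eqP].
by rewrite nth_uniq// ?(allP sL)// => /eqP ->.
Qed.

(** Centralization acts on positions. Along a list of distinct vertices it becomes a single product
    kernel that depends only on the set of vertices, from which symmetry and degeneracy are read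
    off. *)
Lemma htilde_map r (h : r.-tuple T -> R) L j c : uniq L -> size L = j ->
  htilde p h j (map c L) = kop (center_ker [in L]) (fun c' => hproj p h j (map c' L)) c.
Proof.
(* The empty list is treated apart because [nth] needs a default vertex and there may be none. *)
move=> + <-; case: L => [|k0 L'] uL; last set L := k0 :: L'.
  by rewrite /htilde /= -[LHS](kop_dirac (fun=> _) c); apply: eq_kop => k x y.
rewrite /htilde (foldr_centr_map _ _ k0)// ?iota_uniq//; last first.
  by apply/allP => i; rewrite mem_iota.
by rewrite map_nth_iota0// take_size.
Qed.

(** Expanding the product over [k] of [(dirac - mu) + mu], where [J] is the set of factors in which
    the bracket is chosen, gives all the kernels at once. *)
Lemma sum_hoeffding F c : \sum_J kop (hoeffding_ker J) F c = F c.
Proof.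
rewrite -[RHS]kop_dirac /kop exchange_big/=; apply: eq_bigr => c' _.
rewrite -mulr_suml; congr (_ * _); rewrite /kerw.
transitivity (\prod_k ((dirac (c k) (c' k) - mu (c' k)) + mu (c' k))).
  by rewrite bigA_distr; apply: eq_bigr => J _; apply: eq_bigr.
by apply: eq_bigr => k _; rewrite subrK.
Qed.

Lemma hoeffding_set0 F c : kop (hoeffding_ker set0) F c = expect F.
Proof.
rewrite -(cexpT mu F c); apply: eq_kop => k x y.
by rewrite /hoeffding_ker /resample !inE.
Qed.

Lemma hoeffding_indep J F c k : k \in J -> indep_of [set k] F ->
  kop (hoeffding_ker J) F c = 0.
Proof.
move=> kJ iF; rewrite -(eq_kop_fun _ (cexp_id mu1 iF)) /cexp kop_comp.
apply: (@kop_eq0 _ _ _ k) => x y; rewrite /hoeffding_ker kJ /resample inE eqxx.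
rewrite -mulr_suml sumrB mu1.
by rewrite -[X in X - _](eq_bigr _ (fun d _ => mulr1 _)) (dirac_suml (fun=> 1)) subrr mul0r.
Qed.

Lemma hoeffding_center J F c :
  kop (hoeffding_ker J) F c = kop (center_ker [in J]) (cexp (~: J) F) c.
Proof.
rewrite /cexp kop_comp; apply: eq_kop => k x y.
rewrite /hoeffding_ker /center_ker /resample inE /=; case: (k \in J) => /=.
  by rewrite dirac_sumr.
by rewrite (dirac_suml (fun=> mu y)).
Qed.

Lemma kern_sym r (h : r.-tuple T -> R) : symmetric_kernel h -> sym_on r (kern h).
Proof.
move=> hs s u /eqP sr su.
have ur : size u == r by rewrite -(perm_size su).
rewrite /kern !insubT.
have /tuple_permP[s0 e] : perm_eq (Tuple sr) (Tuple ur) by [].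
rewrite -(hs (Sub u ur) s0); by congr h; apply: val_inj; exact: e.
Qed.

Lemma hproj_sym r (h : r.-tuple T -> R) j : symmetric_kernel h -> (j <= r)%N ->
  sym_on j (hproj p h j).
Proof.
move=> hs jr s u sj su; apply: eq_bigr => t _; congr (_ * _).
by apply: (kern_sym hs); rewrite ?size_cat ?size_tuple ?sj ?subnKC// perm_cat2r.
Qed.

(** A vertex of [J] missing from [L] kills the projection. Otherwise averaging over the vertices
    outside [J] turns [h] into [hproj], and centering over [J] turns that into [htilde]. *)
Lemma hoeffding_map r (h : r.-tuple T -> R) L J c : symmetric_kernel h ->
  uniq L -> size L = r ->
  kop (hoeffding_ker J) (fun c' => kern h (map c' L)) c
  = if J \subset [set k in L] then htilde p h #|J| (map c (enum J)) else 0.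
Proof.
move=> hs uL Lr; case: ifPn => [JL|/subsetPn[k kJ kL]]; last first.
  apply: (hoeffding_indep _ kJ) => d d' e; congr kern; apply/eq_in_map => l lL.
  by apply: e; rewrite inE; apply: contraNneq kL => <-; rewrite inE.
rewrite [#|J|]cardE (htilde_map _ _ (enum_uniq J) erefl) hoeffding_center.
rewrite (eq_kop (kap' := center_ker [in enum J])); last first.
  by move=> k x y; rewrite /center_ker /= mem_enum.
apply: eq_kop_fun => d.
pose L' := [seq k <- L | k \notin J].
have perm_L : perm_eq L (enum J ++ L').
  apply: uniq_perm => //; last first.
    move=> k; rewrite mem_cat mem_enum mem_filter.
    case: (boolP (k \in J)) => //= kJ.
    by have := subsetP JL k kJ; rewrite inE.
  rewrite cat_uniq enum_uniq filter_uniq// andbT /=; apply/hasPn => k.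
  by rewrite mem_filter mem_enum => /andP[].
have sz : size L' = (r - size (enum J))%N.
  by rewrite -Lr (perm_size perm_L) size_cat addKn.
pose Psi t := kern h (map d (enum J) ++ t).
transitivity (cexp (~: J) (fun c' => Psi (map c' L')) d).
  apply: cexp_eq => c' cc'; rewrite /Psi.
  rewrite -(@map_agree (~: J) (enum J) d c')//; last first.
    by rewrite disjoints_subset setCK; apply/subsetP => k; rewrite inE mem_enum.
  rewrite -map_cat; apply: (kern_sym hs); first by rewrite size_map.
  exact: perm_map.
rewrite cexp_map ?filter_uniq//; last by move=> k; rewrite mem_filter inE => /andP[].
by rewrite sz.
Qed.

Lemma htilde_degenerate r (h : r.-tuple T -> R) J k c : k \in J ->
  cexp [set k] (fun c' => htilde p h #|J| (map c' (enum J))) c = 0.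
Proof.
move=> kJ; rewrite [#|J|]cardE.
transitivity (cexp [set k] (kop (center_ker [in enum J])
    (fun c' => hproj p h (size (enum J)) (map c' (enum J)))) c).
  by apply: eq_kop_fun => d; rewrite htilde_map ?enum_uniq.
by rewrite cexp_center// mem_enum.
Qed.

End Configurations.

Section HtildeSymmetric.
Variables (R : realType) (m : nat) (p : R).

(** Two permuted sequences are one configuration on ['I_j] read along two enumerations of the same
    vertices. The centering kernel depends only on their set, which leaves the symmetry of
    [hproj]. *)
Lemma htilde_sym r (h : r.-tuple (attr m) -> R) j : symmetric_kernel h -> (j <= r)%N ->
  sym_on j (htilde p h j).
Proof.
move=> hs jr s u /eqP sj su.
have uj : size u == j by rewrite -(perm_size su).
have /tuple_permP[s0 e] : perm_eq (Tuple uj) (Tuple sj) by rewrite perm_sym.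
pose c : {ffun 'I_j -> attr m} := [ffun k => tnth (Tuple sj) k].
pose L : seq 'I_j := map s0 (enum 'I_j).
have uL : uniq L by rewrite map_inj_uniq ?enum_uniq//; exact: perm_inj.
have sL : size L = j by rewrite size_map size_enum_ord.
have sE : s = map c (enum 'I_j).
  rewrite -[LHS](map_tnth_enum (Tuple sj)).
  by apply: eq_map => k; rewrite /= ffunE.
have uE : u = map c L.
  transitivity (val [tuple tnth (Tuple sj) (s0 i) | i < j]); first exact: e.
  rewrite /L -map_comp -val_ord_tuple.
  by apply: eq_map => k; rewrite /= ffunE.
have pL : perm_eq (enum 'I_j) L.
  by apply: uniq_perm; rewrite ?enum_uniq// => k; rewrite mem_enum; 
    apply/esym/mapP; exists (s0^-1%g k); rewrite ?mem_enum// permKV.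
rewrite sE uE (htilde_map p h c (enum_uniq _) (size_enum_ord j)) (htilde_map p h c uL sL).
rewrite (eq_kop (kap' := center_ker p [in L])); last first.
  by move=> k x y; rewrite /center_ker /= (perm_mem pL).
apply: eq_kop_fun => d; apply: (hproj_sym _ hs jr).
  by rewrite size_map size_enum_ord.
exact: perm_map.
Qed.
End HtildeSymmetric.

(** * The standardized U-statistic *)

Section UStatistic.
Variables (R : realType) (n m : nat) (p : R) (r : nat) (h : r.-tuple (attr m) -> R).
Hypotheses (p_gt0 : 0 < p) (p_lt1 : p < 1) (h_sym : symmetric_kernel h).
Local Notation X := (Ustat (n := n) h).
Local Notation sigma := (Num.sqrt (rig_var p X)).
Hypothesis var_gt0 : 0 < rig_var p X.
Local Notation mu := (@mu R m p).
Local Notation nR := (n%:R : R).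
Local Notation ht := (htilde p h).
Implicit Types (J S : {set 'I_n}).

Let mu0 (x : attr m) : 0 <= mu x := mu_ge0 p_gt0 p_lt1 x.
Let mu1 : \sum_(x : attr m) mu x = 1 := mu_sum1 m p.
Let sigma_gt0 : 0 < sigma. Proof. by rewrite sqrtr_gt0. Qed.

Lemma rig_mean_expect (Y : config n m -> R) : rig_mean p Y = expect mu Y.
Proof. by []. Qed.

(** Without vertices there is a single configuration, and the variance vanishes. *)
Lemma n_gt0_of_var : (0 < n)%N.
Proof.
rewrite lt0n; apply/eqP => n0.
have cst (c c' : config n m) : c = c'.
  by apply/ffunP => k; have := ltn_ord k; rewrite {2}n0.
have e : X =1 fun=> X [ffun=> [ffun=> false]] by move=> c; rewrite (cst c [ffun=> [ffun=> false]]).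
move: var_gt0; rewrite /rig_var !rig_mean_expect.
rewrite (eq_expect _ (G := fun=> 0)) ?expect_cst ?ltxx// => c.
by rewrite (eq_expect _ e) expect_cst// e subrr expr0n.
Qed.
Let n_gt0 := n_gt0_of_var.
Let nR_gt0 : 0 < nR. Proof. by rewrite ltr0n. Qed.

Let im (k : {ffun 'I_r -> 'I_n}) : seq 'I_n := map k (enum 'I_r).

Lemma strictly_incr_uniq k : strictly_incr k -> uniq (im k).
Proof.
move=> /forallP inc; rewrite map_inj_uniq ?enum_uniq// => i j e.
have lt_ne (a b : 'I_r) : (a < b)%N -> k a <> k b.
  by move=> ab eab; have /forallP/(_ b)/implyP/(_ ab) := inc a; rewrite eab ltnn.
have [ij|ji|/val_inj//] := ltngtP i j; [case: (lt_ne _ _ ij e)|case: (lt_ne _ _ ji (esym e))].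
Qed.

Lemma size_im k : size (im k) = r.
Proof. by rewrite size_map size_enum_ord. Qed.

Lemma kern_im k (c : config n m) : kern h (map c (im k)) = h [tuple c (k i) | i < r].
Proof.
rewrite /kern insubT; first by rewrite size_map size_im.
move=> sz; congr h; apply: val_inj => /=.
by rewrite /im -map_comp -val_ord_tuple.
Qed.

(** The number of summands of the U-statistic that involve all of [J], hence the multiplicity of
    [htilde] in the component of [J]. *)
Definition hoeffding_count J : nat :=
  #|[pred k : {ffun 'I_r -> 'I_n} | strictly_incr k && (J \subset [set l in im k])]|.

Lemma hoeffding_Ustat J c : kop (hoeffding_ker p J) X c
  = (hoeffding_count J)%:R * ht #|J| (map c (enum J)).
Proof.
rewrite /Ustat kop_sum.
transitivity (\sum_(k : {ffun 'I_r -> 'I_n} | strictly_incr k)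
    (if J \subset [set l in im k] then ht #|J| (map c (enum J)) else 0)).
  apply: eq_bigr => k kinc.
  rewrite -(hoeffding_map p J c h_sym (strictly_incr_uniq kinc) (size_im k)).
  by apply: eq_kop_fun => c'; rewrite kern_im.
by rewrite -big_mkcondr sumr_const mulr_natl.
Qed.

Lemma hoeffding_count_gt J : (r < #|J|)%N -> hoeffding_count J = 0%N.
Proof.
move=> rJ; apply: eq_card0 => k; rewrite !inE; apply/negP => /andP[_ /subset_leq_card].
rewrite leqNgt => /negP; apply; apply: leq_ltn_trans rJ.
by rewrite cardsE (leq_trans (card_size _))// size_im.
Qed.

Lemma strictly_incr_inj (k k' : {ffun 'I_r -> 'I_n}) :
  strictly_incr k -> strictly_incr k' -> im k =i im k' -> k = k'.
Proof.
move=> ki ki' e.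
have srt (l : {ffun 'I_r -> 'I_n}) : strictly_incr l -> sorted (relpre val ltn) (im l).
  move=> /forallP li; rewrite /im sorted_map.
  apply: (@sub_sorted _ (relpre val ltn)); last by rewrite -sorted_map val_enum_ord iota_ltn_sorted.
  by move=> a b ab; have /forallP/(_ b)/implyP := li a; apply.
have : im k = im k'.
  apply: (irr_sorted_eq (leT := relpre val ltn)); [| |exact: srt|exact: srt|exact: e].
    by move=> a b c' /=; exact: ltn_trans.
  by move=> a /=; exact: ltnn.
by move=> /eq_in_map eim; apply/ffunP => i; apply: eim; rewrite mem_enum.
Qed.

(** An increasing index map is determined by its image, hence by the image minus [J], a set of
    [r - #|J|] vertices. *)
Lemma hoeffding_count_le J : (#|J| <= r)%N -> (hoeffding_count J <= n ^ (r - #|J|))%N.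
Proof.
move=> Jr.
pose f (k : {ffun 'I_r -> 'I_n}) := [set l in im k] :\: J.
apply: (@leq_trans #|[set A : {set 'I_n} | #|A| == (r - #|J|)%N]|); last first.
  rewrite card_draws card_ord.
  apply: (@leq_trans (n ^_ (r - #|J|))); first by rewrite -bin_ffact leq_pmulr ?fact_gt0.
  rewrite ffact_prod -[X in (_ <= _ ^ X)%N]card_ord -prod_nat_const.
  by apply: leq_prod => i _; exact: leq_subr.
rewrite /hoeffding_count -(card_in_imset (f := f)).
  apply: subset_leq_card; apply/subsetP => _ /imsetP[k + ->].
  rewrite !inE => /andP[ki Jk]; rewrite /f cardsD (setIidPr Jk) cardsE.
  by rewrite (card_uniqP (strictly_incr_uniq ki)) size_im.
move=> k k'; rewrite !inE => /andP[ki Jk] /andP[ki' Jk'] e.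
apply: strictly_incr_inj => // l; move/setP/(_ l): e; rewrite !inE.
case: (boolP (l \in J)) => //= lJ _.
by have := subsetP Jk l lJ; have := subsetP Jk' l lJ; rewrite !inE => -> ->.
Qed.

(** The value 0 at the empty set removes the mean, which is the component of the empty set. *)
Definition ucoef J : R := if J == set0 then 0 else (hoeffding_count J)%:R / sigma.
Local Notation G := (Gfun ht ucoef).

Lemma Wsum_standardize c : Wsum G c = standardize p X c.
Proof.
rewrite /standardize rig_mean_expect -(hoeffding_set0 p X c) -[X in X - _](sum_hoeffding p X c).
rewrite (bigD1 set0)//= [X in X - _]addrC addrK mulr_suml /Wsum (bigD1 set0)//=.
rewrite {1}/Gfun /ucoef eqxx mul0r add0r; apply: eq_bigr => J /negbTE J0.
by rewrite hoeffding_Ustat /Gfun /ucoef J0 mulrAC.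
Qed.

Lemma G_indep J : indep_of (~: J) (G J).
Proof.
move=> c c' e; rewrite /Gfun; congr (_ * ht _ _); apply/eq_in_map => k.
by rewrite mem_enum => kJ; apply: e; rewrite inE negbK.
Qed.

Lemma G_degen J k : k \in J -> cexp mu [set k] (G J) =1 (fun=> 0).
Proof.
by move=> kJ c; rewrite /cexp kopZ -/(cexp _ _ _ _) htilde_degenerate// mulr0.
Qed.

Lemma ucoef_supp J : ~~ (0 < #|J| <= r)%N -> ucoef J = 0.
Proof.
rewrite /ucoef negb_and -leqNgt leqn0 cards_eq0 -ltnNge.
by case: eqP => //= _ /hoeffding_count_gt ->; rewrite mul0r.
Qed.

Lemma G_supp J c : ~~ (0 < #|J| <= r)%N -> G J c = 0.
Proof. by move=> /ucoef_supp e; rewrite /Gfun e mul0r. Qed.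

Lemma W_var : expect mu (fun c => Wsum G c ^+ 2) = 1.
Proof.
rewrite (eq_expect _ (fun c => congr1 (fun x => x ^+ 2) (Wsum_standardize c))).
rewrite /standardize.
transitivity (expect mu (fun c => (rig_var p X)^-1 * (X c - rig_mean p X) ^+ 2)).
  apply: eq_expect => c; rewrite exprMn exprVn sqr_sqrtr 1?mulrC//; exact: ltW.
by rewrite expectZ -rig_mean_expect -/(rig_var p X) mulVf// gt_eqF.
Qed.

Lemma W_mean0 : expect mu (Wsum G) = 0.
Proof.
rewrite (eq_expect _ Wsum_standardize).
transitivity (expect mu (fun c => sigma^-1 * (X c - rig_mean p X))).
  by apply: eq_expect => c; rewrite /standardize mulrC.
by rewrite expectZ expectB expect_cst// -rig_mean_expect subrr mulr0.
Qed.

Lemma ucoef_le J : (#|J| <= r)%N -> 0 <= ucoef J <= nR ^+ (r - #|J|) / sigma.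
Proof.
move=> Jr; rewrite /ucoef; case: ifP => _.
  by rewrite lexx divr_ge0 ?exprn_ge0// ltW.
rewrite divr_ge0 ?(ltW sigma_gt0)//= ler_wpM2r ?invr_ge0 ?(ltW sigma_gt0)//.
by rewrite -natrX ler_nat hoeffding_count_le.
Qed.

Definition contraction_sum : R :=
  (\sum_(j < r.+1) \sum_(i < j)
     l2norm p (j - i) (contr p i j j (ht j) (ht j)) ^+ 2 / nR ^+ (3 * j - i))
  + (\sum_(j < r.+1) \sum_(1 <= i < j)
      (l2norm p ((j - i) + (j - i)) (contr p i i j (ht j) (ht j)) ^+ 2 / nR ^+ (2 * j)
       + l2norm p (j - i) (contr p i i j (ht j) (ht i)) ^+ 2 / nR ^+ (j + i))).

Let term_ge0 d (f : mfun R m) k : 0 <= l2norm p d f ^+ 2 / nR ^+ k.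
Proof. by rewrite divr_ge0 ?sqr_ge0// exprn_ge0. Qed.

Let sum1_ge0 : 0 <= \sum_(j < r.+1) \sum_(i < j)
     l2norm p (j - i) (contr p i j j (ht j) (ht j)) ^+ 2 / nR ^+ (3 * j - i).
Proof. by apply: sumr_ge0 => j _; apply: sumr_ge0. Qed.

Let sum2_ge0 : 0 <= \sum_(j < r.+1) \sum_(1 <= i < j)
      (l2norm p ((j - i) + (j - i)) (contr p i i j (ht j) (ht j)) ^+ 2 / nR ^+ (2 * j)
       + l2norm p (j - i) (contr p i i j (ht j) (ht i)) ^+ 2 / nR ^+ (j + i)).
Proof. by apply: sumr_ge0 => j _; apply: sumr_ge0 => i _; rewrite addr_ge0. Qed.

Lemma contraction_sum_ge0 : 0 <= contraction_sum.
Proof. exact: addr_ge0. Qed.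

Let le_sum_ord (F : nat -> R) N i : (forall i, 0 <= F i) -> (i < N)%N ->
  F i <= \sum_(i < N) F i.
Proof.
move=> F0 iN; rewrite (bigD1 (Ordinal iN))//= lerDl.
by apply: sumr_ge0 => k _; exact: F0.
Qed.

Let le_sum_nat (F : nat -> R) N i : (forall i, 0 <= F i) -> (1 <= i < N)%N ->
  F i <= \sum_(1 <= i < N) F i.
Proof.
move=> F0 iN; rewrite (bigD1_seq i) ?mem_index_iota ?iota_uniq//= lerDl.
by apply: sumr_ge0 => k _; exact: F0.
Qed.

Let full_le i j : (i < j <= r)%N ->
  contr_sqr p i (j - i) 0 0 (ht j) (ht j) <= contraction_sum * nR ^+ (3 * j - i).
Proof.
move=> /andP[ij jr]; rewrite -l2norm_contr// !addn0 subnKC 1?ltnW//.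
rewrite -ler_pdivrMr ?exprn_gt0//.
pose F k l := l2norm p (k - l) (contr p l k k (ht k) (ht k)) ^+ 2 / nR ^+ (3 * k - l) : R.
apply: (@le_trans _ _ (\sum_(l < j) F j l)).
  by apply: (@le_sum_ord (F j) j i) => // l; exact: term_ge0.
apply: (@le_trans _ _ (\sum_(k < r.+1) \sum_(l < k) F k l)); last by rewrite lerDl.
apply: (@le_sum_ord (fun k => \sum_(l < k) F k l) r.+1 j) => // k.
by apply: sumr_ge0 => l _; exact: term_ge0.
Qed.

Let pair_le i j : (1 <= i)%N -> (i < j <= r)%N ->
  l2norm p ((j - i) + (j - i)) (contr p i i j (ht j) (ht j)) ^+ 2 / nR ^+ (2 * j)
  + l2norm p (j - i) (contr p i i j (ht j) (ht i)) ^+ 2 / nR ^+ (j + i) <= contraction_sum.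
Proof.
move=> i1 /andP[ij jr].
pose F k l := (l2norm p ((k - l) + (k - l)) (contr p l l k (ht k) (ht k)) ^+ 2 / nR ^+ (2 * k)
  + l2norm p (k - l) (contr p l l k (ht k) (ht l)) ^+ 2 / nR ^+ (k + l)) : R.
have F0 k l : 0 <= F k l by rewrite addr_ge0.
apply: (@le_trans _ _ (\sum_(1 <= l < j) F j l)).
  by apply: (@le_sum_nat (F j) j i) => //; rewrite i1.
apply: (@le_trans _ _ (\sum_(k < r.+1) \sum_(1 <= l < k) F k l)); last by rewrite lerDr.
apply: (@le_sum_ord (fun k => \sum_(1 <= l < k) F k l) r.+1 j) => // k.
by apply: sumr_ge0 => l _; exact: F0.
Qed.

Let diag_le i j : (1 <= i)%N -> (i < j <= r)%N ->
  contr_sqr p i 0 (j - i) (j - i) (ht j) (ht j) <= contraction_sum * nR ^+ (2 * j).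
Proof.
move=> i1 ijr; have /andP[ij jr] := ijr.
rewrite -l2norm_contr// !addn0 add0n subnKC 1?ltnW// -ler_pdivrMr ?exprn_gt0//.
by apply: le_trans (pair_le i1 ijr); rewrite lerDl.
Qed.

Let mixed_le i j : (1 <= i)%N -> (i < j <= r)%N ->
  contr_sqr p i 0 (j - i) 0 (ht j) (ht i) <= contraction_sum * nR ^+ (j + i).
Proof.
move=> i1 ijr; have /andP[ij jr] := ijr.
rewrite -l2norm_contr// !addn0 add0n subnKC 1?ltnW// -ler_pdivrMr ?exprn_gt0//.
by apply: le_trans (pair_le i1 ijr); rewrite lerDr.
Qed.

(** Let [a], [b], [d], [e] be the sizes of [S], of the rest of [I :&: J] and of the two differences.
    The squared coefficients give the exponent [4r - 2#|I| - 2#|J|] of [n] and the factor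
    [1 / sigma ^+ 4], the contraction gives [2a + 3b + d + e], and the total is
    [4r - #|S| - #|support2 q|]. *)
Lemma cond_moment_Ustat_le S (q : {set 'I_n} * {set 'I_n}) : S \subset q.1 :&: q.2 ->
  q.1 :&: q.2 != set0 -> support2 q != S ->
  cond_moment mu G S q <= contraction_sum / rig_var p X ^+ 2 * nR ^+ (4 * r)
    / nR ^+ (#|S| + #|support2 q|).
Proof.
case: q => I J /= SIJ IJ0 supS.
have B0 := contraction_sum_ge0.
have rhs0 k l : 0 <= contraction_sum / rig_var p X ^+ 2 * nR ^+ k / nR ^+ l.
  by rewrite !mulr_ge0 ?invr_ge0 ?exprn_ge0 ?(ltW var_gt0) ?(ltW nR_gt0).
have zero I' J' : ucoef I' * ucoef J' = 0 -> cond_moment mu G S (I', J') = 0.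
  move=> e; rewrite /cond_moment -[RHS](expect_cst n mu1 0); apply: eq_expect => c.
  rewrite -[RHS](expr0n _ 2); congr (_ ^+ 2).
  rewrite -[RHS](cexp_cst mu1 S (0 : R) c); apply: eq_kop_fun => d.
  by rewrite /Gpair /Gfun /= mulrACA e mul0r.
have [Ir|Ir] := leqP #|I| r; last first.
  by rewrite zero// ucoef_supp ?mul0r// negb_and -!ltnNge Ir orbT.
have [Jr|Jr] := leqP #|J| r; last first.
  by rewrite zero// [ucoef J]ucoef_supp ?mulr0// negb_and -!ltnNge Jr orbT.
have hsym j : (j <= r)%N -> sym_on j (ht j) by exact: htilde_sym.
rewrite (cond_moment_contr p ucoef hsym Ir Jr SIJ).
set Y := I :&: J :\: S.
have IJE : #|I :&: J| = (#|S| + #|Y|)%N by rewrite -(cardsID S (I :&: J)) (setIidPr SIJ).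
have IE : #|I| = (#|S| + #|Y| + #|I :\: J|)%N by rewrite -IJE cardsID.
have JE : #|J| = (#|S| + #|Y| + #|J :\: I|)%N by rewrite -IJE setIC cardsID.
have suppE : #|support2 (I, J)| = (#|S| + #|Y| + #|I :\: J| + #|J :\: I|)%N.
  rewrite /support2/= cardsU IJE; move: IE JE.
  move: #|S| #|Y| #|I :\: J| #|J :\: I| #|I| #|J| => a b d e i j -> ->; clear; lia.
have subS : S \subset support2 (I, J).
  by apply: subset_trans SIJ _; apply: subset_trans (subsetIl _ _) (subsetUl _ _).
have pos1 : (0 < #|S| + #|Y|)%N by rewrite -IJE card_gt0.
(* The condition [support2 q != S] rules out that every variable is integrated inside the square,
   which would leave a fourth power of a norm. *)
have pos2 : (0 < #|Y| + #|I :\: J| + #|J :\: I|)%N.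
  have : (#|S| < #|support2 (I, J)|)%N.
    by apply: proper_card; rewrite properEneq subS andbT eq_sym.
  rewrite suppE; clear; lia.
have := ucoef_le Ir; have := ucoef_le Jr; rewrite suppE.
rewrite IE in Ir *; rewrite JE in Jr *.
move: (ucoef I) (ucoef J) => u v /andP[v0 vle] /andP[u0 ule].
have cle := contr_sqr_le p_gt0 p_lt1 hsym B0 nR_gt0 full_le diag_le mixed_le Ir Jr pos1 pos2.
have uv := ler_pM u0 v0 ule vle.
have uv2 : (u * v) ^+ 2 <= (nR ^+ (r - (#|S| + #|Y| + #|I :\: J|)) / sigma *
    (nR ^+ (r - (#|S| + #|Y| + #|J :\: I|)) / sigma)) ^+ 2.
  by rewrite ler_sqr ?nnegrE ?mulr_ge0 ?invr_ge0 ?exprn_ge0 ?(ltW sigma_gt0).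
have := ler_pM (sqr_ge0 _) (contr_sqr_ge0 p_gt0 p_lt1 _ _ _ _ _ _) uv2 cle.
move/le_trans; apply.
move: Ir Jr; move: #|S| #|Y| #|I :\: J| #|J :\: I| => a b d e Ir Jr.
have sV : rig_var p X ^+ 2 = sigma ^+ (2 * 2) by rewrite exprM sqr_sqrtr ?(ltW var_gt0).
have expE : (4 * r = (r - (a + b + d)) * 2 + (r - (a + b + e)) * 2
    + (2 * a + 3 * b + d + e) + (a + (a + b + d + e)))%N by clear - Ir Jr; lia.
have -> : nR ^+ (4 * r) = (nR ^+ (r - (a + b + d))) ^+ 2 * (nR ^+ (r - (a + b + e))) ^+ 2
    * nR ^+ (2 * a + 3 * b + d + e) * nR ^+ (a + (a + b + d + e)).
  by rewrite -!exprM -!exprD; congr (_ ^+ _).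
rewrite sV.
have := sigma_gt0; have := exprn_gt0 (a + (a + b + d + e)) nR_gt0.
move: (nR ^+ (a + (a + b + d + e))) (nR ^+ (r - (a + b + d))) (nR ^+ (r - (a + b + e)))
  (nR ^+ (2 * a + 3 * b + d + e)) (sigma) contraction_sum => D A A' C s B D0 s0.
by rewrite le_eqVlt; apply/orP; left; apply/eqP; field; rewrite !gt_eqF.
Qed.

Definition ustat_cst : R :=
  stein_cst R r * Num.sqrt (2 * \sum_(v < (4 * r).+1) 16 ^+ v).

Lemma stein_Ustat (f f' g : R -> R) (K : R) :
  (forall w w', `|f w - f w' - (w - w') * f' w| <= (w - w') * (g w - g w')) ->
  (forall w, `|f' w| <= 2 * K * (1 + `|w|)) ->
  (forall w, `|g w| <= 2 * K * (1 + `|w|)) ->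
  `|rig_mean p (fun c => f' (standardize p X c))
    - rig_mean p (fun c => standardize p X c * f (standardize p X c))|
  <= K * (ustat_cst * nR ^+ (2 * r) / rig_var p X * Num.sqrt contraction_sum).
Proof.
move=> taylor f'K gK.
have K0 : 0 <= K.
  by have := le_trans (normr_ge0 _) (f'K 0); rewrite normr0 addr0 mulr1 pmulr_rge0.
rewrite !rig_mean_expect.
rewrite -(eq_expect _ (fun c => congr1 f' (Wsum_standardize c))).
rewrite -(eq_expect _ (fun c => congr1 (fun w => w * f w) (Wsum_standardize c))).
apply: le_trans (stein_quad_bound mu0 mu1 G_indep G_degen G_supp W_var taylor f'K gK) _.
have B0 := contraction_sum_ge0; have V0 := ltW var_gt0.
rewrite ler_wpM2l// /ustat_cst -!mulrA ler_wpM2l//.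
  by rewrite /stein_cst addr_ge0// mulr_ge0// sqrtr_ge0.
pose Dr : R := \sum_(v < (4 * r).+1) 16 ^+ v; rewrite -/Dr.
have D0 : 0 <= Dr by apply: sumr_ge0 => v _; rewrite exprn_ge0.
have n0 : 0 <= nR ^+ (2 * r) / rig_var p X by rewrite divr_ge0 ?exprn_ge0.
have beta0 : 0 <= contraction_sum / rig_var p X ^+ 2 by rewrite divr_ge0 ?exprn_ge0.
have q := quad_sum_le mu0 mu1 G_indep G_degen G_supp beta0 n_gt0 cond_moment_Ustat_le.
apply: le_trans (ler_wsqrtr q) _.
rewrite -/Dr (_ : 2 * _ * _ * Dr =
    2 * Dr * ((nR ^+ (2 * r) / rig_var p X) ^+ 2 * contraction_sum)); last first.
  have -> : nR ^+ (4 * r) = (nR ^+ (2 * r)) ^+ 2.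
    by rewrite -exprM; congr (_ ^+ _); clear; lia.
  rewrite exprMn exprVn; move: (nR ^+ _) (rig_var _ _ ^- 2) => x y; ring.
have D2 : 0 <= 2 * Dr by rewrite mulr_ge0.
rewrite (sqrtrM _ D2) ler_wpM2l ?sqrtr_ge0// (sqrtrM _ (sqr_ge0 _)) sqrtr_sqr ger0_norm//.
by rewrite mulrA.
Qed.
End UStatistic.

From mathcomp Require Import all_classical all_reals all_analysis.
From mathcomp Require Import normal_distribution measurable_realfun.
Import numFieldNormedType.Exports.
Local Open Scope classical_set_scope.

(** * Stein's equation *)

Section Calculus.
Variable R : realType.
Notation leb := (@lebesgue_measure R).

Lemma is_derive_continuous (F : R -> R) (x d : R) :
  is_derive x 1 F d -> {for x, continuous F}.
Proof. by move=> [h _]; exact/differentiable_continuous/derivable1_diffP. Qed.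

Lemma is_derive_le (F dF : R -> R) (a b : R) : a <= b ->
  (forall x : R, is_derive x 1 F (dF x)) ->
  (forall x, a <= x <= b -> 0 <= dF x) -> F a <= F b.
Proof.
move=> ab FdF dF0.
have cF : {within `[a, b], continuous F}.
  by apply: continuous_subspaceT => x; exact: is_derive_continuous (FdF x).
have [z zab] := MVT_segment ab (fun x _ => FdF x) cF.
by rewrite -subr_ge0 => ->; rewrite mulr_ge0 ?subr_ge0 ?dF0.
Qed.

(** The limits follow by dominated convergence with [|q|]. Taking them along integers is enough,
    since every later comparison at infinity is made along [n%:R] or [- n%:R]. *)
Lemma derive_cumulative (q : R -> R) : continuous q ->
  leb.-integrable [set: R] (EFin \o q) ->
  let A (x : R) := (\int[leb]_(t in `]-oo, x]) q t)%R in
  [/\ forall x : R, is_derive x 1 A (q x),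
    A (n%:R) @[n --> \oo] --> (\int[leb]_x q x)%R &
    A (- n%:R) @[n --> \oo] --> (0 : R)].
Proof.
move=> cq iq A.
have mq : measurable_fun [set: R] q by exact: continuous_measurable_fun.
have cvgA (u : nat -> R) (l : R -> R) :
    (forall x, ((q \_ `]-oo, u n]) x @[n --> \oo] --> l x)) -> measurable_fun [set: R] l ->
    (\int[leb]_(t in `]-oo, u n]) q t)%R @[n --> \oo] --> (\int[leb]_t l t)%R.
  move=> ql ml.
  have q_meas n : measurable_fun [set: R] (q \_ `]-oo, u n]).
    by apply/measurable_restrict => //; exact: measurable_funTS.
  have dom n x : (`|(q \_ `]-oo, u n] x)%:E| <= `|(q x)%:E|)%E.
    by rewrite patchE; case: ifP => // _; rewrite !abse_EFin lee_fin normr0.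
  have absq : leb.-integrable [set: R] (fun x => `|(q x)%:E|)%E by exact: integrable_abse.
  have [] := @dominated_convergence _ _ _ leb setT measurableT
    (fun n => EFin \o (q \_ `]-oo, u n])) (EFin \o l) (fun x => `|(q x)%:E|)%E.
  - move=> n; apply/measurable_EFinP; exact: q_meas.
  - exact/measurable_EFinP.
  - by apply/aeW => x _; apply/fine_cvgP; split; [exact: nearW|exact: ql].
  - exact: absq.
  - by apply/aeW => x n _; exact: dom.
  move=> il _; have ilf := integrable_fin_num measurableT il.
  rewrite -(fineK ilf) => /fine_cvgP[_].
  rewrite [X in X @ _ --> _ -> _](_ : _ = fun n => (\int[leb]_(t in `]-oo, u n]) q t)%R) //.
  apply/funext => n /=; rewrite [RHS]Rintegral_mkcond /Rintegral.
  by [].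
split.
- move=> x; have := @continuous_FTC1 R q -oo%O x (x + 1).
  rewrite ltrDl ltr01 => /(_ isT) []//.
  + exact: integrableS iq.
  + exact: ltNyr.
  + exact: cq.
  by move=> dA eA; split; [exact: dA|rewrite -derive1E].
- apply: cvgA => //.
  move=> x; apply: cvg_near_cst; near=> n.
  rewrite patchE mem_set//= in_itv/=.
  near: n; exact: nbhs_infty_ger.
- have -> : 0 = (\int[leb]_t (cst 0 t))%R :> R by rewrite Rintegral_cst// mul0r.
  apply: cvgA => // x; apply: cvg_near_cst; near=> n.
  rewrite patchE memNset//= in_itv/=; apply/negP; rewrite -ltNge ltrNl.
  near: n; exact: nbhs_infty_gtr.
Unshelve. all: by end_near. Qed.
End Calculus.

(** * Estimates for the Gaussian density *)

Section Gaussian.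
Variable R : realType.
Notation leb := (@lebesgue_measure R).
Implicit Types (h H Q : R -> R) (c w x K : R).

Definition gauss_pdf (x : R) : R := normal_pdf 0 1 x.

Lemma gauss_pdfE x : gauss_pdf x = normal_peak 1 * expR (- (x ^+ 2 / 2)).
Proof.
rewrite /gauss_pdf normal_pdfE ?oner_neq0// /normal_fun.
by rewrite subr0 expr1n mulNr.
Qed.

Lemma gauss_pdf_gt0 x : 0 < gauss_pdf x.
Proof. by rewrite gauss_pdfE mulr_gt0 ?expR_gt0 ?normal_peak_gt0 ?oner_neq0. Qed.

Lemma gauss_pdfN x : gauss_pdf (- x) = gauss_pdf x.
Proof. by rewrite !gauss_pdfE sqrrN. Qed.

Lemma normal_peak_le1 : normal_peak (1 : R) <= 1.
Proof.
rewrite invf_le1 ?sqrtr_gt0; last by rewrite expr1n mul1r pmulrn_lgt0// pi_gt0.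
rewrite -{1}sqrtr1 ler_sqrt expr1n mul1r ?mulr2n; have := pi_ge2 R; lra.
Qed.

Lemma gauss_pdf_le x : gauss_pdf x <= (1 + x ^+ 2 / 2)^-1.
Proof.
have h0 : 0 < 1 + x ^+ 2 / 2 by have := sqr_ge0 x; lra.
rewrite gauss_pdfE expRN (@le_trans _ _ (expR (x ^+ 2 / 2))^-1)//.
  by rewrite ler_piMl ?invr_ge0 ?expR_ge0// normal_peak_le1.
by rewrite lef_pV2 ?posrE ?expR_gt0//; exact: expR_ge1Dx.
Qed.

Lemma gauss_pdf_le1 x : gauss_pdf x <= 1.
Proof.
apply: le_trans (gauss_pdf_le x) _; rewrite invf_le1; have := sqr_ge0 x; lra.
Qed.

Lemma is_derive_gauss_pdf x : is_derive x 1 gauss_pdf (- x * gauss_pdf x).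
Proof.
rewrite (_ : gauss_pdf = fun y => normal_peak 1 * expR (- (y ^+ 2 / 2))); last first.
  by apply/funext => y; rewrite gauss_pdfE.
apply: is_derive_eq; rewrite /GRing.scale/=.
by field.
Qed.

Lemma continuous_gauss_pdf : continuous gauss_pdf.
Proof. by apply: continuous_normal_pdf; exact: oner_neq0. Qed.

Lemma cvg_gauss_pdf : gauss_pdf n%:R @[n --> \oo] --> (0 : R).
Proof.
apply: (@squeeze_cvgr _ _ _ _ (cst 0) (fun n => 2 * n.+1%:R^-1)).
- apply: nearW => n; rewrite ltW ?gauss_pdf_gt0//=.
  apply: le_trans (gauss_pdf_le _) _.
  have n1 : 0 < n.+1%:R / 2 :> R by rewrite divr_gt0.
  have x1 : 0 < 1 + n%:R ^+ 2 / 2 :> R by have := sqr_ge0 (n%:R : R); lra.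
  rewrite -[leRHS]invrK invfM invrK mulrC lef_pV2 ?posrE//.
  by rewrite -(natr1 n); have := sqr_ge0 (n%:R - 1 : R); have := ler0n R n; lra.
- exact: cvg_cst.
- by rewrite -[X in _ --> X](mulr0 2); apply: cvgMl_tmp; exact: cvg_harmonic.
Qed.

(** The normal density of variance 2 dominates: half of the Gaussian exponent absorbs the linear
    factor, since [1 + |x|] is at most [2 * expR (x ^+ 2 / 4)]. *)
Lemma integrable_gauss_lin (g : R -> R) K : continuous g ->
  (forall x, `|g x| <= K * (1 + `|x|)) ->
  leb.-integrable [set: R] (EFin \o (fun x => g x * gauss_pdf x)).
Proof.
move=> cg gK.
have K0 : 0 <= K by have := gK 0; rewrite normr0 addr0 mulr1; exact: le_trans.
pose s : R := Num.sqrt 2.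
have s0 : s != 0 by rewrite gt_eqF// sqrtr_gt0.
have dom x : `|g x * gauss_pdf x| <= K * normal_peak 1 * 2 / normal_peak s * normal_pdf 0 s x.
  rewrite normrM (gtr0_norm (gauss_pdf_gt0 _)).
  apply: le_trans (ler_wpM2r (ltW (gauss_pdf_gt0 _)) (gK x)) _.
  have := normal_peak_gt0 s0 => ps.
  rewrite normal_pdfE// /normal_fun subr0.
  rewrite sqr_sqrtr// gauss_pdfE -!mulrA ler_wpM2l//.
  rewrite mulrCA ler_wpM2l ?normal_peak_ge0// [X in _ <= _ * X]mulrA mulVf ?gt_eqF// mul1r.
  have -> : - (x * (x / 2)) = - (x ^+ 2 / 4) + - (x ^+ 2 / 4) by field.
  have -> : - x ^+ 2 / (2 *+ 2) = - (x ^+ 2 / 4) by rewrite mulNr -mulr_natr -natrM.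
  rewrite expRD mulrA ler_wpM2r ?expR_ge0// expRN ler_pdivrMr ?expR_gt0//.
  have := expR_ge1Dx (x ^+ 2 / 4); have := sqr_ge0 (`|x| / 2 - 1).
  rewrite sqrrB1 exprMn real_normK ?num_real// => h1 h2.
  have := normr_ge0 x; nra.
have ipdf := @integrable_normal_pdf R 0 s.
apply: (@le_integrable _ _ _ leb _ measurableT _
  (EFin \o (fun x => K * normal_peak 1 * 2 / normal_peak s * normal_pdf 0 s x))).
- apply/measurable_EFinP; apply: measurable_funM.
    exact: continuous_measurable_fun.
  by apply: continuous_measurable_fun; exact: continuous_gauss_pdf.
- move=> x _ /=; rewrite lee_fin; apply: le_trans (dom x) _; exact: ler_norm.
- under [X in integrable _ _ X]eq_fun do rewrite /= EFinM.
  exact: integrableZl.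
Qed.

(** Each tail estimate below applies this to the difference of its two sides, which reduces it to
    the sign of a derivative and a limit at infinity. *)
Lemma is_derive_ge_lim (D dD : R -> R) w l :
  (forall x : R, is_derive x 1 D (dD x)) -> (forall x, w <= x -> dD x <= 0) ->
  D n%:R @[n --> \oo] --> l -> l <= D w.
Proof.
move=> DdD dD0 Dl.
rewrite -(cvg_lim _ Dl)//; apply: limr_le; first by apply/cvg_ex; exists l.
near=> n.
have wn : w <= n%:R by near: n; exact: nbhs_infty_ger.
rewrite -lerN2; apply: (@is_derive_le _ (\- D) (\- dD)) => //.
by move=> x /andP[wx _]; rewrite oppr_ge0 dD0.
Unshelve. all: by end_near. Qed.
End Gaussian.

(** * Tail inequalities behind the Stein solution *)

Section SteinTail.
Variables (R : realType) (h H Q : R -> R) (c K : R).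
Hypotheses (h_noninc : forall x y, x <= y -> h y <= h x)
  (h_growth : forall x, `|h x - c| <= K * (1 + `|x|))
  (H_der : forall x : R, is_derive x 1 H ((h x - c) * gauss_pdf x))
  (H_lim : H n%:R @[n --> \oo] --> (0 : R))
  (Q_der : forall x : R, is_derive x 1 Q (- gauss_pdf x))
  (Q_lim : Q n%:R @[n --> \oo] --> (0 : R)).
Implicit Types w x : R.

Let gK : forall x, 0 < gauss_pdf x := @gauss_pdf_gt0 R.

(** [H] and [Q] are known only by their derivatives and limits, so that the estimates also apply to
    the reflected functions that handle negative arguments. The difference has derivative
    [(h x - h w) * gauss_pdf x]. *)
Lemma tail_lower_bound w : (c - h w) * Q w <= H w.
Proof.
rewrite -subr_ge0.
apply: (@is_derive_ge_lim _ (fun x => H x - (c - h w) * Q x)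
  (fun x => (h x - h w) * gauss_pdf x) w).
- by move=> x; apply: is_derive_eq; rewrite /GRing.scale/=; ring.
- by move=> x wx; rewrite mulr_le0_ge0 ?subr_le0 ?h_noninc// ltW.
- rewrite -[X in _ --> X](subrr 0) -[X in _ --> _ - X](mulr0 (c - h w)).
  by apply: cvgB => //; exact: cvgMl_tmp.
Qed.

Lemma tail_ge0 w : 0 <= Q w.
Proof.
apply: (@is_derive_ge_lim _ _ (fun x => - gauss_pdf x) w _ Q_der) => // x _.
by rewrite oppr_le0 ltW.
Qed.

(** The classical lower bound for Mills' ratio: after division by [1 + w ^+ 2] the difference has
    derivative [- 2 * gauss_pdf x / (1 + x ^+ 2) ^+ 2]. *)
Lemma mills_lower w : w * gauss_pdf w <= (1 + w ^+ 2) * Q w.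
Proof.
have d0 x : 0 < 1 + x ^+ 2 by have := sqr_ge0 x; lra.
rewrite -ler_pdivrMl// -subr_ge0.
apply: (@is_derive_ge_lim _ (fun x => Q x - (1 + x ^+ 2)^-1 * (x * gauss_pdf x))
  (fun x => - (2 * gauss_pdf x / (1 + x ^+ 2) ^+ 2)) w).
- move=> x.
  have dg := is_derive_gauss_pdf x.
  have dn0 : 1 + x ^+ 2 != 0 by rewrite gt_eqF.
  have dinv : is_derive x 1 (fun y : R => (1 + y ^+ 2)^-1) (- (1 + x ^+ 2) ^- 2 * (2 * x)).
    apply: is_derive_eq; rewrite /GRing.scale/=; ring.
  by apply: is_derive_eq; rewrite /GRing.scale/=; field; rewrite dn0.
- by move=> x _; rewrite oppr_le0 mulr_ge0 ?invr_ge0 ?sqr_ge0 ?mulr_ge0// ltW.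
- rewrite -[X in _ --> X](subrr 0); apply: cvgB => //.
  apply: (@squeeze_cvgr _ _ _ _ (cst 0) (fun n => gauss_pdf n%:R)).
  + apply: nearW => n.
    rewrite !mulr_ge0 ?invr_ge0 ?(ltW (d0 _)) ?(ltW (gK _))//=.
    rewrite mulrA ler_piMl ?(ltW (gK _))// ler_pdivrMl// mulr1.
    by have := sqr_ge0 (n%:R - 1 : R); have := ler0n R n; nra.
  + exact: cvg_cst.
  + exact: cvg_gauss_pdf.
Qed.

Lemma mills_upper w : w * Q w <= gauss_pdf w.
Proof.
rewrite -subr_ge0.
apply: (@is_derive_ge_lim _ (fun x => gauss_pdf x - w * Q x)
  (fun x => (w - x) * gauss_pdf x) w).
- move=> x; have dg := is_derive_gauss_pdf x.
  by apply: is_derive_eq; rewrite /GRing.scale/=; ring.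
- by move=> x wx; rewrite mulr_le0_ge0 ?subr_le0// ltW.
- rewrite -[X in _ --> X](subrr 0) -[X in _ --> _ - X](mulr0 w).
  by apply: cvgB; [exact: cvg_gauss_pdf|exact: cvgMl_tmp].
Qed.

Lemma tail_upper_bound w : 0 <= w -> H w <= K * (Q w + gauss_pdf w).
Proof.
move=> w0; rewrite -subr_ge0.
apply: (@is_derive_ge_lim _ (fun x => K * (Q x + gauss_pdf x) - H x)
  (fun x => - (K * (1 + x) + (h x - c)) * gauss_pdf x) w).
- move=> x; have dg := is_derive_gauss_pdf x.
  by apply: is_derive_eq; rewrite /GRing.scale/=; ring.
- move=> x wx; rewrite mulr_le0_ge0 ?oppr_le0 ?(ltW (gK _))//.
  have := h_growth x; rewrite (ger0_norm (le_trans w0 wx)) ler_norml => /andP[+ _].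
  lra.
- suff : K * (Q n%:R + gauss_pdf n%:R) - H n%:R @[n --> \oo] --> K * (0 + 0) - (0 : R).
    by rewrite addr0 mulr0 subr0.
  apply: cvgB => //; apply: cvgMl_tmp; apply: cvgD => //; exact: cvg_gauss_pdf.
Qed.

Hypothesis H_ge0 : forall x, 0 <= H x.

(** Up to the factor [gauss_pdf w], this is the derivative of [w * H w / gauss_pdf w]. When
    [h w < c], the sign comes from [tail_lower_bound] followed by [mills_lower]. *)
Lemma tail_mono_bound w : 0 <= w ->
  0 <= (1 + w ^+ 2) * H w + w * (h w - c) * gauss_pdf w.
Proof.
move=> w0; have g0 := gK w; have H0 := H_ge0 w; have s0 := sqr_ge0 w.
have [hc|hc] := leP c (h w).
  apply: addr_ge0; first by apply: mulr_ge0 => //; lra.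
  by rewrite !mulr_ge0 ?subr_ge0 ?(ltW g0).
have w1 : 0 <= 1 + w ^+ 2 by lra.
have c1 : 0 <= c - h w by lra.
have := ler_wpM2l w1 (tail_lower_bound w); have := ler_wpM2l c1 (mills_lower w).
lra.
Qed.

Lemma tail_growth_bound w : 0 <= w -> w * H w <= K * (1 + w) * gauss_pdf w.
Proof.
move=> w0; have := ler_wpM2l w0 (tail_upper_bound w0).
have K0 : 0 <= K by have := h_growth 0; rewrite normr0 addr0 mulr1; exact: le_trans.
have := ler_wpM2l K0 (mills_upper w); nra.
Qed.

End SteinTail.

(** * Solving Stein's equation for monotone test functions *)

Section SteinEquation.
Variable R : realType.
Notation leb := (@lebesgue_measure R).

Definition gauss_mean (h : R -> R) : R := (\int[leb]_x (h x * gauss_pdf x))%R.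

Lemma gauss_mean_cst c : gauss_mean (cst c) = c.
Proof.
rewrite /gauss_mean /Rintegral; under eq_integral do rewrite EFinM.
rewrite integralZl//; last exact: integrable_normal_pdf.
by rewrite integral_normal_pdf mule1.
Qed.

Lemma gauss_tail : exists Q : R -> R, [/\ forall x : R, is_derive x 1 Q (- gauss_pdf x),
  Q n%:R @[n --> \oo] --> (0 : R) & Q (- n%:R) @[n --> \oo] --> (1 : R)].
Proof.
have [dA A1 A0] := derive_cumulative (@continuous_gauss_pdf R) (integrable_normal_pdf 0 1).
set A := (fun x : R => Rintegral _ _ _) in dA A1 A0.
have eA : (\int[leb]_x gauss_pdf x)%R = 1 by rewrite /Rintegral integral_normal_pdf.
exists (fun x => 1 - A x); split.
- by move=> x; apply: is_derive_eq; rewrite add0r mul1r.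
- by rewrite -[X in _ --> X](subrr 1); apply: cvgB; [exact: cvg_cst|rewrite -{2}eA].
- by rewrite -[X in _ --> X](subr0 1); apply: cvgB; [exact: cvg_cst|].
Qed.

Lemma is_derive_reflect (F dF : R -> R) : (forall x : R, is_derive x 1 F (dF x)) ->
  forall x : R, is_derive x 1 (fun y => F (- y)) (- dF (- x)).
Proof.
move=> dF_ x.
have d1 : is_derive x (1 : R) (fun y : R => - y) (- 1) by apply: is_derive_eq.
have := @is_derive1_comp R F (fun y => - y) x (dF (- x)) (-1) (dF_ _) d1.
by rewrite mulrN1.
Qed.

(* The Stein solution [f] for a nonincreasing test function [h].  That [g w = w f w]
   is nondecreasing is what turns the Taylor remainder of [f] into an increment of
   the monotone function [G = g - h + c]. *)
Lemma stein_solution (h : R -> R) (K : R) :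
  continuous h -> (forall x y, x <= y -> h y <= h x) ->
  (forall x, `|h x - gauss_mean h| <= K * (1 + `|x|)) ->
  exists f f' G : R -> R, [/\
    forall w, f' w = w * f w + (h w - gauss_mean h),
    forall w w', `|f w - f w' - (w - w') * f' w| <= (w - w') * (G w - G w'),
    forall w, `|f' w| <= 2 * K * (1 + `|w|) &
    forall w, `|G w| <= 2 * K * (1 + `|w|)].
Proof.
move=> ch hdec hK; set c := gauss_mean h.
have chc : continuous (fun x => h x - c) by move=> x; apply: cvgB; [exact: ch|exact: cvg_cst].
have cq : continuous (fun x => (h x - c) * gauss_pdf x).
  by move=> x; apply: cvgM; [exact: chc|exact: continuous_gauss_pdf].
have iq := integrable_gauss_lin chc hK.
have [] := derive_cumulative cq iq; set H := (fun x : R => Rintegral _ _ _) => dH H1 H0.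
(* Centering by the Gaussian mean makes [H] vanish at both ends, so that both tails can be used. *)
have q0 : (\int[leb]_x ((h x - c) * gauss_pdf x))%R = 0.
  have hK' x : `|h x| <= (K + `|c|) * (1 + `|x|).
    have := ler_normD (h x - c) c; rewrite subrK => /le_trans; apply.
    rewrite mulrDl lerD// -[leLHS]mulr1 ler_wpM2l// lerDl//.
  have c1 (x : R) : `|cst c x| <= `|c| * (1 + `|x|) by rewrite -[leLHS]mulr1 ler_wpM2l// lerDl.
  have i1 := integrable_gauss_lin ch hK'.
  have i2 := integrable_gauss_lin (@cst_continuous R R c) c1.
  have -> : (\int[leb]_x ((h x - c) * gauss_pdf x))%R
     = (\int[leb]_x (h x * gauss_pdf x - cst c x * gauss_pdf x))%R.
    by apply: eq_Rintegral => x _; rewrite mulrBl.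
  rewrite RintegralB//.
  by rewrite -!/(gauss_mean _) gauss_mean_cst subrr.
rewrite q0 in H1.
have [Q [dQ Q1 Q0]] := gauss_tail.
(* The reflected function is again nonincreasing, with [- c] in place of [c] and primitive
   [H (- x)]; it carries the tail bounds over to negative arguments. *)
pose h' x := - h (- x).
have h'dec x y : x <= y -> h' y <= h' x by move=> xy; rewrite lerN2 hdec// lerN2.
have h'K x : `|h' x - - c| <= K * (1 + `|x|).
  rewrite (_ : h' x - - c = - (h (- x) - c)); last by rewrite opprB opprK addrC.
  by rewrite normrN -(normrN x).
have dH' (x : R) : is_derive x 1 (fun y => H (- y)) ((h' x - - c) * gauss_pdf x).
  by rewrite -opprD -gauss_pdfN mulNr; apply: (is_derive_reflect dH).
have dQ' (x : R) : is_derive x 1 (fun y => 1 - Q (- y)) (- gauss_pdf x).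
  have d1 := is_derive_reflect dQ x; rewrite opprK gauss_pdfN in d1.
  by apply: is_derive_eq; rewrite add0r mul1r.
have Q'1 : (1 - Q (- n%:R)) @[n --> \oo] --> (0 : R).
  by rewrite -[X in _ --> X](subrr 1); apply: cvgB; [exact: cvg_cst|].
(* The two tails bound [H x] below by nonnegative multiples of [c - h x] and of [h x - c], one of
   which is nonnegative. *)
have H_ge0 x : 0 <= H x.
  have := tail_lower_bound hdec dH H1 dQ Q1 x.
  have := tail_lower_bound h'dec dH' H0 dQ' Q'1 (- x).
  rewrite /h' !opprK => l1 l2.
  have Q_ge0 := tail_ge0 dQ Q1 x.
  have Q'_ge0 := tail_ge0 dQ' Q'1 (- x); rewrite !opprK in Q'_ge0.
  have [hc|hc] := leP c (h x).
    by apply: le_trans l1; rewrite mulr_ge0// addrC subr_ge0.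
  by apply: le_trans l2; rewrite mulr_ge0// subr_ge0 ltW.
have mono w : 0 <= (1 + w ^+ 2) * H w + w * (h w - c) * gauss_pdf w.
  have [w0|w0] := leP 0 w; first exact: (tail_mono_bound hdec dH H1 dQ Q1 H_ge0).
  have := tail_mono_bound h'dec dH' H0 dQ' Q'1 (fun x => H_ge0 (- x)) (_ : 0 <= - w).
  rewrite oppr_ge0 => /(_ (ltW w0)); rewrite /h' !opprK sqrrN gauss_pdfN.
  by rewrite (_ : - w * (- h w + c) = w * (h w - c))//; ring.
have growth w : `|w| * H w <= K * (1 + `|w|) * gauss_pdf w.
  have [w0|w0] := leP 0 w; first by rewrite ger0_norm//; exact: (tail_growth_bound hK dH H1 dQ Q1).
  have := tail_growth_bound h'K dH' H0 dQ' Q'1 (_ : 0 <= - w).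
  by rewrite oppr_ge0 => /(_ (ltW w0)); rewrite !opprK gauss_pdfN ltr0_norm.
have g0 := @gauss_pdf_gt0 R.
pose f w := H w / gauss_pdf w; pose f' w := w * f w + (h w - c).
pose G w := w * f w - (h w - c).
have wfK w : `|w * f w| <= K * (1 + `|w|).
  have f0 : 0 <= f w by rewrite divr_ge0// ltW.
  by rewrite normrM (ger0_norm f0) mulrA ler_pdivrMr.
have df (x : R) : is_derive x 1 f (f' x).
  have dg := is_derive_gauss_pdf x; have gx : gauss_pdf x != 0 by rewrite gt_eqF.
  by apply: is_derive_eq; rewrite /GRing.scale/= /f' /f; field.
have gmono x y : x <= y -> x * f x <= y * f y.
  move=> xy; apply: (@is_derive_le _ (fun x => x * f x) (fun x => f x + x * f' x)) => //.
    by move=> z; apply: is_derive_eq; rewrite /GRing.scale/=; ring.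
  move=> z _; have gz : gauss_pdf z != 0 by rewrite gt_eqF.
  rewrite (_ : _ + _ = ((1 + z ^+ 2) * H z + z * (h z - c) * gauss_pdf z) / gauss_pdf z).
    by rewrite divr_ge0// ltW.
  by rewrite /f' /f; field.
exists f, f', G; split=> //.
(* By the mean value theorem the remainder is [(w - w') * (f' z - f' w)] with [z] in between. As
   [f'] is the sum of the nondecreasing [w * f w] and the nonincreasing [h w - c], its variation is
   at most the increment of their difference [G]. *)
- move=> w w'.
  have fcont a b : {within `[a, b], continuous f}.
    by apply: continuous_subspaceT => x; exact: is_derive_continuous (df x).
  have [ww'|/ltW ww'] := leP w' w.
    have [z zab e] := MVT_segment ww' (fun x _ => df x) (fcont _ _).
    move: zab; rewrite in_itv/= => /andP[wz zw].
    rewrite e mulrC -mulrBr normrM ger0_norm ?subr_ge0// ler_wpM2l ?subr_ge0//.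
    have := gmono _ _ wz; have := gmono _ _ zw; have := hdec _ _ wz; have := hdec _ _ zw.
    by rewrite /G /f' ler_norml; lra.
  have [z zab e] := MVT_segment ww' (fun x _ => df x) (fcont _ _).
  move: zab; rewrite in_itv/= => /andP[wz zw].
  have -> : f w - f w' - (w - w') * f' w = (w' - w) * (f' w - f' z).
    by rewrite -[f w - f w']opprB e; ring.
  have -> : (w - w') * (G w - G w') = (w' - w) * (G w' - G w) by ring.
  rewrite normrM ger0_norm ?subr_ge0// ler_wpM2l ?subr_ge0//.
  have := gmono _ _ wz; have := gmono _ _ zw; have := hdec _ _ wz; have := hdec _ _ zw.
  by rewrite /G /f' ler_norml; lra.
- move=> w; apply: le_trans (ler_normD _ _) _; have := wfK w; have := hK w; lra.
- move=> w; apply: le_trans (ler_normB _ _) _; have := wfK w; have := hK w; lra.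
Qed.
End SteinEquation.

(** * Integrals against the normal law *)

Section NormalProb.
Variable R : realType.
Notation leb := (@lebesgue_measure R).
Local Notation N01 := (@normal_prob R 0 1).

(** The Radon-Nikodym derivative of the normal law has the same integral as [gauss_pdf] over every
    measurable set, so the two agree almost everywhere. *)
Lemma ge0_integral_normal_prob (f : R -> \bar R) :
  (forall x, 0 <= f x)%E -> measurable_fun [set: R] f ->
  (\int[N01]_x f x = \int[leb]_x (f x * (gauss_pdf x)%:E))%E.
Proof.
move=> f0 mf.
have dom := @normal_prob_dominates R 0 1.
rewrite -(Radon_Nikodym_SigmaFinite.change_of_variables dom)//.
apply: ae_eq_integral => //.
- apply: emeasurable_funM => //.
  exact: measurable_int (Radon_Nikodym_SigmaFinite.f_integrable dom).
- apply: emeasurable_funM => //; apply/measurable_EFinP.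
  exact: measurable_normal_pdf.
- apply: ae_eqe_mul2l; apply: integral_ae_eq => //.
  + exact: Radon_Nikodym_SigmaFinite.f_integrable.
  + by apply/measurable_EFinP; exact: measurable_normal_pdf.
  + by move=> E _ mE; rewrite -Radon_Nikodym_SigmaFinite.f_integral.
Qed.

Lemma integral_normal_prob (f : R -> R) : measurable_fun [set: R] f ->
  (\int[N01]_x (f x)%:E = \int[leb]_x (f x * gauss_pdf x)%:E)%E.
Proof.
move=> mf; have g0 x := ltW (@gauss_pdf_gt0 R x).
rewrite [LHS]integralE [RHS]integralE.
have mf' : measurable_fun [set: R] (EFin \o f) by exact/measurable_EFinP.
rewrite !ge0_integral_normal_prob//.
- congr (_ - _)%E; apply: eq_integral => x _.
    by rewrite !funeposE -!EFin_max -EFinM maxr_pMl// mul0r.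
  by rewrite !funenegE -!EFinN -!EFin_max -EFinM maxr_pMl// mul0r mulNr.
- exact: measurable_funeneg.
- exact: measurable_funepos.
Qed.

Lemma normal_prob_cdf t : N01 `]-oo, t] = (\int[leb]_(x in `]-oo, t]) gauss_pdf x)%R%:E.
Proof.
rewrite /normal_prob /Rintegral fineK//.
apply: integrable_fin_num => //.
exact: integrableS (integrable_normal_pdf 0 1).
Qed.
End NormalProb.

(** * From Stein bounds to the two distances *)

Section Distances.
Variable R : realType.
Notation leb := (@lebesgue_measure R).

Definition gauss_cdf (t : R) : R := (\int[leb]_(x in `]-oo, t]) gauss_pdf x)%R.

Lemma gauss_cdf_lipschitz (s t : R) : s <= t -> gauss_cdf t - gauss_cdf s <= t - s.
Proof.
move=> st; have [dA _ _] :=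
  derive_cumulative (@continuous_gauss_pdf R) (integrable_normal_pdf 0 1).
suff : s - gauss_cdf s <= t - gauss_cdf t by lra.
apply: (@is_derive_le _ (fun x => x - gauss_cdf x) (fun x => 1 - gauss_pdf x)) => //.
by move=> x _; rewrite subr_ge0 gauss_pdf_le1.
Qed.

Lemma le_gauss_mean (g h : R -> R) (K L : R) :
  continuous g -> (forall x, `|g x| <= K * (1 + `|x|)) ->
  continuous h -> (forall x, `|h x| <= L * (1 + `|x|)) ->
  (forall x, g x <= h x) -> gauss_mean g <= gauss_mean h.
Proof.
move=> cg gK ch hL gh; apply: le_Rintegral => //.
- exact: integrable_gauss_lin cg gK.
- exact: integrable_gauss_lin ch hL.
- by move=> x _; rewrite ler_wpM2r// ltW// gauss_pdf_gt0.
Qed.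

Lemma gauss_meanB (g h : R -> R) (K L : R) :
  continuous g -> (forall x, `|g x| <= K * (1 + `|x|)) ->
  continuous h -> (forall x, `|h x| <= L * (1 + `|x|)) ->
  gauss_mean (fun x => g x - h x) = gauss_mean g - gauss_mean h.
Proof.
move=> cg gK ch hL.
have ig := integrable_gauss_lin cg gK; have ih := integrable_gauss_lin ch hL.
rewrite /gauss_mean -RintegralB//.
by apply: eq_Rintegral => x _; rewrite mulrBl.
Qed.

Lemma growthB (g h : R -> R) (K L : R) :
  (forall x, `|g x| <= K * (1 + `|x|)) -> (forall x, `|h x| <= L * (1 + `|x|)) ->
  forall x, `|g x - h x| <= (K + L) * (1 + `|x|).
Proof. by move=> gK hL x; rewrite mulrDl (le_trans (ler_normB _ _))// lerD. Qed.

(** With [A] the primitive of [x * gauss_pdf x], the sum [A + gauss_pdf] is constant. The density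
    being even, [A] agrees at [n] and [- n], where the limits are the mean and 0. *)
Lemma gauss_mean_id : gauss_mean (fun x : R => x) = 0.
Proof.
have idK (x : R) : `|x| <= 1 * (1 + `|x|) by rewrite mul1r lerDr.
have cid_ : continuous (fun x : R => x) by move=> x; exact: cvg_id.
have cq : continuous (fun x : R => x * gauss_pdf x).
  by move=> x; apply: cvgM; [exact: cvg_id|exact: continuous_gauss_pdf].
have [] := derive_cumulative cq (integrable_gauss_lin cid_ idK).
set A := (fun x : R => Rintegral _ _ _) => dA A1 A0.
have e n : A n%:R = A (- n%:R).
  have d0 (x : R) : is_derive x 1 (fun y => A y + gauss_pdf y) 0.
    have dg := is_derive_gauss_pdf x.
    by apply: is_derive_eq; rewrite mulNr addrN.
  apply: (@addIr _ (gauss_pdf n%:R)); rewrite -[in RHS]gauss_pdfN.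
  have nn : - n%:R <= n%:R :> R by rewrite -subr_ge0 opprK addr_ge0.
  apply/eqP; rewrite eq_le; apply/andP; split.
    rewrite -lerN2.
    apply: (@is_derive_le _ (fun y => - (A y + gauss_pdf y)) (fun=> 0) _ _ nn) => //.
    by move=> x; have := d0 x => d0x; apply: is_derive_eq; rewrite oppr0.
  exact: (@is_derive_le _ (fun y => (A y + gauss_pdf y)) (fun=> 0) _ _ nn).
have A1' : A n%:R @[n --> \oo] --> (0 : R) by under eq_fun do rewrite e.
exact: (cvg_unique _ A1 A1').
Qed.

Definition ramp (s d x : R) : R := Num.max 0 (Num.min 1 ((s + d - x) / d)).

Section Ramp.
Variables (s d : R).
Hypothesis d0 : 0 < d.

Lemma continuous_ramp : continuous (ramp s d).
Proof.
move=> x; apply: (@continuous_max _ _ (cst 0) _ x); first exact: cvg_cst.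
apply: (@continuous_min _ _ (cst 1) _ x); first exact: cvg_cst.
apply: cvgM; last exact: cvg_cst.
by apply: cvgB; [exact: cvg_cst|exact: cvg_id].
Qed.

Lemma ramp_noninc x y : x <= y -> ramp s d y <= ramp s d x.
Proof.
move=> xy; rewrite /ramp !ge_max le_max lexx/= le_max.
apply/orP; right; rewrite le_min ge_min lexx/= ge_min.
by apply/orP; right; rewrite ler_wpM2r ?invr_ge0 ?(ltW d0)//; lra.
Qed.

Lemma ramp_ge0 x : 0 <= ramp s d x. Proof. by rewrite /ramp le_max lexx. Qed.

Lemma ramp_le1 x : ramp s d x <= 1.
Proof. by rewrite /ramp ge_max ler01 ge_min lexx. Qed.

Lemma ramp_eq1 x : x <= s -> ramp s d x = 1.
Proof.
move=> xs; rewrite /ramp min_l ?max_r// ler_pdivlMr//; lra.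
Qed.

Lemma ramp_eq0 x : s + d <= x -> ramp s d x = 0.
Proof.
move=> xs; rewrite /ramp max_l// ge_min; apply/orP; right.
by rewrite pmulr_lle0 ?invr_gt0//; lra.
Qed.

Lemma ramp_growth x : `|ramp s d x| <= 1 * (1 + `|x|).
Proof.
by rewrite mul1r ger0_norm ?ramp_ge0// (le_trans (ramp_le1 _))// lerDl.
Qed.

Lemma integrable_gauss_pdf_itv (t : R) :
  leb.-integrable [set: R] (EFin \o (@gauss_pdf R \_ `]-oo, t])).
Proof.
rewrite -restrict_EFin; apply/(integrable_mkcond _ _).1 => //.
exact: integrableS (integrable_normal_pdf 0 1).
Qed.

Lemma gauss_mean_ramp_ge : gauss_cdf s <= gauss_mean (ramp s d).
Proof.
rewrite /gauss_cdf Rintegral_mkcond; apply: le_Rintegral => //.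
- exact: integrable_gauss_pdf_itv.
- exact: integrable_gauss_lin continuous_ramp ramp_growth.
move=> x _; rewrite patchE; case: ifPn => [|_].
  by rewrite inE/= in_itv/= => xs; rewrite ramp_eq1// mul1r.
by rewrite mulr_ge0 ?ramp_ge0// ltW// gauss_pdf_gt0.
Qed.

Lemma gauss_mean_ramp_le : gauss_mean (ramp s d) <= gauss_cdf (s + d).
Proof.
rewrite /gauss_cdf Rintegral_mkcond; apply: le_Rintegral => //.
- exact: integrable_gauss_lin continuous_ramp ramp_growth.
- exact: integrable_gauss_pdf_itv.
move=> x _; rewrite patchE; case: ifPn => [_|].
  by rewrite ler_piMl ?ramp_le1// ltW// gauss_pdf_gt0.
rewrite notin_setE/= in_itv/= => /negP; rewrite -ltNge => /ltW xs.
by rewrite ramp_eq0// mul0r.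
Qed.

Lemma gauss_mean_ramp01 : 0 <= gauss_mean (ramp s d) <= 1.
Proof.
have c0 (x : R) : `|cst 0 x| <= 1 * (1 + `|x|).
  by rewrite normr0 mul1r addr_ge0.
have c1 (x : R) : `|cst 1 x| <= 1 * (1 + `|x|) by rewrite normr1 mul1r lerDl.
apply/andP; split; [rewrite -{1}(gauss_mean_cst 0)|rewrite -[leRHS](gauss_mean_cst 1)].
  apply: (@le_gauss_mean _ _ 1 1) => //.
  - by move=> x; exact: cvg_cst.
  - exact: continuous_ramp.
  - exact: ramp_growth.
  - exact: ramp_ge0.
apply: (@le_gauss_mean _ _ 1 1) => //.
- exact: continuous_ramp.
- exact: ramp_growth.
- by move=> x; exact: cvg_cst.
- exact: ramp_le1.
Qed.

(** The constant 1 does not depend on the width [d]; this is why ramps can be made arbitrarily steep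
    at no cost. *)
Lemma ramp_centered_growth x :
  `|ramp s d x - gauss_mean (ramp s d)| <= 1 * (1 + `|x|).
Proof.
apply: (@le_trans _ _ 1); last by rewrite mul1r lerDl.
have := ramp_ge0 x; have := ramp_le1 x; have /andP[] := gauss_mean_ramp01.
by rewrite ler_norml; lra.
Qed.
End Ramp.

Section Lipschitz.
Variable phi : R -> R.
Hypothesis lip : forall x y, `|phi x - phi y| <= `|x - y|.

Lemma lipschitz1_continuous : continuous phi.
Proof.
move=> x; apply/cvgrPdist_le => /= e e0; near=> y.
apply: le_trans (lip _ _) _; near: y.
by have /cvgrPdist_le/(_ e e0) := @cvg_id _ (nbhs x).
Unshelve. all: by end_near. Qed.

Lemma lipschitz1_growth x : `|phi x| <= (1 + `|phi 0|) * (1 + `|x|).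
Proof.
have := lip x 0; have := ler_normD (phi x - phi 0) (phi 0); rewrite subrK subr0.
have := normr_ge0 x; have := normr_ge0 (phi 0); nra.
Qed.

Lemma integral_normal_prob_lipschitz1 :
  (\int[@normal_prob R 0 1]_x (phi x)%:E)%E = (gauss_mean phi)%:E.
Proof.
rewrite integral_normal_prob; last first.
  by apply: continuous_measurable_fun; exact: lipschitz1_continuous.
rewrite /gauss_mean /Rintegral fineK//; apply: integrable_fin_num => //.
exact: (integrable_gauss_lin lipschitz1_continuous lipschitz1_growth).
Qed.
End Lipschitz.

Section StandardizedLaw.
Variables (I : finType) (P Y : I -> R) (delta : R).
Hypotheses (P_ge0 : forall i, 0 <= P i) (EY : \sum_i P i * Y i = 0).
Hypothesis stein_bound : forall (h : R -> R) (K : R), continuous h ->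
  (forall x y, x <= y -> h y <= h x) ->
  (forall x, `|h x - gauss_mean h| <= K * (1 + `|x|)) ->
  `|\sum_i P i * h (Y i) - gauss_mean h| <= K * delta.

(** The indicator of []-oo, t]] lies between the ramps starting at [t - e] and at [t]. Passing from
    their Gaussian means to [gauss_cdf t] costs at most [e], the density being at most 1, and [e] is
    arbitrary. *)
Lemma kolmogorov_bound t : `|\sum_(i | Y i <= t) P i - gauss_cdf t| <= delta.
Proof.
apply/ler_addgt0Pr => e e0.
have Dle s : `|\sum_i P i * ramp s e (Y i) - gauss_mean (ramp s e)| <= delta.
  rewrite -[leRHS]mul1r; apply: stein_bound.
  - exact: continuous_ramp.
  - exact: ramp_noninc.
  - exact: ramp_centered_growth.
have up : \sum_(i | Y i <= t) P i <= \sum_i P i * ramp t e (Y i).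
  rewrite big_mkcond; apply: ler_sum => i _; case: ifPn => [h|_].
    by rewrite ramp_eq1// mulr1.
  by rewrite mulr_ge0// ramp_ge0.
have lo : \sum_i P i * ramp (t - e) e (Y i) <= \sum_(i | Y i <= t) P i.
  rewrite [leRHS]big_mkcond; apply: ler_sum => i _; case: ifPn => [h|].
    by rewrite ler_piMr// ramp_le1.
  by rewrite -ltNge => /ltW h; rewrite ramp_eq0 ?subrK// mulr0.
have := Dle t; have := Dle (t - e).
have := gauss_mean_ramp_le t e0; have := gauss_mean_ramp_ge (t - e) e0.
have := @gauss_cdf_lipschitz t (t + e); have := @gauss_cdf_lipschitz (t - e) t.
rewrite gerBl lerDl (ltW e0) => /(_ isT) + /(_ isT).
by rewrite !ler_norml; move: up lo; lra.
Qed.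

(** Subtracting the identity makes a 1-Lipschitz function nonincreasing and changes neither
    expectation, because both laws have mean zero. *)
Lemma wasserstein_bound phi : (forall x y, `|phi x - phi y| <= `|x - y|) ->
  `|\sum_i P i * phi (Y i) - gauss_mean phi| <= (2 + gauss_mean (fun x : R => `|x|)) * delta.
Proof.
move=> lip.
have cphi := lipschitz1_continuous lip; have phiK := lipschitz1_growth lip.
have idK (x : R) : `|x| <= 1 * (1 + `|x|) by rewrite mul1r lerDr.
have absK (x : R) : `| `|x| | <= 1 * (1 + `|x|) by rewrite normr_id.
have cabs : continuous (fun x : R => `|x|) by move=> x; exact: norm_continuous.
have cid_ : continuous (fun x : R => x) by move=> x; exact: cvg_id.
pose h x := phi x - x.
have hmean : gauss_mean h = gauss_mean phi.
  by rewrite (gauss_meanB cphi phiK cid_ idK) gauss_mean_id subr0.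
(* This makes the growth constant of the centered [h] independent of [phi]. *)
have phi0 : `|phi 0 - gauss_mean phi| <= gauss_mean (fun x : R => `|x|).
  have c0K (x : R) : `|cst (phi 0) x| <= `|phi 0| * (1 + `|x|).
    by rewrite -[leLHS]mulr1 ler_wpM2l// lerDl.
  have c0c : continuous (cst (phi 0) : R -> R) by move=> x; exact: cvg_cst.
  have := gauss_meanB cphi phiK cabs absK.
  have := gauss_meanB c0c c0K cabs absK; rewrite gauss_mean_cst => e1 e2.
  have l1 : gauss_mean (fun x => phi x - `|x|) <= gauss_mean (cst (phi 0)).
    apply: (le_gauss_mean _ (growthB phiK absK) c0c c0K) => x /=.
      by apply: cvgB; [exact: cphi|exact: cabs].
    by have := lip x 0; rewrite subr0 ler_norml; lra.
  have l2 : gauss_mean (fun x => cst (phi 0) x - `|x|) <= gauss_mean phi.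
    apply: (le_gauss_mean _ (growthB c0K absK) cphi phiK) => x /=.
      by apply: cvgB; [exact: cvg_cst|exact: cabs].
    by have := lip x 0; rewrite subr0 ler_norml; lra.
  by rewrite e2 gauss_mean_cst in l1; rewrite e1 in l2; rewrite ler_norml; lra.
have -> : \sum_i P i * phi (Y i) = \sum_i P i * h (Y i).
  by under [RHS]eq_bigr do rewrite mulrBr; rewrite sumrB EY subr0.
rewrite -hmean; apply: stein_bound.
- by move=> x; apply: cvgB; [exact: cphi|exact: cvg_id].
- move=> x y xy; have := lip y x; rewrite /h (ger0_norm (_ : 0 <= y - x)) ?subr_ge0//.
  by rewrite ler_norml; lra.
(* The centered [h] is at most [2 * |x|], from [phi] and from the identity, plus the bound
   [phi0]. *)
- move=> x; rewrite hmean /h.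
  have M0 : 0 <= gauss_mean (fun x : R => `|x|) by apply: le_trans phi0.
  have l1 := lip x 0; rewrite subr0 in l1.
  have := ler_normD (phi x - phi 0) (phi 0 - gauss_mean phi).
  have := ler_normB (phi x - gauss_mean phi) x.
  rewrite addrA subrK addrAC => a1 a2.
  have := normr_ge0 x; nra.
Qed.
End StandardizedLaw.
End Distances.

Local Open Scope ring_scope.

Lemma ustat_cst_gt0 (R : realType) (r : nat) : 0 < ustat_cst R r.
Proof.
rewrite /ustat_cst mulr_gt0//.
  by rewrite /stein_cst ltr_wpDr// mulr_ge0// sqrtr_ge0.
rewrite sqrtr_gt0 mulr_gt0// big_ord_recl expr0 ltr_wpDr//.
by apply: sumr_ge0 => v _; rewrite exprn_ge0.
Qed.

Theorem theorem4p1 (R : realType) (r : nat) :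
  exists C : R, 0 < C /\
  forall (n m : nat) (p : R) (h : r.-tuple (attr m) -> R),
    0 < p -> p < 1 ->
    symmetric_kernel h ->
    0 < rig_var p (Ustat (n:=n) h) ->
    let ht := htilde p h in
    let nR : R := n%:R in
    dKW_normal_le p (standardize p (Ustat (n:=n) h))
      (C * nR ^+ (2 * r) / rig_var p (Ustat (n:=n) h) *
       Num.sqrt (
         (\sum_(j < r.+1) \sum_(i < j)
            l2norm p (j - i) (contr p i j j (ht j) (ht j)) ^+ 2 / nR ^+ (3 * j - i))
       + (\sum_(j < r.+1) \sum_(1 <= i < j)
            (l2norm p ((j - i) + (j - i)) (contr p i i j (ht j) (ht j)) ^+ 2
               / nR ^+ (2 * j)
             + l2norm p (j - i) (contr p i i j (ht j) (ht i)) ^+ 2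
               / nR ^+ (j + i))))).
Proof.
pose M : R := gauss_mean (fun x : R => `|x|).
have M0 : 0 <= M.
  apply: Rintegral_ge0 => x _; rewrite mulr_ge0// ltW//; exact: gauss_pdf_gt0.
have C0 := ustat_cst_gt0 R r.
(* [2 + M] is the Wasserstein growth constant; it exceeds the constant 1 of the Kolmogorov part. *)
exists (ustat_cst R r * (2 + M)); split; first by rewrite mulr_gt0//; lra.
move=> n m p h p0 p1 hs V0 ht nR.
rewrite -/(contraction_sum n p h).
set V := rig_var p _; pose delta := ustat_cst R r * nR ^+ (2 * r) / V *
  Num.sqrt (contraction_sum n p h).
have delta0 : 0 <= delta.
  apply: mulr_ge0; last exact: sqrtr_ge0.
  apply: divr_ge0; last exact: ltW.
  by apply: mulr_ge0; [exact: ltW|rewrite exprn_ge0// /nR].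
have -> : ustat_cst R r * (2 + M) * nR ^+ (2 * r) / V * Num.sqrt (contraction_sum n p h)
    = (2 + M) * delta by rewrite /delta; ring.
set Y := standardize p _.
have P0 (c : config n m) : 0 <= config_prob p c.
  by apply: prodr_ge0 => k _; exact: mu_ge0.
have EY : \sum_(c : config n m) config_prob p c * Y c = 0.
  have := @W_mean0 R n m p r h hs.
  by rewrite (eq_expect _ (Wsum_standardize p hs)).
(* By Stein's equation the difference of means is the expectation of [g' w - w * g w] at [w = Y c],
   which [stein_Ustat] bounds. *)
have steinY (f : R -> R) (K : R) : continuous f -> (forall x y, x <= y -> f y <= f x) ->
    (forall x, `|f x - gauss_mean f| <= K * (1 + `|x|)) ->
    `|\sum_(c : config n m) config_prob p c * f (Y c) - gauss_mean f| <= K * delta.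
  move=> cf df fK; have [g [g' [G [g'E taylor g'K GK]]]] := stein_solution cf df fK.
  have := stein_Ustat p0 p1 hs V0 taylor g'K GK.
  rewrite -/Y -/delta; apply: le_trans; rewrite le_eqVlt; apply/orP; left; apply/eqP.
  congr (`| _ |); rewrite -expectB.
  transitivity (expect (mu p) (fun c : config n m => f (Y c) - gauss_mean f)).
    by rewrite expectB expect_cst// mu_sum1.
  by apply: eq_expect => c; rewrite g'E; ring.
split=> [t|phi lip].
  rewrite normal_prob_cdf -EFinB abse_EFin lee_fin.
  apply: le_trans (kolmogorov_bound P0 steinY t) _.
  by rewrite ler_peMl//; lra.
rewrite integral_normal_prob_lipschitz1// -EFinB abse_EFin lee_fin.
exact: (wasserstein_bound EY steinY lip).
Qed.
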